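(* Let $\alpha\in(\tfrac13,1)$ and let $p_0\in(0,\tfrac1{1000}]$ be such that $\alpha\le\frac1{1+2p_0}$. For every $t\in\mathbb{R}^+$ and every function $f$ on $\mathbb{R}$ for which the right-hand side is finite, one has the dispersive estimate $$\|e^{\mathrm{i}t(-\Delta)^{\frac{\alpha}{2}}}f\|_{L^\infty}\lesssim (1+t)^{-\frac12}\big\||\xi|^{\frac{2-\alpha}{2}}\hat f(\xi)\big\|_{L^\infty_\xi}+(1+t)^{-(\frac12+p_0)}\big(\|f\|_{H^2}+\|x\cdot\partial f\|_{L^2}\big).$$
   Context: $(-\Delta)^{\alpha/2}$ is the Fourier multiplier on $\mathbb{R}$ with symbol $|\xi|^\alpha$, so $e^{\mathrm{i}t(-\Delta)^{\alpha/2}}$ has symbol $e^{\mathrm{i}t|\xi|^\alpha}$. The hat denotes the Fourier transform on $\mathbb{R}$; $\partial=\partial_x$. The notation $A\lesssim B$ means $A\le CB$ for some universal constant $C$ independent of $A,B$ (in particular of $t$ and $f$). *)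

(* Defs.v *)
From HB Require Import structures.
From mathcomp Require Import all_boot all_order all_algebra.
From mathcomp Require Import complex.
From mathcomp Require Import all_classical all_reals all_analysis.

Set Implicit Arguments.
Unset Strict Implicit.
Unset Printing Implicit Defensive.

Import Order.TTheory GRing.Theory Num.Theory.
Import numFieldNormedType.Exports.

Local Open Scope classical_set_scope.
Local Open Scope ring_scope.
Local Open Scope complex_scope.

Section Definitions.
Context {R : realType}.
Implicit Types f g : R -> R[i].

Let mu := @lebesgue_measure R.

Definition cexpi (theta : R) : R[i] := cos theta +i* sin theta.

Definition Cintegral (D : set R) f : R[i] :=
  (\int[mu]_(x in D) complex.Re (f x))%R +i* (\int[mu]_(x in D) complex.Im (f x))%R.

Definition Cmeasurable f : Prop :=
  measurable_fun setT (@complex.Re R \o f) /\ measurable_fun setT (@complex.Im R \o f).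

Definition Cloc_integrable f : Prop :=
  locally_integrable setT (@complex.Re R \o f) /\
  locally_integrable setT (@complex.Im R \o f).

Definition CLnorm (p : \bar R) f : \bar R :=
  Lnorm mu p (fun x => (Normc.normc (f x))%:E).

Definition in_L2 f : Prop := Cmeasurable f /\ (CLnorm 2%:E f < +oo)%E.

(* The Fourier transform on L^2, normalised as the integral of
   e^(-i x xi) f(x) dx (so that the second derivative has symbol -xi^2).
   Since f need not be integrable, it is the limit in L^2 of the transforms of
   the truncations of f to [-n, n]; it is determined up to a null set. *)
Definition fourier_trunc f (n : nat) (xi : R) : R[i] :=
  Cintegral `[- n%:R, n%:R] (fun x => cexpi (- (x * xi)) * f x).

Definition is_fourier f g : Prop :=
  [/\ in_L2 f, in_L2 g &
      CLnorm 2%:E (fun xi => g xi - fourier_trunc f n xi) @[n --> \oo] --> 0%E].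

Definition fourier f : R -> R[i] := xget (fun=> 0) [set g | is_fourier f g].

Definition inv_fourier g : R -> R[i] :=
  fun x => ((2 * pi)^-1)%:C * fourier g (- x).

Definition fourier_multiplier (m : R -> R[i]) f : R -> R[i] :=
  inv_fourier (fun xi => m xi * fourier f xi).

(* e^(i t (-Laplacian)^(alpha/2)) *)
Definition frac_propagator (alpha t : R) f : R -> R[i] :=
  fourier_multiplier (fun xi => cexpi (t * `|xi| `^ alpha)) f.

Definition test_function (phi : R -> R) : Prop :=
  (forall (n : nat) (x : R), derivable (derive1n n phi) x 1) /\
  (exists M : R, forall x : R, M < `|x| -> phi x = 0).

Definition is_weak_derivative f g : Prop :=
  [/\ Cloc_integrable f, Cloc_integrable g &
      forall phi : R -> R, test_function phi ->
        Cintegral setT (fun x => (derive1 phi x)%:C * f x) =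
        - Cintegral setT (fun x => (phi x)%:C * g x)].

(* The weak derivative, well defined up to a null set; it is the junk value 0
   if f is not weakly differentiable. *)
Definition weak_derivative f : R -> R[i] :=
  xget (fun=> 0) [set g | is_weak_derivative f g].

Definition in_sobolev (m : nat) f : Prop :=
  (forall k, (k <= m)%N -> in_L2 (iter k weak_derivative f)) /\
  (forall k, (k < m)%N ->
    is_weak_derivative (iter k weak_derivative f)
                       (iter k.+1 weak_derivative f)).

(* Meaningful only when in_sobolev m f holds. *)
Definition sobolev_norm (m : nat) f : \bar R :=
  ((\sum_(k < m.+1) CLnorm 2%:E (iter k weak_derivative f) ^+ 2) `^ 2^-1)%E.

Definition x_partial f : R -> R[i] := fun x => x%:C * weak_derivative f x.

(* |xi|^((2 - alpha) / 2) fhat(xi) *)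
Definition weighted_fourier (alpha : R) f : R -> R[i] :=
  fun xi => (`|xi| `^ ((2 - alpha) / 2))%:C * fourier f xi.

End Definitions.

(* Main.v *)
(* Let F be the real or the imaginary part of the Fourier transform of f. The solution at
   (t, y) is made of oscillatory integrals of F(x) cos(t |x|^alpha - x y + th), and by
   reflection x > 0 may be assumed. Here |F(x)| <= A x^(alpha/2 - 1), while the L^2 norms of
   F, x^2 F and (x F)' are bounded by a multiple of B = ||f||_(H^2) + ||x f'||_2, which needs
   Bessel's inequality only.
   The regions x < t^(-1/alpha) and x > t^(1/2) cost O(B t^(-1/2 - p0)) by Cauchy-Schwarz.
   In between, with P = x (d/dx) of the phase and N = P^2 + 1 + t x^alpha, subtract from the
   integrand x F psi' with psi = sin(phase) P / N: since the phase is stationary at most once,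
   the remainder cos(phase) - x psi' is a resonance whose integral against x^(alpha/2 - 1) is
   O(t^(-1/2)), and duality bounds the integral of x F psi' by B ||psi||_2 = O(B t^(-1/2 - p0)).
   A bound for the truncated inverse transforms, which converge in L^2, passes to the limit
   almost everywhere. *)
Require Import Defs.
From HB Require Import structures.
From mathcomp Require Import all_boot all_order all_algebra.
From mathcomp Require Import complex ring lra.
From mathcomp Require Import all_classical all_reals all_analysis.
From mathcomp Require Import measurable_realfun ess_sup_inf.

Set Implicit Arguments.
Unset Strict Implicit.
Unset Printing Implicit Defensive.

Import Order.TTheory GRing.Theory Num.Theory.
Import numFieldNormedType.Exports.

Local Open Scope classical_set_scope.
Local Open Scope ring_scope.

(** * L1 and L2 bounds *)

Section NormBounds.
Context {R : realType}.
Implicit Types (f g : R -> R) (a b c : R).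
Local Notation mu := (@lebesgue_measure R).

(** The transform [F] has no pointwise derivative at hand: its dilation derivative is known only as
    a bounded functional. So nothing is integrated by parts against [F]; instead the oscillating
    factor itself is written as x psi' plus a remainder, with [psi] explicit. Non-stationary phase
    would take psi = sin(phase) / P, which is singular at the stationary point; P / N regularises
    it. Where P^2 dominates, P / N is close to 1 / P; near the stationary point N is of the order of
    U = t x^alpha, so psi stays of size at most U^(-1/2), and the remainder is governed by the ratio
    (1 + U) / N. The natural coordinate is u = U^(1/2). In it P vanishes at most linearly, so (1 +
    U) / N is dominated by Lorentzians of fixed width in u, while the weight x^(alpha/2 - 1) dx is
    du up to the factor 2 / (alpha t^(1/2)). This Jacobian is the source of the rate t^(-1/2),
    uniformly in the position y. Sine and cosine transforms are treated by a single real operator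
    with a phase shift; differentiation and the imaginary unit both become shifts by pi / 2. *)

Definition L1_le f c :=
  measurable_fun setT f /\ (\int[mu]_x `|f x|%:E <= c%:E)%E.

(** The constant enters through its square, so its sign has to be assumed separately wherever two
    bounds are multiplied, as in [L1_CS]. *)
Definition L2_le f c :=
  measurable_fun setT f /\ (\int[mu]_x (f x ^+ 2)%:E <= (c ^+ 2)%:E)%E.

Lemma L1_integrable f c : L1_le f c -> mu.-integrable setT (EFin \o f).
Proof.
move=> [mf fc]; apply/integrableP; split; first exact/measurable_EFinP.
by apply: le_lt_trans (ltry c); rewrite (le_trans _ fc).
Qed.

Lemma L1_Rintegral f c : L1_le f c -> `|\int[mu]_x f x| <= c.
Proof.
move=> fc; have fi := L1_integrable fc.
rewrite -lee_fin EFin_normr_Rintegral//.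
apply: le_trans _ fc.2; apply: le_trans.
  apply: (le_abse_integral mu measurableT).
  by apply/measurable_EFinP; exact: fc.1.
by [].
Qed.

Lemma integrable_L1 f : mu.-integrable setT (EFin \o f) ->
  L1_le f (\int[mu]_x `|f x|).
Proof.
move=> fi; split; first by apply/measurable_EFinP; exact: measurable_int fi.
rewrite /Rintegral fineK//; apply: integrable_fin_num => //.
exact: (integrable_abse fi).
Qed.

Lemma integrable_measurable f : mu.-integrable setT (EFin \o f) ->
  measurable_fun setT f.
Proof. by move=> fi; apply/measurable_EFinP; exact: measurable_int fi. Qed.

Lemma L1_dom_ae f g c : L1_le g c -> measurable_fun setT f ->
  {ae mu, forall x, `|f x| <= `|g x|} -> L1_le f c.
Proof.
move=> [mg gc] mf fg; split=> //; apply: le_trans gc.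
apply: ae_ge0_le_integral => //.
- by apply/measurable_EFinP; apply: measurableT_comp.
- by apply/measurable_EFinP; apply: measurableT_comp.
- by case: fg => N [mN N0 fgN]; exists N; split=> // x nfg; apply: fgN => /= fgx; apply: nfg => _; rewrite lee_fin.
Qed.

Lemma L1_dom f g c : L1_le g c -> measurable_fun setT f ->
  (forall x, `|f x| <= `|g x|) -> L1_le f c.
Proof. by move=> gc mf fg; apply: L1_dom_ae gc mf _; apply/aeW. Qed.

Lemma L2_dom f g c : L2_le g c -> measurable_fun setT f ->
  (forall x, `|f x| <= `|g x|) -> L2_le f c.
Proof.
move=> [mg gc] mf fg; split=> //; apply: le_trans gc.
apply: ge0_le_integral => //.
- by move=> x _; rewrite lee_fin sqr_ge0.
- by apply/measurable_EFinP; apply: measurable_funX.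
- by apply/measurable_EFinP; apply: measurable_funX.
- by move=> x _; rewrite lee_fin -(real_normK (num_real (f x))) -(real_normK (num_real (g x))) lerXn2r ?nnegrE.
Qed.

Lemma L1_D f g a b : L1_le f a -> L1_le g b ->
  L1_le (fun x => f x + g x) (a + b).
Proof.
move=> [mf fa] [mg gb]; split; first exact: measurable_funD.
apply: (@le_trans _ _ (\int[mu]_x (`|f x|%:E + `|g x|%:E))%E).
  apply: ge0_le_integral => //.
  - by apply/measurable_EFinP; apply: measurableT_comp => //; exact: measurable_funD.
  - apply: emeasurable_funD; apply/measurable_EFinP; exact: measurableT_comp.
  - by move=> x _; rewrite -EFinD lee_fin ler_normD.
rewrite ge0_integralD//; first by rewrite EFinD leeD.
- by apply/measurable_EFinP; exact: measurableT_comp.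
- by apply/measurable_EFinP; exact: measurableT_comp.
Qed.

Lemma L1_Z k f a : L1_le f a -> L1_le (fun x => k * f x) (`|k| * a).
Proof.
move=> [mf fa]; split; first exact: measurable_funM.
under eq_integral do rewrite normrM EFinM.
rewrite ge0_integralZl//; first by rewrite EFinM lee_wpmul2l// lee_fin.
by apply/measurable_EFinP; exact: measurableT_comp.
Qed.

Lemma L2_Z k f a : L2_le f a -> L2_le (fun x => k * f x) (`|k| * a).
Proof.
move=> [mf fa]; split; first exact: measurable_funM.
under eq_integral do rewrite exprMn EFinM.
rewrite ge0_integralZl//.
- by rewrite exprMn (EFinM (`|k| ^+ 2)) real_normK ?num_real// lee_wpmul2l// lee_fin sqr_ge0.
- by apply/measurable_EFinP; exact: measurable_funX.
- by move=> x _; rewrite lee_fin sqr_ge0.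
- by rewrite lee_fin sqr_ge0.
Qed.

Lemma L1_le_trans f a b : L1_le f a -> a <= b -> L1_le f b.
Proof. by move=> [mf fa] ab; split=> //; rewrite (le_trans fa)// lee_fin. Qed.

Lemma L1_const_ge0 f a : L1_le f a -> 0 <= a.
Proof.
by move=> [_ fa]; rewrite -lee_fin (le_trans _ fa)// integral_ge0.
Qed.

(* AM-GM with a free parameter avoids normalising by the possibly null norms. *)
Lemma L1_CS f g a b : 0 <= a -> 0 <= b -> L2_le f a -> L2_le g b ->
  L1_le (fun x => f x * g x) (a * b).
Proof.
move=> a0 b0 [mf fa] [mg gb]; split; first exact: measurable_funM.
have mX (h : R -> R) : measurable_fun setT h ->
    measurable_fun setT (fun x : R => (h x ^+ 2)%:E).
  by move=> mh; apply/measurable_EFinP; exact: measurable_funX.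
have g0 (h : R -> R) (x : R) : (0 <= (h x ^+ 2)%:E)%E by rewrite lee_fin sqr_ge0.
have main k : 0 < k -> (\int[mu]_x `|f x * g x|%:E <=
    (k / 2 * a ^+ 2 + (2 * k)^-1 * b ^+ 2)%:E)%E.
  move=> k0; apply: (@le_trans _ _ (\int[mu]_x ((k / 2)%:E * (f x ^+ 2)%:E
      + (2 * k)^-1%:E * (g x ^+ 2)%:E))%E).
    apply: ge0_le_integral => //.
    - by apply/measurable_EFinP; apply: measurableT_comp => //; exact: measurable_funM.
    - by apply: emeasurable_funD; apply: emeasurable_funM => //; exact: mX.
    - move=> x _; rewrite -!EFinM -EFinD lee_fin normrM.
      rewrite -(real_normK (num_real (f x))) -(real_normK (num_real (g x))).
      rewrite -subr_ge0.
      rewrite (_ : _ - _ = (2 * k)^-1 * (k * `|f x| - `|g x|) ^+ 2).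
        by rewrite mulr_ge0 ?sqr_ge0// invr_ge0 mulr_ge0// ltW.
      by field; rewrite gt_eqF.
  have k2 : (0 <= (k / 2)%:E)%E by rewrite lee_fin divr_ge0// ltW.
  have k3 : (0 <= (2 * k)^-1%:E)%E by rewrite lee_fin invr_ge0 mulr_ge0// ltW.
  rewrite ge0_integralD//.
  - rewrite !ge0_integralZl//; try by apply: mX.
    by rewrite EFinD !(EFinM _ (_ ^+ 2)) leeD// lee_wpmul2l.
  - by move=> x _; rewrite mule_ge0.
  - by apply: emeasurable_funM => //; exact: mX.
  - by move=> x _; rewrite mule_ge0.
  - by apply: emeasurable_funM => //; exact: mX.
have [a00|a00] := eqVneq a 0.
  rewrite a00 mul0r; apply/lee_addgt0Pr => e e0; rewrite add0e.
  (* With this parameter the surviving term is e b^2 / (b^2 + 1), at most e; the added 1 keeps the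
     parameter positive when b vanishes too. *)
  have k0 : 0 < (b ^+ 2 + 1) / (2 * e).
    by rewrite divr_gt0 ?ltr_wpDl ?sqr_ge0// mulr_gt0.
  apply: le_trans (main _ k0) _; rewrite a00 expr0n/= mulr0 add0r lee_fin.
  have b1 : 0 < b ^+ 2 + 1 by rewrite ltr_wpDl ?sqr_ge0.
  rewrite [leLHS](_ : _ = e * (b ^+ 2 / (b ^+ 2 + 1))).
    by rewrite ger_pMr// ler_pdivrMr// mul1r; lra.
  by field; rewrite !gt_eqF//.
have [b00|b00] := eqVneq b 0.
  rewrite b00 mulr0; apply/lee_addgt0Pr => e e0; rewrite add0e.
  have a2 : 0 < a ^+ 2 by rewrite exprn_gt0// lt_neqAle eq_sym a00.
  have k0 : 0 < (2 * e) / (a ^+ 2) by rewrite divr_gt0// mulr_gt0.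
  apply: le_trans (main _ k0) _; rewrite b00 expr0n/= mulr0 addr0 lee_fin.
  rewrite le_eqVlt; apply/orP; left; apply/eqP; field; exact: a00.
(* The minimiser b / a makes both halves equal to a b / 2. *)
have k0 : 0 < b / a by rewrite divr_gt0// lt_neqAle eq_sym ?a00 ?b00.
apply: le_trans (main _ k0) _; rewrite lee_fin le_eqVlt; apply/orP; left.
by apply/eqP; field; rewrite a00 b00.
Qed.

End NormBounds.

(** * Cosine transforms *)

Section CosineTransform.
Context {R : realType}.
Implicit Types (a b l : R -> R) (th : R).
Local Notation mu := (@lebesgue_measure R).
Local Notation integr f := (mu.-integrable setT (EFin \o f)).

Lemma integrableM_bounded (k : R -> R) a M : measurable_fun setT k ->
  (forall x, `|k x| <= M) -> integr a -> integr (fun x => k x * a x).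
Proof.
move=> mk kM ia; apply: (@L1_integrable _ _ (`|M| * \int[mu]_x `|a x|)).
apply: (@L1_dom _ _ (fun x => M * a x)).
- by apply: L1_Z; exact: integrable_L1.
- by apply: measurable_funM => //; exact: integrable_measurable.
- move=> x; rewrite !normrM ler_wpM2r// (le_trans (kM x))//; exact: ler_norm.
Qed.

Section Kernel.
Variables (k : R -> R -> R) (a b : R -> R) (M : R).
Hypothesis mk : measurable_fun setT (fun z : R * R => k z.1 z.2).
Hypothesis kM : forall x y, `|k x y| <= M.
Hypothesis ia : integr a.
Hypothesis ib : integr b.

Let M0 : 0 <= M. Proof. exact: le_trans (kM 0 0). Qed.

Let mk1 x : measurable_fun setT (k x).
Proof.
by rewrite (_ : k x = (fun z : R * R => k z.1 z.2) \o pair x)//; exact: measurableT_comp.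
Qed.

Let mk2 y : measurable_fun setT (k ^~ y).
Proof.
rewrite (_ : k ^~ y = (fun z : R * R => k z.1 z.2) \o (fun x => (x, y)))//.
exact: measurableT_comp.
Qed.

Let f (z : R * R) : \bar R := (a z.1 * (k z.1 z.2 * b z.2))%:E.

Let mf : measurable_fun setT f.
Proof.
apply/measurable_EFinP; apply: measurable_funM.
  by apply: measurableT_comp => //; exact: integrable_measurable.
by apply: measurable_funM => //; apply: measurableT_comp => //; exact: integrable_measurable.
Qed.

Let kb_int x : integr (fun y => k x y * b y).
Proof. exact: integrableM_bounded (kM x) ib. Qed.

Let ka_int y : integr (fun x => k x y * a x).
Proof. exact: integrableM_bounded (fun x => kM x y) ia. Qed.

Let f_int : (mu \x mu)%E.-integrable setT f.
Proof.
apply/integrable12ltyP => //.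
pose Ib := \int[mu]_y `|b y|.
apply: (@le_lt_trans _ _ (\int[mu]_x (`|a x| * (M * Ib))%:E)%E).
  apply: ge0_le_integral => //.
  - by move=> x _; exact: integral_ge0.
  - have mh : measurable_fun setT (abse \o f) by exact: measurableT_comp.
    by apply: (@measurable_fun_fubini_tonelli_F _ _ _ _ _ mu (abse \o f)) => // z; exact: abse_ge0.
  - apply/measurable_EFinP; apply: measurable_funM => //.
    by apply: measurableT_comp => //; exact: integrable_measurable.
  - move=> x _.
    have := L1_Z (a x) (integrable_L1 (kb_int x)).
    case=> _ h; apply: le_trans h _; rewrite lee_fin ler_wpM2l//.
    apply: le_trans (ler_norm _) (L1_Rintegral _).
    apply: (@L1_dom _ _ (fun y => M * b y)).
    - by rewrite -[M in X in L1_le _ X](ger0_norm M0); apply: L1_Z; exact: integrable_L1.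
    - by apply: measurableT_comp => //; apply: integrable_measurable.
    - by move=> y; rewrite normr_id !normrM ler_wpM2r// (ger0_norm M0).
have := L1_Z (M * Ib) (integrable_L1 ia); case=> _.
under eq_integral do rewrite normrM.
move=> h; apply: le_lt_trans (ltry _); apply: le_trans h.
apply: ge0_le_integral => //.
- move=> x _; rewrite lee_fin mulr_ge0// mulr_ge0//.
  by apply: (L1_const_ge0 (integrable_L1 ib)).
- apply/measurable_EFinP; apply: measurable_funM => //.
  by apply: measurableT_comp => //; exact: integrable_measurable.
- apply/measurable_EFinP; apply: measurable_funM => //.
  by apply: measurableT_comp => //; exact: integrable_measurable.
- by move=> x _; rewrite lee_fin mulrC ler_wpM2r// ler_norm.
Qed.

Let innerE x : (\int[mu]_y f (x, y) = (a x * \int[mu]_y (k x y * b y))%:E)%E.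
Proof.
rewrite /f/= -(RintegralZl (a x) measurableT (kb_int x)).
rewrite /Rintegral fineK//; apply: integrable_fin_num => //.
exact: (L1_integrable (L1_Z (a x) (integrable_L1 (kb_int x)))).
Qed.

Let outerE y : (\int[mu]_x f (x, y) = (b y * \int[mu]_x (k x y * a x))%:E)%E.
Proof.
rewrite /f/= -(RintegralZl (b y) measurableT (ka_int y)).
transitivity (\int[mu]_x (b y * (k x y * a x))%:E)%E.
  by apply: eq_integral => x _; congr EFin; ring.
rewrite /Rintegral fineK//; apply: integrable_fin_num => //.
exact: (L1_integrable (L1_Z (b y) (integrable_L1 (ka_int y)))).
Qed.

Lemma integrable_kernel : integr (fun x => a x * \int[mu]_y (k x y * b y)).
Proof.
have := integrable_fubini_F f_int; apply: eq_integrable => // x _.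
by rewrite /fubini_F innerE.
Qed.

(** A general bounded kernel is allowed because the lemma serves the cosine kernel and, in Schur's
    test, convolution kernels. *)
Lemma Fubini_kernel : \int[mu]_x (a x * \int[mu]_y (k x y * b y)) =
  \int[mu]_y (b y * \int[mu]_x (k x y * a x)).
Proof.
have := Fubini f_int => H; rewrite /Rintegral; congr fine.
under eq_integral do rewrite -/(Rintegral _ _ _) -innerE.
by rewrite H; apply: eq_integral => y _; rewrite outerE.
Qed.

End Kernel.

(** The phase [th] makes one real operator out of the cosine and the sine transform, and each
    derivative in x shifts it by pi / 2 while multiplying [l] by y; the family is closed under
    differentiation. *)
Definition cosT th l (x : R) : R := \int[mu]_y (cos (x * y + th) * l y).

Lemma measurable_cosker th :
  measurable_fun setT (fun z : R * R => cos (z.1 * z.2 + th)).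
Proof.
apply: measurableT_comp; first by apply: continuous_measurable_fun; exact: continuous_cos.
by apply: measurable_funD => //; apply: measurable_funM.
Qed.

Lemma cos_norm_le1 (x : R) : `|cos x| <= 1.
Proof. by rewrite ler_norml cos_geN1 cos_le1. Qed.

Lemma measurable_coslin th x : measurable_fun setT (fun y : R => cos (x * y + th)).
Proof.
apply: measurableT_comp; first by apply: continuous_measurable_fun; exact: continuous_cos.
by apply: measurable_funD => //; apply: measurable_funM.
Qed.

Lemma cosT_integrand th l x : integr l -> integr (fun y => cos (x * y + th) * l y).
Proof.
move=> il; apply: integrableM_bounded il; last by move=> y; exact: cos_norm_le1.
exact: measurable_coslin.
Qed.

Lemma cosT_le th l x : integr l -> `|cosT th l x| <= \int[mu]_y `|l y|.
Proof.
move=> il; apply: L1_Rintegral; apply: L1_dom (integrable_L1 il) _ _.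
  exact: integrable_measurable (cosT_integrand _ _ il).
by move=> y; rewrite normrM ler_piMl// cos_norm_le1.
Qed.

Lemma integrableM_cosT th a l : integr a -> integr l ->
  integr (fun x => a x * cosT th l x).
Proof.
by move=> ia il; apply: (integrable_kernel (measurable_cosker th) (M := 1)) => // x y; exact: cos_norm_le1.
Qed.

(** The kernel cos(x y + th) is symmetric, so the operator is its own transpose; every duality
    argument below goes through this. *)
Lemma cosT_swap th a l : integr a -> integr l ->
  \int[mu]_x (a x * cosT th l x) = \int[mu]_y (l y * cosT th a y).
Proof.
move=> ia il; rewrite /cosT (Fubini_kernel (measurable_cosker th) (M := 1) _ ia il).
  by apply: eq_Rintegral => y _; congr (_ * _); apply: eq_Rintegral => x _; rewrite (mulrC x).
by move=> x y; exact: cos_norm_le1.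
Qed.

(* Bounded with compact support. *)
Definition bcs l (M m : R) := [/\ measurable_fun setT l, forall x, `|l x| <= M &
  forall x, m < `|x| -> l x = 0].

Lemma bcs_integrable l (M m : R) : bcs l M m -> integr l.
Proof.
move=> [ml lM l0].
have M0 : 0 <= M by rewrite (le_trans _ (lM 0)).
have i1 := integrable_indic_itv (- m) m true false.
apply: (@L1_integrable _ _ (`|M| * _)); apply: L1_dom (L1_Z M (integrable_L1 i1)) ml _.
move=> x; rewrite normrM (ger0_norm M0) indicE.
have [xm|xm] := boolP (x \in _); first by rewrite normr1 mulr1.
rewrite normr0 mulr0 l0 ?normr0//; rewrite ltNge; apply: contra xm => xm.
by rewrite inE/= in_itv/= -ler_norml.
Qed.

Lemma bcsM l (M m : R) (g : R -> R) (B : R) : bcs l M m -> measurable_fun setT g ->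
  (forall x, `|x| <= m -> `|g x| <= B) -> bcs (fun x => g x * l x) (`|B| * M) m.
Proof.
move=> [ml lM l0] mg gB; split; first exact: measurable_funM.
  move=> x; have [xm|xm] := leP `|x| m; last first.
    by rewrite l0// mulr0 normr0 mulr_ge0// (le_trans _ (lM 0)).
  by rewrite normrM ler_pM// (le_trans (gB _ xm))// ler_norm.
by move=> x xm; rewrite l0// mulr0.
Qed.

Lemma bcsX l (M m : R) : bcs l M m -> bcs (fun x => x * l x) (`|m| * M) m.
Proof. by move=> h; apply: (bcsM h) => // x; exact: id. Qed.

Lemma is_derive_cosT th l (M m x : R) : bcs l M m ->
  is_derive x (1 : R) (cosT th l) (cosT (th + pi / 2) (fun y => y * l y) x).
Proof.
move=> bl; have il := bcs_integrable bl; have ixl := bcs_integrable (bcsX bl).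
pose f (x y : R) := cos (x * y + th) * l y.
have df u y : is_derive u (1:R) (f ^~ y) (cos (u * y + (th + pi / 2)) * (y * l y)).
  rewrite /f addrA cosD cos_pihalf sin_pihalf mulr0 sub0r mulr1.
  apply: is_derive_eq; rewrite !scaler1 /GRing.scale/=; ring.
have Ix : (`]x - 1, x + 1[%classic) x by rewrite /= in_itv/=; apply/andP; split; lra.
have H1 : forall u, `]x - 1, x + 1[%classic u -> integr (f u).
  by move=> u _; exact: cosT_integrand.
have H2 u y : `]x - 1, x + 1[%classic u -> setT y -> derivable (f ^~ y) u 1.
  by move=> _ _; case: (df u y).
have ig : integr (fun y => `|y * l y|) by exact: integrable_norm.
have H3 u y : `]x - 1, x + 1[%classic u -> setT y ->
    `|partial1of2 f u y| <= `|y * l y|.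
  move=> _ _; rewrite partial1of2E (@derive_val _ _ _ _ _ _ _ (df u y)) normrM.
  by rewrite ler_piMl// cos_norm_le1.
have gg0 y : 0 <= `|y * l y| by [].
split.
  exact: (derivable_under_integral measurableT Ix H1 H2 gg0 ig H3).
rewrite -derive1E (differentiation_under_integral measurableT Ix H1 H2 gg0 ig H3).
apply: eq_Rintegral => y _; rewrite partial1of2E.
exact: (@derive_val _ _ _ _ _ _ _ (df x y)).
Qed.

Lemma continuous_cosT th l (M m : R) : bcs l M m -> continuous (cosT th l).
Proof.
move=> bl x; apply/differentiable_continuous/derivable1_diffP.
by case: (is_derive_cosT th x bl).
Qed.

Lemma measurable_cosT th l (M m : R) : bcs l M m -> measurable_fun setT (cosT th l).
Proof. by move=> bl; apply: continuous_measurable_fun; exact: continuous_cosT bl. Qed.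

End CosineTransform.

(** * Bessel inequality *)

Section Bessel.
Context {R : realType}.
Implicit Types (f g l : R -> R) (a b c th : R).
Local Notation mu := (@lebesgue_measure R).

Lemma FTC_is_derive (G g : R -> R) a b : a < b ->
  (forall x, a <= x <= b -> is_derive x (1 : R) G (g x)) ->
  {within `[a, b], continuous g} ->
  (\int[mu]_(x in `[a, b]) (g x)%:E = (G b - G a)%:E)%E.
Proof.
move=> ab dG cg.
have cG x : a <= x <= b -> {for x, continuous G}.
  move=> /dG [dx _]; exact/differentiable_continuous/derivable1_diffP.
rewrite (@continuous_FTC2 R g G a b)//.
- split.
  + by move=> x; rewrite in_itv/= => /andP[ax xb]; case: (dG x) => //; rewrite !ltW.
  + by apply: cvg_at_right_filter; apply: cG; rewrite lexx ltW.
  + by apply: cvg_at_left_filter; apply: cG; rewrite lexx ltW.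
- move=> x; rewrite in_itv/= => /andP[ax xb].
  by rewrite derive1E; case: (dG x) => //; rewrite !ltW.
Qed.

Lemma FTC_continuous (G g : R -> R) a b : a < b ->
  (forall x, is_derive x (1 : R) G (g x)) -> continuous g ->
  (\int[mu]_(x in `[a, b]) (g x)%:E = (G b - G a)%:E)%E.
Proof.
move=> ab dG cg; apply: FTC_is_derive => //.
exact: continuous_subspaceT.
Qed.

Lemma sin_norm_le (x : R) : `|sin x| <= `|x|.
Proof.
wlog x0 : x / 0 <= x => [h|].
  have [/h//|/ltW x0] := leP 0 x.
  by rewrite -normrN -sinN -(normrN x) h// oppr_ge0.
have dsin (u : R) : u \in `]0, x[ -> is_derive u (1 : R) sin (cos u) by move=> _; exact: is_derive_sin.
have csin : {within `[0, x], continuous (@sin R)}.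
  by apply: continuous_subspaceT; exact: continuous_sin.
have [c _] := MVT_segment x0 dsin csin.
rewrite sin0 !subr0 => ->; rewrite normrM ler_piMl//; exact: cos_norm_le1.
Qed.

Lemma atan_diff_le (x y : R) : atan x - atan y <= pi.
Proof. by have := atan_ltpi2 x; have := atan_gtNpi2 y; lra. Qed.

(** The integrand is the derivative of [atan \o g], whose oscillation is at most pi whatever [g] and
    the interval are. It integrates both the Schur kernel and, later, the resonance. *)
Lemma integral_atan_le (g g' : R -> R) a b : a < b ->
  (forall x, a <= x <= b -> is_derive x (1 : R) g (g' x)) ->
  {within `[a, b], continuous g'} ->
  (\int[mu]_(x in `[a, b]) (g' x / (1 + g x ^+ 2))%:E <= pi%:E)%E.
Proof.
move=> ab dg cg'.
have g2 (x : R) : 1 + g x ^+ 2 != 0 by rewrite gt_eqF// ltr_pwDl// sqr_ge0.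
have dG x : a <= x <= b -> is_derive x (1 : R) (atan \o g) (g' x / (1 + g x ^+ 2)).
  by move=> /dg dgx; rewrite mulrC; exact: is_derive1_comp.
have cG : {within `[a, b], continuous (fun x => g' x / (1 + g x ^+ 2))}.
  have cg : {within `[a, b], continuous g}.
    by apply: derivable_within_continuous => x; rewrite in_itv/= => /dg[].
  move=> x; apply: cvgM; first exact: cg'.
  apply: cvgV; first exact: g2.
  by apply: cvgD; [exact: cvg_cst|apply: cvgM; exact: cg].
by rewrite (FTC_is_derive ab dG cG) lee_fin atan_diff_le.
Qed.

(** Monotone convergence along sets of choice: growing intervals in [L2_exhaust], intervals
    intersected with sublevel sets in [L2_dual]. *)
Lemma integral_le_exhaust (f : R -> R) (D : nat -> set R) (c : \bar R) :
  measurable_fun setT f -> (forall x, 0 <= f x) ->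
  (forall n, measurable (D n)) ->
  (forall m n, (m <= n)%N -> D m `<=` D n) -> (forall x, exists n, D n x) ->
  (forall n, (\int[mu]_x (f x * \1_(D n) x)%:E <= c)%E) ->
  (\int[mu]_x (f x)%:E <= c)%E.
Proof.
move=> mf f0 mD ndD Dx fc.
pose g n x := (f x * \1_(D n) x)%:E.
have mg n : measurable_fun setT (g n).
  by apply/measurable_EFinP; apply: measurable_funM => //; exact: measurable_indic.
have g0 n x : setT x -> (0 <= g n x)%E by move=> _; rewrite lee_fin mulr_ge0.
have ndg x : setT x -> {homo g^~ x : m n / (m <= n)%N >-> (m <= n)%E}.
  move=> _ m n mn; rewrite lee_fin ler_wpM2l// !indicE ler_nat.
  by have [xm|//] := boolP (x \in D m); rewrite mem_set//; apply: (ndD _ _ mn); rewrite inE in xm.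
have h : ((\int[mu]_x g n x)%E @[n --> \oo] --> \int[mu]_x (f x)%:E)%E.
  have -> : (fun x => (f x)%:E) = (fun x => limn (g^~ x)).
    apply/funext => x; apply/esym/cvg_lim => //.
    have [N DN] := Dx x; apply: cvg_near_cst; exists N => // n /= Nn.
    by rewrite /g indicE mem_set ?mulr1//; exact: ndD DN.
  exact: cvg_monotone_convergence.
rewrite -(cvg_lim _ h)//; apply: lime_le; first exact: cvgP h.
exact: nearW.
Qed.

Lemma L2_exhaust f b : measurable_fun setT f -> 0 <= b ->
  (forall n : nat, L2_le (fun x => f x * \1_(`[- n%:R, n%:R]) x) b) -> L2_le f b.
Proof.
move=> mf b0 fb; split=> //.
apply: (integral_le_exhaust (D := fun n : nat => `[- (n%:R : R), n%:R]%classic)) => //.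
- exact: measurable_funX.
- by move=> x; exact: sqr_ge0.
- move=> m n mn x /=; rewrite !in_itv/= -!ler_norml => /le_trans; apply.
  by rewrite ler_nat.
- move=> x; exists (Num.truncn `|x|).+1; rewrite /= in_itv/= -ler_norml ltW//.
  exact: truncnS_gt.
move=> n; have [_] := fb n; apply: le_trans; rewrite le_eqVlt; apply/orP; left; apply/eqP.
apply: eq_integral => x _; congr EFin; rewrite exprMn indicE.
by case: (_ \in _); rewrite ?expr1n ?expr0n.
Qed.

Section Weight.
Variable L : R.
Hypothesis L0 : 0 < L.

(** A truncation that is continuous across the endpoints: its transform decays like the inverse
    square and is integrable, which fails for the sharp indicator. *)
Definition parabola (x : R) := (1 - (x / L) ^+ 2) * \1_(`[- L, L]) x.

Lemma parabola_ge0 x : 0 <= parabola x.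
Proof.
rewrite /parabola indicE; have [xm|xm] := boolP (x \in _); last by rewrite mulr0.
rewrite mulr1 subr_ge0; move: xm; rewrite inE/= in_itv/= -ler_norml => xL.
rewrite -(real_normK (num_real _)) expr_le1//.
by rewrite normrM normfV (gtr0_norm L0) ler_pdivrMr// mul1r.
Qed.

Lemma parabola_le1 x : parabola x <= 1.
Proof.
rewrite /parabola indicE; have [xm|xm] := boolP (x \in _); last by rewrite mulr0.
by rewrite mulr1 gerBl sqr_ge0.
Qed.

Lemma bcs_parabola : bcs parabola 1 L.
Proof.
split.
- apply: measurable_funM; last exact: measurable_indic.
  by apply: measurable_funB => //; apply: measurable_funX; apply: measurable_funM.
- by move=> x; rewrite ger0_norm ?parabola_le1// parabola_ge0.
- move=> x xL; rewrite /parabola indicE memNset ?mulr0//=.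
  by rewrite in_itv/= -ler_norml; apply/negP; rewrite -ltNge.
Qed.

(** Sum of two bounds: 2 L from the mass of the weight, and 8 L / (L s)^2 from integrating by parts,
    where the first boundary term is lost because the weight vanishes at the endpoints. *)
Lemma cosT_parabola_le s : `|cosT 0 parabola s| <= 10 * L / (1 + (L * s) ^+ 2).
Proof.
have ls : 0 < 1 + (L * s) ^+ 2 by rewrite ltr_pwDl// sqr_ge0.
have b1 : `|cosT 0 parabola s| <= 2 * L.
  apply: le_trans (cosT_le _ _ (bcs_integrable bcs_parabola)) _.
  apply: le_trans (ler_norm _) (L1_Rintegral _).
  have L1 : L1_le (\1_(`[- L, L]) : R -> R) (2 * L).
    split; first exact: measurable_indic.
    under eq_integral do rewrite ger0_norm//.
    rewrite integral_indic// setIT /= lebesgue_measure_itv/= lte_fin.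
    by rewrite ifT ?gtrN//= -EFinD lee_fin; lra.
  apply: (L1_dom L1).
    by apply: measurableT_comp => //; case: bcs_parabola.
  move=> x; rewrite normr_id /parabola normrM indicE.
  have := parabola_ge0 x; have := parabola_le1 x; rewrite /parabola indicE.
  by case: (_ \in _) => /=; [rewrite !mulr1 normr1 mulr1 => h1 /ger0_norm ->|rewrite normr0 mulr0].
have b2 : `|cosT 0 parabola s| * (L * s) ^+ 2 <= 8 * L.
  have [->|s0] := eqVneq s 0.
    by rewrite mulr0 expr0n mulr0 mulr_ge0// ltW.
  (* The antiderivative of [g] found by integrating by parts until the quadratic factor is
     exhausted. *)
  pose G x := (1 - (x / L) ^+ 2) * (sin (s * x) / s) - 2 * x / L ^+ 2 * (cos (s * x) / s ^+ 2)
              + 2 / L ^+ 2 * (sin (s * x) / s ^+ 3).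
  pose g x := (1 - (x / L) ^+ 2) * cos (s * x).
  have L00 : L != 0 by rewrite gt_eqF.
  have dG (x : R) : is_derive x (1 : R) G (g x).
    apply: is_derive_eq; rewrite /GRing.scale/= /g; field.
    by rewrite s0 L00.
  have cg : continuous g.
    move=> x; apply/differentiable_continuous/derivable1_diffP.
    have [//] : is_derive x (1 : R) g (- (2 * x / L ^+ 2) * cos (s * x) - (1 - (x / L) ^+ 2) * (s * sin (s * x))).
    by apply: is_derive_eq; rewrite /GRing.scale/=; field.
  have NL : - L < L by rewrite gtrN.
  have -> : cosT 0 parabola s = G L - G (- L).
    rewrite -[RHS]/(fine (G L - G (- L))%:E) -(FTC_continuous NL dG cg).
    transitivity (\int[mu]_(x in `[- L, L]) g x); last by [].
    rewrite /cosT [RHS]Rintegral_mkcond; apply: eq_Rintegral => x _.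
    rewrite addr0 /parabola patchE indicE /g.
    by case: ifPn => _; rewrite ?mulr1 ?mulr0// mulrC.
  have -> : G L - G (- L) = - (4 * cos (L * s) / (L * s ^+ 2)) + 4 * (sin (L * s)) / (L ^+ 2 * s ^+ 3).
    rewrite /G !mulrN sinN cosN (mulrC s L); field; by rewrite s0 L00.
  have Ls2 : 0 <= (L * s) ^+ 2 by exact: sqr_ge0.
  rewrite -[X in _ * X](ger0_norm Ls2) -normrM mulrDl.
  have -> : - (4 * cos (L * s) / (L * s ^+ 2)) * (L * s) ^+ 2 = - (4 * L * cos (L * s)).
    by field; rewrite s0 L00.
  have -> : 4 * sin (L * s) / (L ^+ 2 * s ^+ 3) * (L * s) ^+ 2 = 4 * L * (sin (L * s) / (L * s)).
    by field; rewrite s0 L00.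
  have h1 : `|cos (L * s)| <= 1 by exact: cos_norm_le1.
  have h2 : `|sin (L * s) / (L * s)| <= 1.
    rewrite normrM normfV ler_pdivrMr ?normr_gt0 ?mulf_neq0// mul1r.
    exact: sin_norm_le.
  apply: le_trans (ler_normD _ _) _; rewrite normrN !normrM (ger0_norm (ltW L0)) (ger0_norm (_ : 0 <= 4))//.
  have L4 : 0 <= 4 * L by rewrite mulr_ge0// ltW.
  have := ler_wpM2l L4 h1; have := ler_wpM2l L4 h2; rewrite normrM; lra.
by rewrite ler_pdivlMr// mulrDr mulr1; lra.
Qed.

End Weight.

End Bessel.

Section BesselInequality.
Context {R : realType}.
Implicit Types (f g l : R -> R) (a b c th : R).
Local Notation mu := (@lebesgue_measure R).
Local Notation integr f := (mu.-integrable setT (EFin \o f)).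

(** A T T* argument. The phases [th] and th + pi / 2 are added because cos cos + sin sin = cos of
    the difference: only their sum turns the double kernel into a convolution kernel, the transform
    of the weight at x - y. *)
Lemma cosT_orthogonality th L l (M m : R) : 0 < L -> bcs l M m ->
  \int[mu]_x (parabola L x * (cosT th l x ^+ 2 + cosT (th + pi / 2) l x ^+ 2)) =
  \int[mu]_x (l x * \int[mu]_y (cosT 0 (parabola L) (x - y) * l y)).
Proof.
move=> L0 bl; have il := bcs_integrable bl.
have iw := bcs_integrable (bcs_parabola L0).
pose T t x := cosT t l x.
have iT t : integr (fun x => T t x * parabola L x).
  apply: (integrableM_bounded _ _ iw); first exact: measurable_cosT bl.
  by move=> x; exact: cosT_le.
have H t : \int[mu]_x (parabola L x * T t x ^+ 2) =
    \int[mu]_x (l x * \int[mu]_y (l y * \int[mu]_z (cos (x * z + t) * cos (y * z + t) * parabola L z))).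
  transitivity (\int[mu]_x ((T t x * parabola L x) * cosT t l x)).
    by apply: eq_Rintegral => x _; rewrite -/(T t x); ring.
  rewrite (cosT_swap _ (iT t) il); apply: eq_Rintegral => x _; congr (_ * _).
  have ic : integr (fun z => cos (x * z + t) * parabola L z) by exact: cosT_integrand.
  transitivity (\int[mu]_z ((cos (x * z + t) * parabola L z) * cosT t l z)).
    by apply: eq_Rintegral => z _; rewrite -/(T t z); ring.
  rewrite (cosT_swap _ ic il); apply: eq_Rintegral => y _; congr (_ * _).
  by apply: eq_Rintegral => z _; ring.
have iwT t : integr (fun x => parabola L x * T t x ^+ 2).
  have := integrableM_cosT t (iT t) il; apply: eq_integrable => // x _ /=.
  by rewrite -/(T t x); congr EFin; ring.
transitivity (\int[mu]_x (parabola L x * T th x ^+ 2 + parabola L x * T (th + pi / 2) x ^+ 2)).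
  by apply: eq_Rintegral => x _; rewrite mulrDr.
have icc x y t : integr (fun z => cos (x * z + t) * cos (y * z + t) * parabola L z).
  have := cosT_integrand t x (cosT_integrand t y iw).
  by apply: eq_integrable => // z _ /=; congr EFin; ring.
have mcc x t : measurable_fun setT (fun y : R => \int[mu]_z (cos (x * z + t) * cos (y * z + t) * parabola L z)).
  rewrite (_ : (fun y => _) = cosT t (fun z => cos (x * z + t) * parabola L z)); last first.
    by apply/funext => y; apply: eq_Rintegral => z _; ring.
  have := bcs_parabola L0 => bp; apply: (@measurable_cosT _ _ _ (`|1| * 1) L).
  apply: bcsM bp _ _; first exact: measurable_coslin.
  by move=> z _; exact: cos_norm_le1.
have bcc x y t : `|\int[mu]_z (cos (x * z + t) * cos (y * z + t) * parabola L z)| <=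
    \int[mu]_z `|parabola L z|.
  apply: L1_Rintegral; apply: (L1_dom (integrable_L1 iw)).
    exact: integrable_measurable (icc x y t).
  by move=> z; rewrite normrM ler_piMl// normrM mulr_ile1// cos_norm_le1.
have il2 x t : integr (fun y => l y * \int[mu]_z (cos (x * z + t) * cos (y * z + t) * parabola L z)).
  have := integrableM_bounded (mcc x t) (fun y => bcc x y t) il.
  by apply: eq_integrable => // y _ /=; rewrite mulrC.
have ill t : integr (fun x => l x * \int[mu]_y (l y * \int[mu]_z (cos (x * z + t) * cos (y * z + t) * parabola L z))).
  have := integrableM_cosT t il (iT t).
  apply: eq_integrable => // x _ /=; congr (_ * _)%:E.
  have ic : integr (fun z => cos (x * z + t) * parabola L z) by exact: cosT_integrand.
  transitivity (\int[mu]_z ((cos (x * z + t) * parabola L z) * cosT t l z)).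
    by apply: eq_Rintegral => z _; rewrite -/(T t z); ring.
  rewrite (cosT_swap _ ic il); apply: eq_Rintegral => y _; congr (_ * _).
  by apply: eq_Rintegral => z _; ring.
rewrite RintegralD// !H -RintegralD//; apply: eq_Rintegral => x _.
rewrite -mulrDr; congr (_ * _).
rewrite -RintegralD//; apply: eq_Rintegral => y _.
rewrite -mulrDr mulrC; congr (_ * _).
rewrite -RintegralD//; apply: eq_Rintegral => z _.
rewrite -mulrDl; congr (_ * _).
rewrite !addrA !cosDpihalf mulrNN addr0.
by rewrite -cosB; congr cos; ring.
Qed.

(* Schur's test with the kernel [10 L / (1 + L^2 s^2)], whose integral does not
   depend on [L]. *)
Lemma cosT_Schur L l (M m b : R) : 0 < L -> 0 < m -> bcs l M m -> L2_le l b ->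
  \int[mu]_x (l x * \int[mu]_y (cosT 0 (parabola L) (x - y) * l y)) <= 10 * pi * b ^+ 2.
Proof.
move=> L0 m0 bl lb; have il := bcs_integrable bl.
pose K (s : R) := 10 * L / (1 + (L * s) ^+ 2).
have den (s : R) : 0 < 1 + (L * s) ^+ 2 by rewrite ltr_pwDl// sqr_ge0.
have K0 s : 0 <= K s by rewrite divr_ge0 ?mulr_ge0// ltW.
have KL s : `|K s| <= 10 * L.
  rewrite ger0_norm// ler_pdivrMr// ler_pMr ?mulr_gt0// lerDl; exact: sqr_ge0.
have Ks s : K (- s) = K s by rewrite /K mulrN sqrrN.
have cK : continuous K.
  move=> s; apply/differentiable_continuous/derivable1_diffP.
  have dd : is_derive s (1 : R) (fun s => 1 + (L * s) ^+ 2) (2 * L ^+ 2 * s).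
    by apply: is_derive_eq; rewrite /GRing.scale/=; ring.
  apply: derivableM => //; apply: derivableV; first by rewrite gt_eqF.
  by case: dd.
have mK : measurable_fun setT K by exact: continuous_measurable_fun.
have mKxy : measurable_fun setT (fun z : R * R => K (z.1 - z.2)).
  by apply: measurableT_comp => //; apply: measurable_funB.
have KLxy (x y : R) : `|K (x - y)| <= 10 * L by exact: KL.
have mKx (x : R) : measurable_fun setT (fun y : R => K (x - y)).
  by apply: measurableT_comp => //; apply: measurable_funB.
(* The kernel lemmas ask for integrable functions, so the indicator of the support of [l] replaces
   the constant 1 as the test function of Schur's method. *)
pose I (x : R) : R := \1_(`[- m, m]) x.
have mI : measurable_fun setT I by exact: measurable_indic.
have I0 x : 0 <= I x by [].
have iI : integr I by exact: (integrable_indic_itv (- m) m true false).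
have I01 x : I x = 0 \/ I x = 1.
  by rewrite /I indicE; case: (_ \in _); [right|left].
have lI x : l x = l x * I x.
  rewrite /I indicE; have [xm|xm] := boolP (x \in _); first by rewrite mulr1.
  case: bl => _ _ ->; first by rewrite mul0r.
  by rewrite ltNge; apply: contra xm => xm; rewrite inE/= in_itv/= -ler_norml.
have ml : measurable_fun setT l by case: bl.
have iabs : integr (fun x => `|l x|) by exact: (integrable_abse il).
have isq : integr (fun x => l x ^+ 2).
  apply: (@L1_integrable _ _ (b ^+ 2)); split; first exact: measurable_funX.
  by under eq_integral do rewrite ger0_norm ?sqr_ge0//; case: lb.
pose k (g : R -> R) (x : R) := \int[mu]_y (K (x - y) * g y).
have iKg x g : integr g -> integr (fun y => K (x - y) * g y).
  exact: (integrableM_bounded (mKx x) (KLxy x)).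
have ik g h : integr g -> integr h -> integr (fun x => g x * k h x).
  by move=> ig ih; exact: (integrable_kernel mKxy KLxy ig ih).
(* The substitution L (y - x) turns the kernel into 10 / (1 + s^2), of total mass 10 pi. *)
have kI x : k I x <= 10 * pi.
  apply: le_trans (ler_norm _) (L1_Rintegral _); split.
    exact: integrable_measurable (iKg _ _ iI).
  have NL : - m < m by rewrite gtrN.
  have -> : (10 * pi)%:E = (10%:E * pi%:E)%E :> \bar R by rewrite EFinM.
  have dg (y : R) : is_derive y (1 : R) (fun y => L * (y - x)) L.
    by apply: is_derive_eq; rewrite /GRing.scale/=; ring.
  have cg : {within `[- m, m], continuous (fun _ : R => L)}.
    by apply: continuous_subspaceT; exact: cst_continuous.
  have h := integral_atan_le NL (fun y _ => dg y) cg.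
  have e y : K (x - y) = 10 * (L / (1 + (L * (y - x)) ^+ 2)).
    by rewrite /K -(opprB y x) mulrN sqrrN mulrA.
  have mL : measurable_fun setT (fun y : R => L / (1 + (L * (y - x)) ^+ 2)).
    have : measurable_fun setT (fun y : R => 10^-1 * K (x - y)).
      by apply: measurable_funM => //; exact: mKx.
    by apply: eq_measurable_fun => y _; rewrite /= e mulKf.
  apply: (@le_trans _ _ (\int[mu]_(y in `[(- m)%R, m]) (10 * (L / (1 + (L * (y - x)) ^+ 2)))%:E)%E); last first.
    under eq_integral do rewrite EFinM.
    rewrite ge0_integralZl//; first by rewrite lee_wpmul2l.
      by apply/measurable_EFinP; exact: measurable_funTS.
    by move=> y _; rewrite lee_fin divr_ge0// ltW.
  rewrite [leRHS]integral_mkcond; apply: ge0_le_integral => //.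
  - apply/measurable_EFinP; apply: measurableT_comp => //.
    exact: integrable_measurable (iKg _ _ iI).
  - apply: (measurable_restrictT _ (measurable_itv `[(- m)%R, m])).1; apply: measurable_funTS.
    by apply/measurable_EFinP; exact: measurable_funM.
  - move=> y _; rewrite patchE /I indicE; case: ifPn => _; last by rewrite mulr0 normr0.
    by rewrite mulr1 ger0_norm// -e.
have step1 x : l x * \int[mu]_y (cosT 0 (parabola L) (x - y) * l y) <= `|l x| * k (fun y => `|l y|) x.
  apply: le_trans (ler_norm _) _; rewrite normrM ler_wpM2l//.
  have h0 : L1_le (fun y => K (x - y) * `|l y|) (k (fun y => `|l y|) x).
    split; first exact: integrable_measurable (iKg _ _ iabs).
    rewrite /k /Rintegral fineK; last by apply: integrable_fin_num => //; exact: (iKg x _ iabs).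
    by rewrite le_eqVlt; apply/orP; left; apply/eqP/eq_integral => y _; congr EFin; rewrite ger0_norm// mulr_ge0.
  apply: L1_Rintegral; apply: L1_dom h0 _ _.
    apply: measurable_funM => //; apply: measurableT_comp; last exact: measurable_funB.
    exact: measurable_cosT (bcs_parabola L0).
  move=> y; rewrite normrM [leRHS]normrM normr_id ler_wpM2r// [leRHS]ger0_norm//.
  exact: cosT_parabola_le.
have step2 x : `|l x| * k (fun y => `|l y|) x <= 2^-1 * (l x ^+ 2 * k I x + I x * k (fun y => l y ^+ 2) x).
  rewrite /k -!RintegralZl//; try by apply: iKg.
  rewrite -RintegralD//; last 2 first.
  - exact: (L1_integrable (L1_Z (l x ^+ 2) (integrable_L1 (iKg x _ iI)))).
  - exact: (L1_integrable (L1_Z (I x) (integrable_L1 (iKg x _ isq)))).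
  rewrite -RintegralZl//; last first.
    apply: (L1_integrable (L1_D (L1_Z (l x ^+ 2) (integrable_L1 (iKg x _ iI)))
      (L1_Z (I x) (integrable_L1 (iKg x _ isq))))).
  apply: le_Rintegral => //.
  - exact: (L1_integrable (L1_Z `|l x| (integrable_L1 (iKg x _ iabs)))).
  - exact: (L1_integrable (L1_Z 2^-1 (L1_D (L1_Z (l x ^+ 2) (integrable_L1 (iKg x _ iI)))
      (L1_Z (I x) (integrable_L1 (iKg x _ isq)))))).
  move=> y _.
  have -> : `|l x| * (K (x - y) * `|l y|) = K (x - y) * (`|l x| * `|l y|) by ring.
  have -> : 2^-1 * (l x ^+ 2 * (K (x - y) * I y) + I x * (K (x - y) * l y ^+ 2)) =
    K (x - y) * (2^-1 * (l x ^+ 2 * I y + I x * l y ^+ 2)) by ring.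
  rewrite ler_wpM2l//.
  have h : `|l x| * `|l y| <= 2^-1 * (l x ^+ 2 + l y ^+ 2).
    rewrite -(real_normK (num_real (l x))) -(real_normK (num_real (l y))).
    by have := sqr_ge0 (`|l x| - `|l y|); lra.
  have := lI x; have := lI y.
  case: (I01 x) => ->; case: (I01 y) => ->; rewrite ?mulr0 ?mulr1 ?mul0r ?mul1r => e1 e2.
  - by rewrite e1 e2 normr0; lra.
  - by rewrite e2 normr0 mul0r expr0n/=; lra.
  - by rewrite e1 normr0 mulr0 expr0n/=; lra.
  - exact: h.
have i1 := ik _ _ isq iI; have i2 := ik _ _ iI isq.
apply: (@le_trans _ _ (\int[mu]_x (2^-1 * (l x ^+ 2 * k I x + I x * k (fun y => l y ^+ 2) x)))).
  apply: le_Rintegral => //.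
  - apply: (integrable_kernel (k := fun x y => cosT 0 (parabola L) (x - y)) (M := \int[mu]_x `|parabola L x|)) => //.
    + apply: measurableT_comp; last exact: measurable_funB.
      exact: measurable_cosT (bcs_parabola L0).
    + move=> x y; apply: cosT_le; exact: bcs_integrable (bcs_parabola L0).
  - exact: (L1_integrable (L1_Z 2^-1 (L1_D (integrable_L1 i1) (integrable_L1 i2)))).
  - by move=> x _; exact: le_trans (step1 x) (step2 x).
rewrite RintegralZl//; last exact: (L1_integrable (L1_D (integrable_L1 i1) (integrable_L1 i2))).
rewrite RintegralD//.
(* The kernel is even, so Fubini exchanges the two halves produced by the inequality between
   products and squares. *)
have -> : \int[mu]_x (I x * k (fun y => l y ^+ 2) x) = \int[mu]_x (l x ^+ 2 * k I x).
  rewrite /k (Fubini_kernel mKxy KLxy iI isq); apply: eq_Rintegral => y _; congr (_ * _).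
  by apply: eq_Rintegral => x _; rewrite -(opprB y x) Ks.
suff : \int[mu]_x (l x ^+ 2 * k I x) <= 10 * pi * b ^+ 2 by lra.
apply: (@le_trans _ _ (\int[mu]_x (10 * pi * l x ^+ 2))).
  apply: le_Rintegral => //; first exact: (L1_integrable (L1_Z _ (integrable_L1 isq))).
  by move=> x _; rewrite mulrC ler_wpM2r// sqr_ge0.
rewrite RintegralZl//; rewrite ler_wpM2l ?mulr_ge0 ?pi_ge0//.
apply: le_trans (ler_norm _) (L1_Rintegral _); split; first exact: measurable_funX.
by under eq_integral do rewrite ger0_norm ?sqr_ge0//; case: lb.
Qed.

(** The weighted bound 10 pi b^2 is uniform in the window, so it survives the exhaustion of the
    line. The factor 2 lost to the weight gives 20 pi b^2, which is below (14 pi b)^2; the constant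
    is not sharp. *)
Lemma cosT_Bessel th l (M m b : R) : 0 < m -> 0 <= b -> bcs l M m -> L2_le l b ->
  L2_le (cosT th l) (14 * pi * b).
Proof.
move=> m0 b0 bl lb; have mT := measurable_cosT th bl.
have pi2 := @pi_ge2 R.
apply: L2_exhaust => //; first by rewrite !mulr_ge0 ?pi_ge0.
move=> n; split; first by apply: measurable_funM => //; exact: measurable_indic.
(* On [-n, n] one has |x| / L <= 1/2, where the weight is at least 3/4; the successor keeps L
   positive when n = 0. *)
pose L : R := n.+1%:R * 2; have L0 : 0 < L by rewrite mulr_gt0.
have := cosT_Schur L0 m0 bl lb; rewrite -(cosT_orthogonality th L0 bl) => J.
have iw := bcs_integrable (bcs_parabola L0).
have il := bcs_integrable bl.
have mT' := measurable_cosT (th + pi / 2) bl.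
have iJ : integr (fun x => parabola L x * (cosT th l x ^+ 2 + cosT (th + pi / 2) l x ^+ 2)).
  have h t : measurable_fun setT (cosT t l) -> integr (fun x => cosT t l x * (cosT t l x * parabola L x)).
    by move=> mt; do 2 apply: (integrableM_bounded mt (fun x => cosT_le t x il)).
  have := L1_integrable (L1_D (integrable_L1 (h _ mT)) (integrable_L1 (h _ mT'))).
  by apply: eq_integrable => // x _; congr EFin; ring.
have J' : L1_le (fun x => parabola L x * (cosT th l x ^+ 2 + cosT (th + pi / 2) l x ^+ 2)) (10 * pi * b ^+ 2).
  apply: L1_le_trans (integrable_L1 iJ) _; apply: le_trans J.
  rewrite le_eqVlt; apply/orP; left; apply/eqP; apply: eq_Rintegral => x _.
  by rewrite ger0_norm// mulr_ge0 ?parabola_ge0// addr_ge0 ?sqr_ge0.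
have [_ H] : L1_le (fun x => (cosT th l x * \1_(`[- n%:R, n%:R]) x) ^+ 2) (`|2| * (10 * pi * b ^+ 2)).
  apply: L1_dom (L1_Z 2 J') _ _.
    by apply: measurable_funX; apply: measurable_funM => //; exact: measurable_indic.
  move=> x.
  have q0 : 0 <= cosT th l x ^+ 2 + cosT (th + pi / 2) l x ^+ 2 by rewrite addr_ge0 ?sqr_ge0.
  have p0 := parabola_ge0 L0 x.
  rewrite ger0_norm ?sqr_ge0// ger0_norm; last by rewrite mulr_ge0// mulr_ge0.
  rewrite indicE; have [xn|xn] := boolP (x \in _); last first.
    by rewrite mulr0 expr0n/= mulr_ge0// mulr_ge0.
  rewrite mulr1; move: xn; rewrite inE/= in_itv/= -ler_norml => xn.
  have nn1 : (n%:R : R) <= n.+1%:R by rewrite ler_nat.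
  have p1 : 1 <= 2 * parabola L x.
    rewrite /parabola indicE mem_set/=; last first.
      rewrite in_itv/= -ler_norml (le_trans xn)// (le_trans nn1)// /L ler_peMr// ler1n//.
    rewrite mulr1 -(real_normK (num_real _)) normrM normfV (ger0_norm (ltW L0)).
    have : `|x| / L <= 2^-1 by rewrite ler_pdivrMr// /L; lra.
    have : 0 <= `|x| / L by rewrite divr_ge0// ltW.
    by nra.
  rewrite mulrA; apply: le_trans (ler_wpM2r _ p1); last by rewrite addr_ge0 ?sqr_ge0.
  by rewrite mul1r lerDl sqr_ge0.
under eq_integral do rewrite -[_ ^+ 2]ger0_norm ?sqr_ge0//.
apply: le_trans H _; rewrite lee_fin ger0_norm//.
have := sqr_ge0 b; nra.
Qed.

End BesselInequality.

(** * Smooth cutoffs and weak derivatives *)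

Section Smooth.
Context {R : realType}.
Implicit Types f g : R -> R.

Definition smooth f := forall (n : nat) (x : R), derivable (derive1n n f) x 1.

(** A coinduction principle: it is enough to place [f] in a class of differentiable functions that
    is stable under differentiation. *)
Lemma smooth_stable (P : (R -> R) -> Prop) f :
  (forall g, P g -> (forall x, derivable g x 1) /\ P g^`()%classic) ->
  P f -> smooth f.
Proof.
move=> HP Pf n; suff /HP[] : P (derive1n n f) by [].
by elim: n => [|n /HP[]].
Qed.

(** Peeling off the first derivative rather than the last lets an induction on [n] range over all
    functions; with Leibniz' rule this yields products. *)
Fixpoint diffn n f : Prop :=
  if n is m.+1 then (forall x, derivable f x 1) /\ diffn m f^`()%classic else True.

Lemma smooth_diffn f : smooth f <-> forall n, diffn n f.
Proof.
split=> [sf n|df n x].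
  suff : forall m, diffn n (derive1n m f) by move/(_ 0%N).
  elim: n => [//|n IH] m /=; split; first exact: sf.
  exact: (IH m.+1).
suff : diffn 1 (derive1n n f) by case=> /(_ x).
have {df} : forall k, diffn k (derive1n n f).
  elim: n => [//|n IH] k; have [_] := IH k.+1; exact.
exact.
Qed.

Lemma smooth_derivable f x : smooth f -> derivable f x 1.
Proof. by move=> /(_ 0%N x). Qed.

Lemma smooth_derive1 f : smooth f -> smooth f^`()%classic.
Proof. by move=> sf n x; rewrite /derive1n -iterSr; exact: (sf n.+1). Qed.

Lemma smooth_continuous f : smooth f -> continuous f.
Proof.
by move=> sf x; apply/differentiable_continuous/derivable1_diffP; exact: smooth_derivable.
Qed.

Lemma diffnS n f : diffn n.+1 f -> diffn n f.
Proof. by elim: n f => [//|n IH] f [df ?]; split=> //; exact: IH. Qed.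

Lemma diffnD n f g : diffn n f -> diffn n g -> diffn n (fun x => f x + g x).
Proof.
elim: n f g => [//|n IH] f g [df df'] [dg dg']; split.
  by move=> x; exact: derivableD.
rewrite (_ : _^`()%classic = fun x => f^`()%classic x + g^`()%classic x); first exact: IH.
by apply/funext => x; rewrite !derive1E deriveD.
Qed.

Lemma diffnM n f g : diffn n f -> diffn n g -> diffn n (fun x => f x * g x).
Proof.
elim: n f g => [//|n IH] f g [df df'] [dg dg']; split.
  by move=> x; exact: derivableM.
rewrite (_ : _^`()%classic = fun x => f x * g^`()%classic x + g x * f^`()%classic x); last first.
  by apply/funext => x; rewrite !derive1E deriveM.
by apply: diffnD; apply: IH => //; apply: diffnS; split.
Qed.

Lemma smoothM f g : smooth f -> smooth g -> smooth (fun x => f x * g x).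
Proof.
move=> /smooth_diffn sf /smooth_diffn sg; apply/smooth_diffn => n.
exact: diffnM.
Qed.

Lemma smooth_cst (c : R) : smooth (fun=> c).
Proof.
apply: (@smooth_stable (fun f => exists c, f = fun=> c)); last by exists c.
move=> g [d ->]; split; first by move=> x; exact: derivable_cst.
by exists 0; apply/funext => x; rewrite derive1_cst.
Qed.

Lemma smooth_id : smooth id.
Proof.
apply/smooth_diffn => -[//|n]; split; first by move=> x; exact: derivable_id.
rewrite (_ : _^`()%classic = fun=> (1 : R)); first by move: n; apply/smooth_diffn; exact: smooth_cst.
by apply/funext => x; rewrite derive1E derive_id.
Qed.

Lemma is_derive_affine (a b x : R) f : derivable f (a * x + b) 1 ->
  is_derive x (1 : R) (fun y => f (a * y + b)) (a * f^`()%classic (a * x + b)).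
Proof.
move=> df; rewrite mulrC derive1E.
have d1 : is_derive (a * x + b) (1 : R) f ('D_1 f (a * x + b)) by exact: derivableP.
have d2 : is_derive x (1 : R) (fun y => a * y + b) a.
  by apply: is_derive_eq; rewrite /GRing.scale/=; ring.
exact: (@is_derive1_comp _ f (fun y => a * y + b)).
Qed.

Lemma smooth_affine (a b : R) f : smooth f -> smooth (fun x => f (a * x + b)).
Proof.
move=> sf.
apply: (@smooth_stable (fun h => exists c g, smooth g /\ h = fun x => c * g (a * x + b))); last first.
  by exists 1, f; split=> //; apply/funext => x; rewrite mul1r.
move=> h [c [g [sg ->]]].
have dh x : is_derive x (1 : R) (fun x => c * g (a * x + b)) (c * (a * g^`()%classic (a * x + b))).
  have dg := is_derive_affine (x := x) (smooth_derivable (x := a * x + b) sg).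
  by apply: is_derive_eq; rewrite /GRing.scale/=; ring.
split=> [x|]; first by case: (dh x).
exists (c * a), g^`()%classic; split; first exact: smooth_derive1.
by apply/funext => x; rewrite derive1E (@derive_val _ _ _ _ _ _ _ (dh x)) mulrA.
Qed.

(** The classical flat function e^(-1/x) with a polynomial prefactor in 1/x; with the prefactor the
    family becomes stable under differentiation. *)
Definition expV (p : {poly R}) (x : R) := if 0 < x then p.[x^-1] * expR (- x^-1) else 0.

(** Each monomial satisfies y^i <= i! e^y for y >= 0, which gives the witness coefficient by
    coefficient. *)
Lemma horner_expR_le (p : {poly R}) : exists C : R, forall y, 0 <= y -> `|p.[y]| * expR (- y) <= C.
Proof.
exists (\sum_(i < size p) `|p`_i| * i`!%:R) => y y0.
rewrite horner_coef expRN ler_pdivrMr ?expR_gt0// mulr_suml.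
apply: le_trans (ler_norm_sum _ _ _) _; apply: ler_sum => i _.
rewrite normrM -mulrA ler_wpM2l// normrX ger0_norm//.
case: (val i) => [|n].
  by rewrite expr0 fact0 mul1r; apply: le_trans (expR_ge1Dx _); rewrite lerDl.
have f0 : 0 < (n.+1`!)%:R :> R by rewrite ltr0n fact_gt0.
have := expR_ge1Dxn n y0; rewrite -(ler_pM2l f0) mulrDr mulrCA divff ?gt_eqF//.
rewrite !mulr1; apply: le_trans; rewrite lerDr; exact: ltW.
Qed.

Lemma is_derive_expV p x :
  is_derive x (1 : R) (expV p) (expV ('X^2 * (p - p^`())) x).
Proof.
have [x0|x0|x0] := ltgtP 0 x.
- apply: (@near_eq_is_derive R R R (fun y : R => p.[y^-1] * expR (- y^-1))).
    by near=> y; rewrite /expV ifT//; near: y; exact: lt_nbhsr.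
  have xn : x != 0 by rewrite gt_eqF.
  have dV : is_derive x (1 : R) (fun y : R => y^-1) (- x ^- 2).
    have := is_deriveV xn (is_derive_id x (1 : R)).
    by rewrite /GRing.scale/= mulr1.
  have dp : is_derive x (1 : R) (fun y => p.[y^-1]) (- x ^- 2 * p^`().[x^-1]).
    have := is_derive_poly p x^-1 => d1; rewrite mulrC.
    exact: (@is_derive1_comp _ (horner p) (fun y => y^-1)).
  have de : is_derive x (1 : R) (fun y : R => expR (- y^-1)) (x ^- 2 * expR (- x^-1)).
    rewrite mulrC; apply: (@is_derive1_comp _ expR (fun y => - y^-1)).
    by apply: is_derive_eq; rewrite opprK.
  apply: is_derive_eq; rewrite /expV x0 /GRing.scale/= hornerM hornerXn hornerD hornerN.
  set a := p.[x^-1]; set b := p^`().[x^-1]; set c := expR _.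
  field; exact: xn.
- apply: (@near_eq_is_derive R R R (fun _ : R => 0 : R)).
    by near=> y; rewrite /expV ifF//; apply/negbTE; rewrite -leNgt ltW//; near: y; exact: lt_nbhsl.
  by rewrite /expV ltNge (ltW x0)/=; exact: is_derive_cst.
- rewrite -x0 {2}/expV ltxx.
  (* Two extra powers of 1/y make the function O(y^2) at the origin, so its difference quotient
     there tends to 0. *)
  have [C HC] := horner_expR_le (p * 'X^2).
  have bnd y : `|expV p y| <= `|C| * y ^+ 2.
    rewrite /expV; case: ifPn => y0; last by rewrite normr0 mulr_ge0 ?sqr_ge0.
    have yn : y != 0 by rewrite gt_eqF.
    have := HC y^-1; rewrite invr_ge0 ltW// => /(_ isT).
    rewrite hornerM hornerXn normrM (ger0_norm (sqr_ge0 y^-1)).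
    rewrite normrM (ger0_norm (expR_ge0 _)) => h.
    rewrite -ler_pdivrMr ?exprn_gt0//; apply: le_trans (ler_norm C).
    by apply: le_trans h; rewrite exprVn mulrAC.
  have cv : h^-1 *: (expV p (h *: 1 + 0) - expV p 0) @[h --> 0^'] --> (0 : R).
    apply/cvgrPdist_le => e e0; near=> h.
    have h0 : h != 0 by near: h; exact: nbhs_dnbhs_neq.
    rewrite sub0r normrN addr0 /GRing.scale/= mulr1 {2}/expV ltxx subr0 normrM normfV.
    rewrite ler_pdivrMl ?normr_gt0//; apply: le_trans (bnd h) _.
    rewrite -(real_normK (num_real h)) expr2 mulrCA ler_wpM2l//.
    have C1 : 0 < `|C| + 1 by rewrite ltr_wpDl.
    have he : `|h| <= e / (`|C| + 1) by near: h; apply: dnbhs0_le; exact: divr_gt0.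
    apply: (@le_trans _ _ ((`|C| + 1) * `|h|)); first by rewrite ler_wpM2r// lerDl.
    by rewrite mulrC -ler_pdivlMr.
  apply: DeriveDef; first by apply: cvgP cv.
  by apply: cvg_lim cv.
Unshelve. all: by end_near. Qed.

Lemma smooth_expV p : smooth (expV p).
Proof.
apply: (@smooth_stable (fun f => exists p, f = expV p)); last by exists p.
move=> g [q ->]; split; first by move=> x; case: (is_derive_expV q x).
exists ('X^2 * (q - q^`())); apply/funext => x.
by rewrite derive1E (@derive_val _ _ _ _ _ _ _ (is_derive_expV q x)).
Qed.

Lemma smooth_bump : exists eta : R -> R, [/\ smooth eta, eta 0 = 1 &
  forall x, 1 < `|x| -> eta x = 0].
Proof.
pose h := expV 1.
(* Each of the two factors equals e^(-1) at the origin, whence the normalisation e^2. *)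
exists (fun x => expR 2 * (h (1 * x + 1) * h (-1 * x + 1))); split.
- apply: smoothM; first exact: smooth_cst.
  by apply: smoothM; apply: smooth_affine; exact: smooth_expV.
- rewrite !mulr0 !add0r /h /expV ltr01 hornerC !mul1r invr1 -!expRD.
  by rewrite (_ : _ + _ = 0) ?expR0//; ring.
- move=> x; rewrite ltr_normr => /orP[x1|x1].
    by rewrite [h (-1 * x + 1)]/h /expV ifF ?mulr0//; apply/negbTE; rewrite -leNgt; lra.
  by rewrite [h (1 * x + 1)]/h /expV ifF ?mul0r ?mulr0//; apply/negbTE; rewrite -leNgt; lra.
Qed.

End Smooth.

Section WeakDerivative.
Context {R : realType}.
Implicit Types (f g : R -> R).
Local Notation mu := (@lebesgue_measure R).
Local Notation integr f := (mu.-integrable setT (EFin \o f)).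

Lemma Rintegral_dominated (fn : nat -> R -> R) f g :
  (forall n, measurable_fun setT (fn n)) -> measurable_fun setT f -> integr g ->
  (forall x, fn n x @[n --> \oo] --> f x) -> (forall n x, `|fn n x| <= g x) ->
  \int[mu]_x fn n x @[n --> \oo] --> \int[mu]_x f x.
Proof.
move=> mfn mf ig fnf fng.
have fi : integr f.
  apply: (L1_integrable (L1_dom (integrable_L1 ig) mf _)) => x.
  apply: (@le_trans _ _ (g x)); last exact: ler_norm.
  have h : `|fn n x| @[n --> \oo] --> `|f x| by exact: cvg_norm.
  rewrite -(cvg_lim _ h)//; apply: limr_le; first exact: cvgP h.
  by apply: nearW => n; exact: fng.
have H : ((\int[mu]_x (fn n x)%:E)%E @[n --> \oo] --> (\int[mu]_x (f x)%:E)%E).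
  apply: (@dominated_cvg _ _ _ mu setT measurableT (fun n x => (fn n x)%:E) (EFin \o f) (EFin \o g)) => //.
  - by move=> n; apply/measurable_EFinP; exact: mfn.
  - by move=> x _; apply: cvg_EFin; [exact: nearW|exact: fnf].
  - by move=> n x _; rewrite lee_fin.
apply: fine_cvg; rewrite fineK//; exact: integrable_fin_num.
Qed.

Lemma csupp_bounded f (m : R) : 0 <= m -> continuous f -> (forall x, m < `|x| -> f x = 0) ->
  exists E : R, forall x, `|f x| <= E.
Proof.
move=> m0 cf f0.
have cn : {within `[- m, m], continuous (fun x => `|f x|)}.
  by apply: continuous_subspaceT => x; apply: cvg_norm; exact: cf.
have Nm : - m <= m by lra.
have [c _ Hc] := EVT_max Nm cn.
exists `|f c| => x; have [xm|xm] := leP `|x| m; last by rewrite f0// normr0.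
by apply: Hc; rewrite in_itv/= -ler_norml.
Qed.

Lemma derive1_csupp f (m : R) x : (forall x, m < `|x| -> f x = 0) -> m < `|x| ->
  f^`()%classic x = 0.
Proof.
move=> f0 mx.
have fe : \forall y \near x, (fun _ : R => 0 : R) y = f y.
  near=> y; rewrite f0//; near: y.
  have : (fun y : R => `|y|) @ x --> `|x| by apply: cvg_norm; exact: cvg_id.
  by move=> /cvgr_gt; apply.
have d0 : is_derive x (1 : R) (fun _ : R => 0 : R) 0 by exact: is_derive_cst.
by rewrite derive1E; case: (@near_eq_is_derive R R R _ _ _ _ _ fe d0).
Unshelve. all: by end_near. Qed.

(** Test functions without compact support, reached by the cutoffs eta(h x) with h = 1 / (n + 1).
    The derivative of the cutoff costs a factor h but lives where h |x| <= 1, so h (1 + |x|) <= 2: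
    this is why [Phi * f] may exceed an integrable function by the factor 1 + |x|. *)
Lemma weak_ibp f g (Phi Q : R -> R) :
  (forall phi, test_function phi ->
    \int[mu]_x (phi^`()%classic x * f x) = - \int[mu]_x (phi x * g x)) ->
  measurable_fun setT f -> measurable_fun setT g -> smooth Phi ->
  integr (fun x => Phi^`()%classic x * f x) -> integr (fun x => Phi x * g x) ->
  integr Q -> (forall x, `|Phi x * f x| <= (1 + `|x|) * Q x) ->
  \int[mu]_x (Phi^`()%classic x * f x) = - \int[mu]_x (Phi x * g x).
Proof.
move=> fg mf mg sP iPf iPg iQ PQ.
have [eta [seta eta0 etas]] := @smooth_bump R.
have [E HE] := csupp_bounded ler01 (smooth_continuous seta) etas.
have [E' HE'] := csupp_bounded ler01 (smooth_continuous (smooth_derive1 seta))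
  (fun x => @derive1_csupp eta 1 x etas).
have E0 : 0 <= E by exact: le_trans (HE 0).
have E'0 : 0 <= E' by exact: le_trans (HE' 0).
have Q0 x : 0 <= Q x.
  by rewrite -(pmulr_rge0 _ (_ : 0 < 1 + `|x|)) ?ltr_pwDl// (le_trans _ (PQ x)).
pose h (n : nat) : R := n.+1%:R^-1.
have h0 n : 0 < h n by rewrite invr_gt0.
have h1 n : h n <= 1 by rewrite invf_le1// ler1n.
have hcvg : h n @[n --> \oo] --> 0 by exact: cvg_harmonic.
have cvgcomp (u : R -> R) x : continuous u -> u (h n * x + 0) @[n --> \oo] --> u 0.
  move=> cu; apply: (cvg_comp (fun n => h n * x + 0) u _ (cu 0)).
  have H : h n * x + 0 @[n --> \oo] --> 0 * x + 0.
    by apply: cvgD; [exact: cvgMr_tmp|exact: cvg_cst].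
  by rewrite mul0r addr0 in H.
pose phi n x := eta (h n * x + 0) * Phi x.
have sphi n : smooth (phi n) by apply: smoothM => //; exact: smooth_affine.
have tphi n : test_function (phi n).
  split; first exact: sphi.
  exists n.+1%:R => x nx; rewrite /phi etas ?mul0r// addr0 normrM ger0_norm ?ltW//.
  by rewrite mulrC ltr_pdivlMr// mul1r.
have dphi n x : (phi n)^`()%classic x =
    eta (h n * x + 0) * Phi^`()%classic x + h n * eta^`()%classic (h n * x + 0) * Phi x.
  have d1 := is_derive_affine (x := x) (smooth_derivable (x := h n * x + 0) seta).
  have d2 : is_derive x (1 : R) Phi (Phi^`()%classic x).
    by rewrite derive1E; apply: derivableP; exact: smooth_derivable.
  rewrite /phi derive1E; apply: derive_val.
  by apply: is_derive_eq; rewrite /GRing.scale/=; ring.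
have meta n : measurable_fun setT (fun x : R => eta (h n * x + 0)).
  by apply: continuous_measurable_fun; apply: smooth_continuous; exact: smooth_affine.
have meta' n : measurable_fun setT (fun x : R => eta^`()%classic (h n * x + 0)).
  apply: continuous_measurable_fun; apply: smooth_continuous; apply: smooth_affine.
  exact: smooth_derive1.
have mPf : measurable_fun setT (fun x => Phi x * f x).
  by apply: measurable_funM => //; apply: continuous_measurable_fun; exact: smooth_continuous.
have iE : integr (fun x => E * `|Phi^`()%classic x * f x| + 2 * E' * Q x).
  apply: (L1_integrable (L1_D (L1_Z E (integrable_L1 (integrable_abse iPf))) (L1_Z (2 * E') (integrable_L1 iQ)))).
have lim1 : \int[mu]_x ((phi n)^`()%classic x * f x) @[n --> \oo] --> \int[mu]_x (Phi^`()%classic x * f x).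
  apply: (Rintegral_dominated (g := fun x => E * `|Phi^`()%classic x * f x| + 2 * E' * Q x)) => //.
  - move=> n; apply: measurable_funM => //; apply: continuous_measurable_fun.
    apply: smooth_continuous; exact: smooth_derive1.
  - exact: integrable_measurable.
  - move=> x; under eq_fun do rewrite dphi mulrDl -!mulrA.
    have H : eta (h n * x + 0) * (Phi^`()%classic x * f x) +
        h n * (eta^`()%classic (h n * x + 0) * (Phi x * f x)) @[n --> \oo] -->
        eta 0 * (Phi^`()%classic x * f x) + 0 * (eta^`()%classic 0 * (Phi x * f x)).
      apply: cvgD.
        by apply: cvgMr_tmp; apply: cvgcomp; exact: smooth_continuous.
      apply: cvgM => //; apply: cvgMr_tmp.
      by apply: cvgcomp; apply: smooth_continuous; exact: smooth_derive1.
    by rewrite eta0 mul1r mul0r addr0 in H.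
  - move=> n x; rewrite dphi mulrDl; apply: le_trans (ler_normD _ _) _.
    apply: lerD; first by rewrite -mulrA normrM ler_wpM2r.
    have [xn|xn] := ltP 1 `|h n * x + 0|.
      by rewrite (derive1_csupp etas xn) mulr0 !mul0r normr0 !mulr_ge0.
    have -> : h n * eta^`()%classic (h n * x + 0) * Phi x * f x =
      h n * eta^`()%classic (h n * x + 0) * (Phi x * f x) by ring.
    rewrite normrM (normrM (h n)) (ger0_norm (ltW (h0 n))).
    apply: (@le_trans _ _ (h n * E' * ((1 + `|x|) * Q x))).
      by apply: ler_pM => //; [rewrite mulr_ge0// ltW|rewrite ler_wpM2l// ltW].
    rewrite mulrA ler_wpM2r// mulrAC ler_wpM2r// mulrDr mulr1.
    move: xn; rewrite addr0 normrM (ger0_norm (ltW (h0 n))).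
    by have := h1 n; lra.
have lim2 : \int[mu]_x (phi n x * g x) @[n --> \oo] --> \int[mu]_x (Phi x * g x).
  apply: (Rintegral_dominated (g := fun x => E * `|Phi x * g x|)) => //.
  - move=> n; apply: measurable_funM => //; apply: continuous_measurable_fun.
    exact: smooth_continuous.
  - exact: integrable_measurable.
  - exact: (L1_integrable (L1_Z E (integrable_L1 (integrable_abse iPg)))).
  - move=> x; under eq_fun do rewrite /phi -mulrA.
    have H : eta (h n * x + 0) * (Phi x * g x) @[n --> \oo] --> eta 0 * (Phi x * g x).
      by apply: cvgMr_tmp; apply: cvgcomp; exact: smooth_continuous.
    by rewrite eta0 mul1r in H.
  - by move=> n x; rewrite /phi -mulrA normrM ler_wpM2r.
have lim2' : (fun n => - \int[mu]_x (phi n x * g x)) @ \oo --> - \int[mu]_x (Phi x * g x).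
  exact: cvgN.
have E1 : (fun n => \int[mu]_x ((phi n)^`()%classic x * f x)) =
    (fun n => - \int[mu]_x (phi n x * g x)) by apply/funext => n; rewrite fg.
rewrite E1 in lim1.
by rewrite -(cvg_lim _ lim1)// (cvg_lim _ lim2').
Qed.

End WeakDerivative.

(** * Duality with the cosine transform *)

Section Duality.
Context {R : realType}.
Implicit Types (f g k l F : R -> R) (b c th : R).
Local Notation mu := (@lebesgue_measure R).
Local Notation integr f := (mu.-integrable setT (EFin \o f)).

Lemma L2_indic_itv (m : R) : 0 <= m -> L2_le (\1_(`[- m, m]) : R -> R) (Num.sqrt (2 * m)).
Proof.
move=> m0; split; first exact: measurable_indic.
rewrite sqr_sqrtr ?mulr_ge0//.
under eq_integral => x _.
  rewrite (_ : \1_(`[- m, m]) x ^+ 2 = \1_(`[- m, m]) x :> R); last first.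
    by rewrite indicE; case: (_ \in _); rewrite ?expr1n ?expr0n.
  over.
rewrite integral_indic// setIT /= lebesgue_measure_itv/= lte_fin.
by case: ifPn => _; [rewrite -EFinD lee_fin; lra|rewrite lee_fin mulr_ge0].
Qed.

Definition cut (n : nat) f (x : R) : R := f x * \1_(`[- n%:R, n%:R]) x.

Lemma cut_integrable n f b : 0 <= b -> L2_le f b -> integr (cut n f).
Proof.
move=> b0 fb; by apply: L1_integrable (L1_CS b0 _ fb (L2_indic_itv _)).
Qed.

Lemma bcs_L2 l (M m : R) : bcs l M m -> exists2 c, 0 <= c & L2_le l c.
Proof.
move=> [ml lM l0]; have M0 : 0 <= M by rewrite (le_trans _ (lM 0)).
exists (`|M| * Num.sqrt (2 * `|m|)); first by rewrite mulr_ge0// sqrtr_ge0.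
apply: L2_dom (L2_Z M (L2_indic_itv (normr_ge0 m))) ml _ => x.
rewrite normrM (ger0_norm M0) indicE.
have [xm|xm] := boolP (x \in _); first by rewrite normr1 mulr1.
rewrite normr0 mulr0 l0 ?normr0//; apply: le_lt_trans (ler_norm m) _.
rewrite ltNge; apply: contra xm => xm.
by rewrite inE/= in_itv/= -ler_norml.
Qed.

Lemma continuous_cosT_integrable th l : integr l -> continuous (cosT th l).
Proof.
move=> il x.
apply: (@continuity_under_integral R _ _ mu (fun x y => cos (x * y + th) * l y) setT measurableT (x - 1) (x + 1) _ _ (fun y => `|l y|)).
- by move=> u _; exact: cosT_integrand.
- apply/aeW => y _ u _; apply: cvgMr_tmp.
  apply: (@continuous_comp _ _ _ (fun u : R => u * y + th) cos); last exact: continuous_cos.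
  by apply: cvgD; [apply: cvgMr_tmp; exact: cvg_id|exact: cvg_cst].
- exact: (integrable_abse il).
- move=> u _; apply/aeW => y _; rewrite normrM ler_piMl//; exact: cos_norm_le1.
- by rewrite inE/= in_itv/=; apply/andP; split; lra.
Qed.

Lemma bessel_integrable th f l (M m b : R) : 0 <= b -> L2_le f b -> bcs l M m ->
  integr (fun x => f x * cosT th l x).
Proof.
move=> b0 fb bl.
have [c c0 lc] := bcs_L2 bl.
(* [cosT_Bessel] asks for a positive support radius, so the radius is enlarged. *)
have bl' : bcs l M (`|m| + 1).
  case: bl => ml lM l0; split=> // x xm; apply: l0; apply: le_lt_trans xm.
  by rewrite (le_trans (ler_norm m))// lerDl.
have m0 : 0 < `|m| + 1 by rewrite ltr_wpDl.
have h := cosT_Bessel th m0 c0 bl' lc.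
by apply: L1_integrable (L1_CS b0 _ fb h); rewrite !mulr_ge0 ?pi_ge0.
Qed.

Lemma bessel_le th f l (M m b c : R) : 0 <= b -> 0 <= c -> L2_le f b -> bcs l M m ->
  L2_le l c -> `|\int[mu]_x (f x * cosT th l x)| <= 14 * pi * b * c.
Proof.
move=> b0 c0 fb bl lc.
have bl' : bcs l M (`|m| + 1).
  case: bl => ml lM l0; split=> // x xm; apply: l0; apply: le_lt_trans xm.
  by rewrite (le_trans (ler_norm m))// lerDl.
have m0 : 0 < `|m| + 1 by rewrite ltr_wpDl.
have h := cosT_Bessel th m0 c0 bl' lc.
rewrite (_ : 14 * pi * b * c = b * (14 * pi * c)); last by ring.
by apply: L1_Rintegral (L1_CS b0 _ fb h); rewrite !mulr_ge0 ?pi_ge0.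
Qed.

(* Dual form of [F] being the L^2 limit of the cosine transforms of the truncations of
   [f] (with phase shift [th1]) plus those of [g] (with phase shift [th2]). *)
Definition transform_pair th1 th2 f g F := forall k (M m : R), bcs k M m ->
  \int[mu]_x (F x * k x) =
  \int[mu]_x (f x * cosT th1 k x) + \int[mu]_x (g x * cosT th2 k x).

Lemma cut_cvg th f l (M m b : R) : 0 <= b -> L2_le f b -> bcs l M m ->
  \int[mu]_x (cut n f x * cosT th l x) @[n --> \oo] --> \int[mu]_x (f x * cosT th l x).
Proof.
move=> b0 fb bl; have ifl := bessel_integrable th b0 fb bl.
have mf : measurable_fun setT f by case: fb.
apply: (Rintegral_dominated (g := fun x => `|f x * cosT th l x|)).
- move=> n; apply: measurable_funM; last exact: measurable_cosT bl.
  by apply: measurable_funM => //; exact: measurable_indic.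
- exact: integrable_measurable.
- exact: (integrable_abse ifl).
- move=> x; apply: cvg_near_cst; exists (Num.truncn `|x|).+1 => // n /= xn.
  rewrite /cut indicE mem_set ?mulr1//= in_itv/= -ler_norml ltW//.
  by apply: lt_le_trans (truncnS_gt _) _; rewrite ler_nat.
- move=> n x; rewrite /cut !normrM ler_wpM2r// ler_piMr// indicE.
  by case: (_ \in _); rewrite ?normr1 ?normr0.
Qed.

(** For truncated functions the identity is the self-transposition of [cosT]. On the left the limit
    is taken by Cauchy-Schwarz against [k]; on the right by dominated convergence, as Bessel's
    inequality makes [f * cosT th1 k] and [g * cosT th2 k] integrable. *)
Lemma transform_pair_lim th1 th2 f g F (b B : R) : 0 <= b -> 0 <= B ->
  L2_le f b -> L2_le g b -> L2_le F B ->
  (forall e, 0 < e -> \forall n \near \oo,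
     L2_le (fun x => F x - (cosT th1 (cut n f) x + cosT th2 (cut n g) x)) e) ->
  transform_pair th1 th2 f g F.
Proof.
move=> b0 B0 fb gb FB Fn k M m bk.
pose G n x := cosT th1 (cut n f) x + cosT th2 (cut n g) x.
have icf n := cut_integrable n b0 fb; have icg n := cut_integrable n b0 gb.
have mG n : measurable_fun setT (G n).
  by apply: measurable_funD; apply: continuous_measurable_fun; exact: continuous_cosT_integrable.
have [c c0 kc] := bcs_L2 bk; have ik := bcs_integrable bk.
have mF : measurable_fun setT F by case: FB.
have mk : measurable_fun setT k by case: bk.
have iFk := L1_integrable (L1_CS B0 c0 FB kc).
have i1 n := integrableM_cosT th1 ik (icf n); have i2 n := integrableM_cosT th2 ik (icg n).
have GE n : \int[mu]_x (G n x * k x) =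
    \int[mu]_x (cut n f x * cosT th1 k x) + \int[mu]_x (cut n g x * cosT th2 k x).
  rewrite (cosT_swap th1 (icf n) ik) (cosT_swap th2 (icg n) ik) -RintegralD//.
  by apply: eq_Rintegral => x _; rewrite /G; ring.
have iGk n : integr (fun x => G n x * k x).
  have := L1_integrable (L1_D (integrable_L1 (i1 n)) (integrable_L1 (i2 n))).
  by apply: eq_integrable => // x _; congr EFin; rewrite /G; ring.
have lim2 : \int[mu]_x (G n x * k x) @[n --> \oo] -->
    \int[mu]_x (f x * cosT th1 k x) + \int[mu]_x (g x * cosT th2 k x).
  under eq_fun do rewrite GE.
  by apply: cvgD; [exact: cut_cvg fb bk|exact: cut_cvg gb bk].
have lim1 : \int[mu]_x (G n x * k x) @[n --> \oo] --> \int[mu]_x (F x * k x).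
  apply/cvgrPdist_le => e e0.
  have c1 : 0 < c + 1 by rewrite ltr_wpDl.
  (* The 1 guards against a vanishing bound c. *)
  pose d := e / (c + 1); have d0 : 0 < d by rewrite divr_gt0.
  near=> n.
  have FG : L2_le (fun x => F x - G n x) d by near: n; exact: Fn.
  rewrite -RintegralB//.
  have := L1_Rintegral (L1_CS (ltW d0) c0 FG kc).
  rewrite (_ : \int[mu]_x ((F x - G n x) * k x) = \int[mu]_x (F x * k x - G n x * k x)); last first.
    by apply: eq_Rintegral => x _; rewrite mulrBl.
  move/le_trans; apply.
  by rewrite /d mulrAC ler_pdivrMr// ler_pM2l// lerDl.
by rewrite -(cvg_lim _ lim1)// (cvg_lim _ lim2).
Unshelve. all: by end_near. Qed.

(** [F] is tested against itself, cut in space and in height so that the test function is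
    admissible. This gives I <= D I^(1/2) for the truncated square integral I, hence I <= D^2, and
    the truncation is then removed. *)
Lemma L2_dual F (D : R) : 0 <= D -> measurable_fun setT F ->
  (forall k (M m c : R), 0 <= c -> bcs k M m -> L2_le k c ->
     `|\int[mu]_x (F x * k x)| <= D * c) -> L2_le F D.
Proof.
move=> D0 mF H; split=> //.
pose S n : set R := `[- n%:R, n%:R] `&` [set x | `|F x| <= n%:R].
have mS n : measurable (S n).
  apply: measurableI => //.
  rewrite (_ : [set x | _] = setT `&` F @^-1` `[- n%:R, n%:R]); last first.
    by rewrite setTI; apply/seteqP; split=> x /=; rewrite in_itv/= -ler_norml.
  exact: mF.
apply: (integral_le_exhaust (D := S)) => //.
- exact: measurable_funX.
- by move=> x; exact: sqr_ge0.
- move=> n p np x [/=]; rewrite !in_itv/= -!ler_norml => h1 h2.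
  have np' : n%:R <= p%:R :> R by rewrite ler_nat.
  by split=> /=; rewrite ?in_itv/= -?ler_norml; apply: le_trans np'.
- move=> x; exists (maxn (Num.truncn `|x|).+1 (Num.truncn `|F x|).+1); split=> /=.
    rewrite in_itv/= -ler_norml ltW//; apply: lt_le_trans (truncnS_gt _) _.
    by rewrite ler_nat leq_maxl.
  by rewrite ltW//; apply: lt_le_trans (truncnS_gt _) _; rewrite ler_nat leq_maxr.
move=> n; pose k x := F x * \1_(S n) x.
have kS x : F x ^+ 2 * \1_(S n) x = k x ^+ 2.
  by rewrite /k exprMn indicE; case: (_ \in _); rewrite ?expr1n ?expr0n.
have bk : bcs k n%:R n%:R.
  split.
  - by apply: measurable_funM => //; exact: measurable_indic.
  - move=> x; rewrite /k indicE; have [|_] := boolP (x \in S n).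
      by rewrite inE => -[_ /=]; rewrite mulr1.
    by rewrite mulr0 normr0.
  - move=> x nx; rewrite /k indicE memNset ?mulr0// => -[/=].
    by rewrite in_itv/= -ler_norml leNgt nx.
have [c0 c00 kc0] := bcs_L2 bk.
have ik2 : integr (fun x => k x ^+ 2).
  by have := L1_integrable (L1_CS c00 c00 kc0 kc0); apply: eq_integrable.
pose I := \int[mu]_x (k x ^+ 2).
have I0 : 0 <= I by apply: Rintegral_ge0 => x _; exact: sqr_ge0.
have IE : (\int[mu]_x (k x ^+ 2)%:E)%E = I%:E.
  by rewrite /I /Rintegral fineK//; exact: integrable_fin_num.
(* The crude bound [c0] served to make the square integrable; the argument needs the exact norm of
   [k]. *)
have kc : L2_le k (Num.sqrt I).
  by split; [case: bk|rewrite sqr_sqrtr// IE].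
have := H _ _ _ _ (sqrtr_ge0 I) bk kc.
have -> : \int[mu]_x (F x * k x) = I.
  apply: eq_Rintegral => x _; rewrite -kS /k mulrA -expr2//.
rewrite (ger0_norm I0) => ID.
under eq_integral do rewrite kS.
rewrite IE lee_fin -(sqr_sqrtr I0) lerXn2r ?nnegrE ?sqrtr_ge0//.
have [I00|I00] := eqVneq I 0; first by rewrite I00 sqrtr0.
have sI : 0 < Num.sqrt I by rewrite sqrtr_gt0 lt_neqAle eq_sym I00.
by rewrite -(ler_pM2r sI) -expr2 sqr_sqrtr.
Qed.

(** Two transforms enter the pair, each costing the Bessel constant 14 pi. *)
Lemma transform_pair_L2 th1 th2 f g F (b : R) : 0 <= b -> L2_le f b -> L2_le g b ->
  measurable_fun setT F -> transform_pair th1 th2 f g F -> L2_le F (28 * pi * b).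
Proof.
move=> b0 fb gb mF FP; apply: L2_dual => //; first by rewrite !mulr_ge0 ?pi_ge0.
move=> k M m c c0 bk kc; rewrite (FP _ _ _ bk).
apply: le_trans (ler_normD _ _) _.
have := bessel_le th1 b0 c0 fb bk kc; have := bessel_le th2 b0 c0 gb bk kc; lra.
Qed.

End Duality.

Section DerivativeDuality.
Context {R : realType}.
Implicit Types (f g k l F psi : R -> R) (b c th : R).
Local Notation mu := (@lebesgue_measure R).
Local Notation integr f := (mu.-integrable setT (EFin \o f)).

Definition weak_deriv f g := forall phi, test_function phi ->
  \int[mu]_x (phi^`()%classic x * f x) = - \int[mu]_x (phi x * g x).

Lemma derive1_cosT th l (M m : R) : bcs l M m ->
  (cosT th l)^`()%classic = cosT (th + pi / 2) (fun y => y * l y).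
Proof.
move=> bl; apply/funext => x; rewrite derive1E.
exact: (@derive_val _ _ _ _ _ _ _ (is_derive_cosT th x bl)).
Qed.

Lemma smooth_cosT th l (M m : R) : bcs l M m -> smooth (cosT th l).
Proof.
move=> bl; apply: (@smooth_stable R (fun f => exists th l M m, bcs l M m /\ f = cosT th l)); last first.
  by exists th, l, M, m.
move=> f [t [k [M' [m' [bk ->]]]]]; split; first by move=> x; case: (is_derive_cosT t x bk).
exists (t + pi / 2), (fun y => y * k y), (`|m'| * M'), m'; split; first exact: bcsX.
exact: derive1_cosT bk.
Qed.

Lemma cosT_pi th l x : integr l -> cosT (th + pi) l x = - cosT th l x.
Proof.
move=> il; rewrite -mulN1r -RintegralZl//; last exact: cosT_integrand.
by apply: eq_Rintegral => y _; rewrite addrA cosDpi; ring.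
Qed.

(** A factor y under the transform is a derivative of the transform, which is moved onto [f]. The
    transform is smooth but need not have compact support, hence the appeal to [weak_ibp]. *)
Lemma weak_deriv_cosT th f g l (M m b : R) : 0 <= b -> L2_le f b -> L2_le g b ->
  weak_deriv f g -> bcs l M m ->
  \int[mu]_x (f x * cosT (th + pi / 2) (fun y => y * l y) x) =
  - \int[mu]_x (g x * cosT th l x).
Proof.
move=> b0 fb gb fg bl.
have bxl := bcsX bl.
have i1 := bessel_integrable (th + pi / 2) b0 fb bxl.
have i2 := bessel_integrable th b0 gb bl.
have i3 := bessel_integrable th b0 fb bl.
have dT := derive1_cosT th bl.
transitivity (\int[mu]_x ((cosT th l)^`()%classic x * f x)).
  by rewrite dT; apply: eq_Rintegral => x _; rewrite mulrC.
rewrite (weak_ibp (Q := fun x => `|f x * cosT th l x|) fg)//.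
- by congr (- _); apply: eq_Rintegral => x _; rewrite mulrC.
- by case: fb.
- by case: gb.
- exact: smooth_cosT bl.
- by rewrite dT; apply: eq_integrable i1 => // x _ /=; rewrite mulrC.
- by apply: eq_integrable i2 => // x _ /=; rewrite mulrC.
- exact: (integrable_abse i3).
- by move=> x; rewrite (mulrC (cosT _ _ _)) ler_peMl// lerDl.
Qed.

Lemma weak_deriv2_cosT th f f1 f2 l (M m b : R) : 0 <= b ->
  L2_le f b -> L2_le f1 b -> L2_le f2 b -> weak_deriv f f1 -> weak_deriv f1 f2 ->
  bcs l M m ->
  \int[mu]_x (f x * cosT th (fun y => y ^+ 2 * l y) x) =
  - \int[mu]_x (f2 x * cosT th l x).
Proof.
move=> b0 fb f1b f2b ff1 f12 bl.
(* Two derivatives shift the phase by pi, so starting from th - pi brings it back to [th]; the shift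
   by pi in the remaining transform supplies the sign. *)
pose t := th - pi.
have h1 := weak_deriv_cosT (t + pi / 2) b0 fb f1b ff1 (bcsX bl).
have h2 := weak_deriv_cosT t b0 f1b f2b f12 bl.
transitivity (\int[mu]_x (f x * cosT (t + pi / 2 + pi / 2) (fun y => y * (y * l y)) x)).
  apply: eq_Rintegral => x _; congr (_ * _).
  rewrite (_ : t + pi / 2 + pi / 2 = th); last by rewrite /t; field.
  by congr (cosT _ _ _); apply/funext => y; rewrite mulrA expr2.
rewrite h1 h2 opprK.
have i1 := bessel_integrable t b0 f2b bl.
rewrite -mulN1r -(RintegralZl (-1) measurableT (bessel_integrable th b0 f2b bl)).
apply: eq_Rintegral => x _.
rewrite (_ : th = t + pi); last by rewrite /t; ring.
by rewrite cosT_pi; [ring|exact: bcs_integrable bl].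
Qed.

Lemma transform_pair_L2_sqr th1 th2 f f1 f2 g g1 g2 F (b : R) : 0 <= b ->
  L2_le f b -> L2_le f1 b -> L2_le f2 b -> weak_deriv f f1 -> weak_deriv f1 f2 ->
  L2_le g b -> L2_le g1 b -> L2_le g2 b -> weak_deriv g g1 -> weak_deriv g1 g2 ->
  measurable_fun setT F -> transform_pair th1 th2 f g F ->
  L2_le (fun x => x ^+ 2 * F x) (28 * pi * b).
Proof.
move=> b0 fb f1b f2b ff1 f12 gb g1b g2b gg1 g12 mF FP.
apply: L2_dual => //.
- by rewrite !mulr_ge0 ?pi_ge0.
- by apply: measurable_funM => //; exact: measurable_funX.
move=> k M m c c0 bk kc.
have bk2 : bcs (fun x => x ^+ 2 * k x) (`|m ^+ 2| * M) m.
  apply: bcsM bk _ _; first exact: measurable_funX.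
  move=> x xm; rewrite normrX lerXn2r ?nnegrE//; exact: le_trans xm.
rewrite (_ : \int[mu]_x _ = \int[mu]_x (F x * (x ^+ 2 * k x))); last first.
  by apply: eq_Rintegral => x _; ring.
rewrite (FP _ _ _ bk2) (weak_deriv2_cosT th1 b0 fb f1b f2b ff1 f12 bk).
rewrite (weak_deriv2_cosT th2 b0 gb g1b g2b gg1 g12 bk).
apply: le_trans (ler_normD _ _) _; rewrite !normrN.
have := bessel_le th1 b0 c0 f2b bk kc; have := bessel_le th2 b0 c0 g2b bk kc; lra.
Qed.

Section CompactIbp.
Variables (psi psi' : R -> R) (p q : R).
Hypothesis pq : p < q.
Hypothesis dpsi : forall x, p <= x <= q -> is_derive x (1 : R) psi (psi' x).
Hypothesis cpsi' : {within `[p, q], continuous psi'}.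
Hypothesis psip : psi p = 0.
Hypothesis psiq : psi q = 0.

Let I (x : R) : R := \1_(`[p, q]) x.
Let m := Num.max `|p| `|q|.

Let in_m x : p <= x <= q -> `|x| <= m.
Proof.
move=> /andP[px xq]; rewrite ler_norml /m; apply/andP; split.
  rewrite lerNl le_max -normrN; apply/orP; left.
  by apply: le_trans (ler_norm (- p)); rewrite lerN2.
by rewrite le_max; apply/orP; right; apply: le_trans xq (ler_norm _).
Qed.

Let cpsi : {within `[p, q], continuous psi}.
Proof.
by apply: derivable_within_continuous => x; rewrite in_itv/= => /dpsi[].
Qed.

Let bcs_itv g : {within `[p, q], continuous g} -> exists M, bcs (fun x => g x * I x) M m.
Proof.
move=> cg.
have cn : {within `[p, q], continuous (fun x => `|g x|)}.
  by move=> x; apply: cvg_norm; exact: cg.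
have [c _ Hc] := EVT_max (ltW pq) cn.
exists `|g c|; split.
- have h : measurable_fun `[p, q] g.
    exact: (subspace_continuous_measurable_fun (measurable_itv `[p, q]) cg).
  have := (measurable_restrictT g (measurable_itv `[p, q])).1 h.
  apply: eq_measurable_fun => x _; rewrite patchE /I indicE.
  by case: (_ \in _); rewrite ?mulr1 ?mulr0.
- move=> x; rewrite /I indicE; have [|_] := boolP (x \in _).
    by rewrite inE mulr1 => /Hc.
  by rewrite mulr0 normr0.
- move=> x mx; rewrite /I indicE memNset ?mulr0//= in_itv/= => /in_m.
  by rewrite leNgt mx.
Qed.

Lemma bcs_psi : exists M, bcs (fun x => psi x * I x) M m.
Proof. exact: bcs_itv. Qed.

Let cid_itv : {within `[p, q], continuous (@id R)}.
Proof. by apply: continuous_subspaceT => x; exact: cvg_id. Qed.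

Lemma bcs_xpsi' : exists M, bcs (fun x => x * psi' x * I x) M m.
Proof. by apply: bcs_itv => x; apply: cvgM; [exact: cid_itv|exact: cpsi']. Qed.

(* Integration by parts: the transform of [xi psi'] is minus the derivative of
   [x] times the transform of [psi]. *)
Lemma is_derive_xcosT th x :
  is_derive x (1 : R) (fun x => x * cosT th (fun y => psi y * I y) x)
    (- cosT th (fun y => y * psi' y * I y) x).
Proof.
have [M bp] := bcs_psi; have [M' bp'] := bcs_xpsi'.
have ibp := bcs_integrable bp.
have dT := is_derive_cosT th x bp.
have -> : - cosT th (fun y => y * psi' y * I y) x =
  x * cosT (th + pi / 2) (fun y => y * (psi y * I y)) x + cosT th (fun y => psi y * I y) x.
  (* Integrating psi' G by parts yields both terms at once: the derivative of G contains the
     transform of [psi] and the one with phase shifted by pi / 2. The boundary terms vanish with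
     [psi]. *)
  pose G y := y * cos (x * y + th).
  pose g y := cos (x * y + th) - x * y * sin (x * y + th).
  have dG (y : R) : is_derive y (1 : R) G (g y).
    by apply: is_derive_eq; rewrite /GRing.scale/= /g; ring.
  have cg : continuous g.
    move=> y; apply/differentiable_continuous/derivable1_diffP.
    have [//] : is_derive y (1 : R) g (- x * sin (x * y + th) - x * (sin (x * y + th) + y * (x * cos (x * y + th)))).
    by apply: is_derive_eq; rewrite /GRing.scale/=; ring.
  have LRc (u v : R -> R) : (forall y, p <= y <= q -> is_derive y (1 : R) u (v y)) ->
      derivable_oo_LRcontinuous u p q /\ {in `]p, q[, u^`()%classic =1 v}.
    move=> duv.
    have cu y : p <= y <= q -> {for y, continuous u}.
      by move=> /duv[dy _]; exact/differentiable_continuous/derivable1_diffP.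
    split; first split.
    + by move=> y; rewrite in_itv/= => /andP[ax xb]; case: (duv y) => //; rewrite !ltW.
    + by apply: cvg_at_right_filter; apply: cu; rewrite lexx ltW.
    + by apply: cvg_at_left_filter; apply: cu; rewrite lexx ltW.
    + move=> y; rewrite in_itv/= => /andP[ax xb].
      by rewrite derive1E; case: (duv y) => //; rewrite !ltW.
  have [lG eG] := LRc G g (fun y _ => dG y); have [lp ep] := LRc _ _ dpsi.
  have cgw : {within `[p, q], continuous g} by exact: continuous_subspaceT.
  have := Rintegration_by_parts pq cpsi' lp ep cgw lG eG.
  rewrite psip psiq !mul0r subr0 sub0r => H.
  have mkc (u : R -> R) : \int[mu]_y (u y * I y) = \int[mu]_(y in `[p, q]) u y.
    rewrite [RHS]Rintegral_mkcond; apply: eq_Rintegral => y _.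
    by rewrite patchE /I indicE; case: (_ \in _); rewrite ?mulr1 ?mulr0.
  have -> : cosT th (fun y => y * psi' y * I y) x = \int[mu]_(y in `[p, q]) (psi' y * G y).
    by rewrite -mkc; apply: eq_Rintegral => y _; rewrite /G; ring.
  rewrite -H -mkc /cosT -RintegralZl//; last first.
    exact: cosT_integrand (bcs_integrable (bcsX bp)).
  rewrite -RintegralD//; last exact: cosT_integrand.
    by apply: eq_Rintegral => y _; rewrite addrA cosDpihalf /g; ring.
  apply: (L1_integrable (L1_Z x (integrable_L1 (cosT_integrand _ _ _)))).
  exact: bcs_integrable (bcsX bp).
by apply: is_derive_eq; rewrite /GRing.scale/=; ring.
Qed.

(** With T the transform of [psi], the left side pairs [f] with -(x T)'. Moving the derivative gives
    the pairing of f' with x T, that is, of x f' with T. The function x T may grow linearly relative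
    to T, which is the growth that [weak_ibp] tolerates. *)
Lemma transform_pair_dilation_aux th f f1 (b : R) : 0 <= b -> L2_le f b -> measurable_fun setT f1 ->
  L2_le (fun x => x * f1 x) b -> weak_deriv f f1 ->
  \int[mu]_x (f x * cosT th (fun y => y * psi' y * I y) x) =
  \int[mu]_x (x * f1 x * cosT th (fun y => psi y * I y) x).
Proof.
move=> b0 fb mf1 xf1 ff1.
have [M bp] := bcs_psi; have [M' bp'] := bcs_xpsi'.
pose T := cosT th (fun y => psi y * I y); pose H := cosT th (fun y => y * psi' y * I y).
pose Phi x := x * T x.
have dPhi : Phi^`()%classic = fun x => - H x.
  by apply/funext => x; rewrite derive1E; case: (is_derive_xcosT th x).
have i1 := bessel_integrable th b0 fb bp'.
have i2 := bessel_integrable th b0 xf1 bp.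
have i3 := bessel_integrable th b0 fb bp.
transitivity (- \int[mu]_x (Phi^`()%classic x * f x)).
  rewrite -[RHS]mulN1r -RintegralZl//; last first.
    rewrite dPhi; have := L1_integrable (L1_Z (-1) (integrable_L1 i1)).
    by apply: eq_integrable => // x _ /=; congr EFin; rewrite /H; ring.
  by apply: eq_Rintegral => x _; rewrite dPhi /H; ring.
rewrite (weak_ibp (Q := fun x => `|f x * T x|) ff1)//.
- by rewrite opprK; apply: eq_Rintegral => x _; rewrite /Phi /T; ring.
- by case: fb.
- by apply: smoothM; [exact: smooth_id|exact: smooth_cosT bp].
- rewrite dPhi; have := L1_integrable (L1_Z (-1) (integrable_L1 i1)).
  by apply: eq_integrable => // x _ /=; congr EFin; rewrite /H; ring.
- by apply: eq_integrable i2 => // x _ /=; congr EFin; rewrite /Phi /T; ring.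
- exact: (integrable_abse i3).
- move=> x; rewrite /Phi -mulrA normrM (mulrC (T x)) ler_wpM2r// lerDr//.
Qed.

Lemma transform_pair_dilation th1 th2 f f1 g g1 F (b c : R) : 0 <= b -> 0 <= c ->
  L2_le f b -> measurable_fun setT f1 -> L2_le (fun x => x * f1 x) b -> weak_deriv f f1 ->
  L2_le g b -> measurable_fun setT g1 -> L2_le (fun x => x * g1 x) b -> weak_deriv g g1 ->
  transform_pair th1 th2 f g F -> L2_le (fun x => psi x * I x) c ->
  `|\int[mu]_x (F x * (x * psi' x * I x))| <= 28 * pi * b * c.
Proof.
move=> b0 c0 fb mf1 xf1 ff1 gb mg1 xg1 gg1 FP pc.
have [M bp] := bcs_psi; have [M' bp'] := bcs_xpsi'.
rewrite (FP _ _ _ bp') (transform_pair_dilation_aux th1 b0 fb mf1 xf1 ff1).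
rewrite (transform_pair_dilation_aux th2 b0 gb mg1 xg1 gg1).
apply: le_trans (ler_normD _ _) _.
have := bessel_le th1 b0 c0 xf1 bp pc; have := bessel_le th2 b0 c0 xg1 bp pc; lra.
Qed.

End CompactIbp.

End DerivativeDuality.

(** * The oscillatory integral *)

Section StationaryPhase.
Context {R : realType}.
Implicit Types (x y r t s alpha beta : R).

(** Young's inequality for the product of r^beta and 1, with exponents 1 / beta and 1 / (1 -
    beta). *)
Lemma powR_Bernoulli r beta : 0 < r -> 0 < beta < 1 -> r `^ beta <= 1 - beta * (1 - r).
Proof.
move=> r0 /andP[b0 b1].
have b1' : 0 < 1 - beta by rewrite subr_gt0.
have E1 : (r `^ beta) `^ (beta^-1) = r.
  by rewrite -powRrM divff ?gt_eqF// powRr1// ltW.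
have bV : 0 < beta^-1 by rewrite invr_gt0.
have bV' : 0 < (1 - beta)^-1 by rewrite invr_gt0.
have e1 : beta^-1^-1 + (1 - beta)^-1^-1 = 1 by rewrite !invrK; ring.
have := @conjugate_powR R (r `^ beta) 1 beta^-1 (1 - beta)^-1 (powR_ge0 _ _) ler01 bV bV' e1.
by rewrite E1 powR1 mulr1 !invrK mul1r; lra.
Qed.

Lemma powR_ge1 r s : 1 <= r -> 0 <= s -> 1 <= r `^ s.
Proof. by move=> r1 s0; rewrite -[leLHS](powRr0 r) ler_powR. Qed.

Lemma powR_le1 r s : 0 < r <= 1 -> 0 <= s -> r `^ s <= 1.
Proof. by move=> r1 s0; rewrite -[leRHS](powRr0 r) ger_powR. Qed.

(** Here r stands for x / x0 with x0 the stationary point: 1 - r^(1 - alpha) is the normalised phase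
    derivative and 1 - r^(-alpha/2) the relative distance in the variable u. The latter blows up as
    r tends to 0 while the former stays bounded, hence the first alternative. *)
Lemma powR_gap r alpha : 0 < r -> 0 < alpha < 1 ->
  let c := (1 - alpha) / 2 in
  c <= `|1 - r `^ (1 - alpha)| \/
  c * `|1 - r `^ (- (alpha / 2))| <= `|1 - r `^ (1 - alpha)|.
Proof.
move=> r0 /andP[a0 a1] c.
have b01 : 0 < 1 - alpha < 1 by apply/andP; split; lra.
have c0 : 0 < c by rewrite /c; lra.
have hB := powR_Bernoulli r0 b01.
have [r1|r1] := leP r 1.
  have [r2|r2] := leP r 2^-1.
    left; rewrite /c ger0_norm; nra.
  right.
  have h1 : 1 <= r `^ (- (alpha / 2)).
    by rewrite powRN invf_ge1 ?powR_gt0// powR_le1 ?r0// divr_ge0// ltW.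
  have h2 : r `^ (- (alpha / 2)) <= r^-1.
    rewrite powRN lef_pV2 ?posrE ?powR_gt0//; apply: ger1_powR; first by rewrite r0.
    lra.
  have h3 : r^-1 - 1 <= 2 * (1 - r).
    rewrite (_ : r^-1 - 1 = (1 - r) / r); last by field; rewrite gt_eqF.
    rewrite ler_pdivrMr//; nra.
  rewrite ler0_norm ?subr_le0// ger0_norm; last by nra.
  have : c * (r `^ (- (alpha / 2)) - 1) <= c * (2 * (1 - r)) by apply: (ler_wpM2l (ltW c0)); lra.
  rewrite /c opprB; lra.
right.
(* Beyond the stationary point, Bernoulli's inequality for 1 / r bounds r^(1 - alpha) from below. *)
have r1' : r^-1 < 1 by rewrite invf_lt1.
have rV0 : 0 < r^-1 by rewrite invr_gt0.
have := powR_Bernoulli rV0 b01; set k := (1 - alpha) * (1 - r^-1) => hV.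
have k0 : 0 <= k by rewrite mulr_ge0//; lra.
have rho0 : 0 < r `^ (1 - alpha) by exact: powR_gt0.
have rhoV : r^-1 `^ (1 - alpha) = (r `^ (1 - alpha))^-1.
  by rewrite -(powR_inv1 (ltW r0)) -powRrM mulN1r powRN.
rewrite rhoV in hV.
have rho1 : 1 + k <= r `^ (1 - alpha).
  have h : (r `^ (1 - alpha))^-1 * r `^ (1 - alpha) <= (1 - k) * r `^ (1 - alpha).
    by rewrite ler_wpM2r// ltW.
  rewrite mulVf ?gt_eqF// in h.
  have h1 : 1 <= r `^ (1 - alpha).
    by have := ler_wpM2r (ltW rho0) k0; rewrite mul0r; lra.
  by have := ler_wpM2l k0 h1; lra.
have s1 : r `^ (- (alpha / 2)) <= 1.
  by rewrite powRN invf_le1 ?powR_gt0// powR_ge1// ?divr_ge0// ltW.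
have s2 : r^-1 <= r `^ (- (alpha / 2)).
  rewrite powRN lef_pV2 ?posrE ?powR_gt0//; apply: ler1_powR; first exact: ltW.
  lra.
rewrite ger0_norm ?subr_ge0// ler0_norm; last by lra.
apply: (@le_trans _ _ (c * (1 - r^-1))); first by apply: (ler_wpM2l (ltW c0)); lra.
by rewrite /k /c in rho1 *; nra.
Qed.

Lemma powR_mono (x y s : R) : 0 <= x -> x <= y -> 0 <= s -> x `^ s <= y `^ s.
Proof.
by move=> x0 xy s0; apply: ge0_ler_powR; rewrite ?nnegrE// (le_trans x0).
Qed.

(* In the variable [u = (t x^alpha)^(1/2)], [x] times the derivative of the phase
   [t x^alpha - y x] vanishes at most linearly at a single point [u0]. *)
Lemma phase_derivative_lower alpha t y : 0 < alpha < 1 -> 0 < t ->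
  exists u0 : R, forall x, 0 < x ->
    let c := alpha * (1 - alpha) / 2 in
    let u := Num.sqrt t * x `^ (alpha / 2) in
    let P := alpha * (t * x `^ alpha) - y * x in
    c * u * u <= `|P| \/ c * u * `|u - u0| <= `|P|.
Proof.
move=> /[dup] a01 /andP[a0 a1] t0.
have st0 : 0 < Num.sqrt t by rewrite sqrtr_gt0.
have uu x : 0 < x -> Num.sqrt t * x `^ (alpha / 2) * (Num.sqrt t * x `^ (alpha / 2)) = t * x `^ alpha.
  move=> x0; rewrite mulrACA -expr2 sqr_sqrtr ?ltW//; congr (_ * _).
  rewrite -powRD ?(gt_eqF x0) ?implybT//; congr (_ `^ _); lra.
have [y0|y0] := leP y 0.
  (* For y <= 0 the phase is increasing and P >= alpha u^2, so the first alternative always holds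
     and u0 is arbitrary. *)
  exists 0 => x x0 c u P; left.
  rewrite -mulrA uu// /P ger0_norm; last first.
    have : 0 <= alpha * (t * x `^ alpha) by rewrite !mulr_ge0 ?powR_ge0 ?ltW.
    by have := ler_wpM2r (ltW x0) y0; rewrite mul0r; lra.
  have U0 : 0 <= t * x `^ alpha by rewrite mulr_ge0 ?powR_ge0 ?ltW.
  have : y * x <= 0 by rewrite mulr_le0_ge0// ltW.
  have : c * (t * x `^ alpha) <= alpha * (t * x `^ alpha).
    by rewrite ler_wpM2r// /c; nra.
  lra.
(* The stationary point, the root of alpha t x^(alpha - 1) = y. *)
pose x0 := (y / (alpha * t)) `^ (- (1 - alpha)^-1).
have yat : 0 < y / (alpha * t) by rewrite divr_gt0// mulr_gt0.
have x00 : 0 < x0 by exact: powR_gt0.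
exists (Num.sqrt t * x0 `^ (alpha / 2)) => x xp c u P.
pose r := x / x0; have r0 : 0 < r by rewrite divr_gt0.
have xr : x = r * x0 by rewrite /r divfK ?gt_eqF.
have U0 : 0 < t * x `^ alpha by rewrite mulr_gt0 ?powR_gt0.
have u0 : 0 < u by rewrite mulr_gt0 ?powR_gt0.
have PE : P = alpha * (t * x `^ alpha) * (1 - r `^ (1 - alpha)).
  rewrite /P mulrBr mulr1; congr (_ - _).
  have rE : r `^ (1 - alpha) = x `^ (1 - alpha) * (y / (alpha * t)).
    rewrite /r powRM ?ltW ?invr_gt0//; congr (_ * _).
    rewrite -(powR_inv1 (ltW x00)) -powRrM /x0 -powRrM.
    rewrite (_ : - (1 - alpha)^-1 * (-1 * (1 - alpha)) = 1); last by field; rewrite subr_eq0 gt_eqF.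
    by rewrite powRr1// ltW.
  rewrite rE; have -> : y * x = alpha * t * (x `^ alpha * x `^ (1 - alpha)) * (y / (alpha * t)).
    rewrite -powRD ?(gt_eqF xp) ?implybT//.
    rewrite (_ : alpha + (1 - alpha) = 1); last by ring.
    rewrite powRr1 ?ltW//; field; lra.
  by ring.
have uE : u - Num.sqrt t * x0 `^ (alpha / 2) = u * (1 - r `^ (- (alpha / 2))).
  rewrite mulrBr mulr1; congr (_ - _); rewrite /u -mulrA; congr (_ * _).
  rewrite {1}xr powRM ?ltW// mulrAC -powRD ?(gt_eqF r0) ?implybT//.
  by rewrite addrN powRr0 mul1r.
have aU : 0 <= alpha * (t * x `^ alpha) by rewrite mulr_ge0 ?ltW.
rewrite PE normrM (ger0_norm aU) uE normrM (gtr0_norm u0).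
have -> : c * u * u = alpha * (t * x `^ alpha) * ((1 - alpha) / 2).
  by rewrite -mulrA uu// /c; ring.
have -> : c * u * (u * `|1 - r `^ (- (alpha / 2))|) =
  alpha * (t * x `^ alpha) * ((1 - alpha) / 2 * `|1 - r `^ (- (alpha / 2))|).
  transitivity (c * (u * u) * `|1 - r `^ (- (alpha / 2))|); first by ring.
  have -> : u * u = t * x `^ alpha by exact: uu.
  by rewrite /c; ring.
by have [h|h] := powR_gap r0 a01; [left|right]; rewrite ler_wpM2l.
Qed.

(** A lower bound c u d for |P| makes the denominator at least u^2 (1 + (c d)^2), and 1 + u^2 <= 2
    u^2. The alternatives are d = u and d = |u - u0|; summing the two Lorentzians covers both
    without a case distinction in x. *)
Lemma resonance_bound (c u u0 P : R) : 0 < c -> 0 < u -> 1 <= u ^+ 2 ->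
  c * u * u <= `|P| \/ c * u * `|u - u0| <= `|P| ->
  (1 + u ^+ 2) / (P ^+ 2 + 1 + u ^+ 2) <=
  2 * ((1 + (c * u) ^+ 2)^-1 + (1 + (c * (u - u0)) ^+ 2)^-1).
Proof.
move=> c0 up u1 h.
have main (d : R) : 0 <= d -> c * u * d <= `|P| ->
    (1 + u ^+ 2) / (P ^+ 2 + 1 + u ^+ 2) <= 2 * (1 + (c * d) ^+ 2)^-1.
  move=> d0 hd.
  have u2 : 0 < u ^+ 2 by rewrite exprn_gt0.
  have hP : (c * d) ^+ 2 * u ^+ 2 <= P ^+ 2.
    rewrite -exprMn -(real_normK (num_real P)) lerXn2r ?nnegrE ?mulr_ge0// ?(ltW c0) ?(ltW up)//.
    by rewrite mulrAC.
  have D0 : 0 < 1 + (c * d) ^+ 2 by rewrite ltr_pwDl// sqr_ge0.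
  have N0 : 0 < P ^+ 2 + 1 + u ^+ 2 by have := sqr_ge0 P; lra.
  rewrite ler_pdivrMr// mulrAC ler_pdivlMr//.
  have := sqr_ge0 (c * d); nra.
have i1 : 0 <= (1 + (c * u) ^+ 2)^-1 by rewrite invr_ge0; have := sqr_ge0 (c * u); lra.
have i2 : 0 <= (1 + (c * (u - u0)) ^+ 2)^-1 by rewrite invr_ge0; have := sqr_ge0 (c * (u - u0)); lra.
case: h => h.
  by have := main _ (ltW up) h; lra.
have := main _ (normr_ge0 _) h.
by rewrite exprMn real_normK ?num_real// -exprMn; lra.
Qed.

(** Pointwise algebra, with [DP], [Dv], [Dchi] standing for x times a derivative. With w = (1 + U) /
    N one has P v = 1 - w, so cs P v reproduces cs up to w. The other errors are the derivative of
    v, at most 6 w + 2 / (1 + U), and the two contributions of the cutoff. *)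
Lemma cutoff_error (P U DP alpha cs sn chi Dchi N v Dv : R) :
  0 < alpha < 1 -> 0 <= U -> `|cs| <= 1 -> `|sn| <= 1 -> 0 <= chi <= 1 ->
  DP = P - alpha * (1 - alpha) * U ->
  N = P ^+ 2 + 1 + U -> v = P / N ->
  Dv = DP / N - P * (2 * P * DP + alpha * U) / N ^+ 2 ->
  `|cs - (cs * (P * (v * chi)) + sn * (Dv * chi + v * Dchi))| <=
  7 * ((1 + U) / N) + 2 / (1 + U) + (1 - chi) + `|Dchi|.
Proof.
move=> /andP[a0 a1] U0 cs1 sn1 /andP[chi0 chi1] DPE NE vE DvE.
have P2 := sqr_ge0 P.
have N0 : 0 < N by rewrite NE; lra.
have Nn : N != 0 by rewrite gt_eqF.
pose w := (1 + U) / N.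
have w0 : 0 <= w by rewrite divr_ge0// ?(ltW N0)//; lra.
have PvE : P * v = 1 - w.
  have P2E : P ^+ 2 = N - (1 + U) by rewrite NE; ring.
  by rewrite vE mulrA -expr2 P2E /w; field; exact: Nn.
have Pv0 : 0 <= P * v by rewrite vE mulrA -expr2 divr_ge0// ltW.
have aP := normr_ge0 P.
have aP2 : `|P| ^+ 2 = P ^+ 2 by rewrite real_normK ?num_real.
have v1 : `|v| <= 1.
  rewrite vE normrM normfV (gtr0_norm N0) ler_pdivrMr// mul1r NE -aP2.
  by have := sqr_ge0 (`|P| - 1); nra.
have z0 : 0 <= alpha * (1 - alpha) by apply: mulr_ge0; lra.
have z1 : alpha * (1 - alpha) <= 1 by nra.
have aDP : `|DP| <= `|P| + U.
  rewrite DPE; apply: le_trans (ler_normB _ _) _; rewrite lerD2l.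
  by have := ler_wpM2r U0 z1; rewrite mul1r ger0_norm//; exact: mulr_ge0.
have Dv4 : `|Dv| <= 4 * (`|P| + 1 + U) / N.
  have -> : Dv = (DP * (N - 2 * P ^+ 2) - alpha * P * U) / N ^+ 2.
    by rewrite DvE; field; exact: Nn.
  rewrite normrM normfV (ger0_norm (_ : 0 <= N ^+ 2)) ?sqr_ge0//.
  rewrite ler_pdivrMr ?exprn_gt0//.
  have -> : 4 * (`|P| + 1 + U) / N * N ^+ 2 = 4 * (`|P| + 1 + U) * N by field; exact: Nn.
  apply: le_trans (ler_normB _ _) _.
  have h1 : `|DP * (N - 2 * P ^+ 2)| <= (`|P| + U) * (3 * N).
    rewrite normrM ler_pM//; rewrite ler_norml; apply/andP; split; rewrite NE; lra.
  have h2 : `|alpha * P * U| <= (`|P| + 1 + U) * N.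
    rewrite !normrM (ger0_norm U0) (gtr0_norm a0).
    apply: (@le_trans _ _ (`|P| * U)); first by rewrite ler_wpM2r// ler_piMl// ltW.
    by apply: ler_pM => //; lra.
  nra.
(* From 2 |P| (1 + U) <= P^2 + (1 + U)^2 and P^2 <= N. *)
have PN : `|P| / N <= 2^-1 * (w + (1 + U)^-1).
  have U1 : 0 < 1 + U by lra.
  rewrite ler_pdivrMr// /w.
  have -> : 2^-1 * ((1 + U) / N + (1 + U)^-1) * N = 2^-1 * ((1 + U) + N / (1 + U)).
    by field; rewrite Nn gt_eqF.
  have -> : 2^-1 * (1 + U + N / (1 + U)) = 2^-1 * ((1 + U) ^+ 2 + N) / (1 + U).
    by field; rewrite gt_eqF.
  rewrite ler_pdivlMr// NE -aP2; have := sqr_ge0 (`|P| - (1 + U)); nra.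
have Dv7 : `|Dv| <= 6 * w + 2 / (1 + U).
  apply: le_trans Dv4 _.
  have -> : 4 * (`|P| + 1 + U) / N = 4 * (`|P| / N) + 4 * w by rewrite /w; field; exact: Nn.
  lra.
have -> : cs - (cs * (P * (v * chi)) + sn * (Dv * chi + v * Dchi)) =
  cs * (1 - P * v * chi) - sn * (Dv * chi + v * Dchi) by ring.
apply: le_trans (ler_normB _ _) _; rewrite !normrM.
have k1 : `|1 - P * v * chi| <= w + (1 - chi).
  rewrite ger0_norm PvE; last by nra.
  nra.
have k2 : `|Dv * chi + v * Dchi| <= `|Dv| + `|Dchi|.
  apply: le_trans (ler_normD _ _) _; rewrite !normrM lerD//.
    by rewrite (ger0_norm chi0) ler_piMr.
  by rewrite ler_piMl.
have k3 : `|cs| * `|1 - P * v * chi| <= w + (1 - chi).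
  by apply: le_trans k1; rewrite ler_piMl.
have k4 : `|sn| * `|Dv * chi + v * Dchi| <= `|Dv| + `|Dchi|.
  by apply: le_trans k2; rewrite ler_piMl.
rewrite -/w; lra.
Qed.

End StationaryPhase.

(** * Integrals of power weights and of the resonance *)

Section PowerIntegrals.
Context {R : realType}.
Implicit Types (f g : R -> R) (a b c x : R).
Local Notation mu := (@lebesgue_measure R).

Lemma L1_itv g a b c : (forall x, a <= x <= b -> 0 <= g x) -> measurable_fun setT g ->
  (\int[mu]_(x in `[a, b]) (g x)%:E <= c%:E)%E ->
  L1_le (fun x => g x * \1_(`[a, b]) x) c.
Proof.
move=> g0 mg gc; split; first by apply: measurable_funM => //; exact: measurable_indic.
apply: le_trans gc; rewrite [leRHS]integral_mkcond le_eqVlt; apply/orP; left; apply/eqP.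
apply: eq_integral => x _; rewrite patchE indicE.
have [|_] := boolP (x \in _); last by rewrite mulr0 normr0.
by rewrite inE/= in_itv/= => /g0 g0x; rewrite mulr1 ger0_norm.
Qed.

Lemma L2_itv g a b c : measurable_fun setT g -> 0 <= c ->
  (\int[mu]_(x in `[a, b]) (g x ^+ 2)%:E <= c%:E)%E ->
  L2_le (fun x => g x * \1_(`[a, b]) x) (Num.sqrt c).
Proof.
move=> mg c0 gc; split; first by apply: measurable_funM => //; exact: measurable_indic.
rewrite sqr_sqrtr//.
apply: le_trans gc; rewrite [leRHS]integral_mkcond le_eqVlt; apply/orP; left; apply/eqP.
apply: eq_integral => x _; rewrite patchE indicE.
by case: (_ \in _); rewrite ?mulr1// mulr0 expr0n.
Qed.

Lemma measurable_inv : measurable_fun setT (fun x : R => x^-1).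
Proof.
(* Written with a real power, whose measurability is known; at the origin both sides are 0. *)
rewrite (_ : (fun x => x^-1) = fun x : R => (x * `|x| `^ (- 2))); last first.
  apply/funext => x; rewrite powRN powR_mulrn// real_normK ?num_real//.
  have [->|x0] := eqVneq x 0; first by rewrite invr0 mul0r.
  by field.
apply: measurable_funM => //; by apply: (measurableT_comp (measurable_powR _)).
Qed.

Lemma L2_cst_itv a b : a <= b -> L2_le (\1_(`[a, b]) : R -> R) (Num.sqrt (b - a)).
Proof.
move=> ab; have := @L2_itv (fun=> 1) a b (b - a) (measurable_cst _).
rewrite subr_ge0 => /(_ ab); rewrite (_ : (fun x => 1 * _) = \1_(`[a, b])); last first.
  by apply/funext => x; rewrite mul1r.
apply; under eq_integral do rewrite expr1n.
rewrite integral_cst//= mul1e lebesgue_measure_itv/= lte_fin.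
by case: ifPn => _; [rewrite -EFinB|rewrite lee_fin subr_ge0].
Qed.

Lemma L2_inv a b : 0 < a -> a < b -> L2_le (fun x => x^-1 * \1_(`[a, b]) x) (Num.sqrt a^-1).
Proof.
move=> a0 ab; have b0 : 0 < b by exact: lt_trans ab.
apply: L2_itv; [exact: measurable_inv|by rewrite invr_ge0 ltW|].
have dG x : a <= x <= b -> is_derive x (1 : R) (fun x : R => - x^-1) (x^-1 ^+ 2).
  move=> /andP[ax _]; have xn : x != 0 by rewrite gt_eqF// (lt_le_trans a0).
  have dV : is_derive x (1 : R) (fun y : R => y^-1) (- x ^- 2).
    by have := is_deriveV xn (is_derive_id x (1 : R)); rewrite /GRing.scale/= mulr1.
  by apply: is_derive_eq; rewrite opprK exprVn.
have cg : {within `[a, b], continuous (fun x : R => x^-1 ^+ 2)}.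
  apply: continuous_in_subspaceT => x; rewrite inE/= in_itv/= => /andP[ax _].
  have xn : x != 0 by rewrite gt_eqF// (lt_le_trans a0).
  by apply: cvgM; apply: cvgV.
rewrite (FTC_is_derive ab dG cg) lee_fin opprK.
by have : 0 <= b^-1 by [rewrite invr_ge0 ltW|]; lra.
Qed.

Lemma L2_invsqr a b : 0 < a -> a < b ->
  L2_le (fun x => x^-1 ^+ 2 * \1_(`[a, b]) x) (Num.sqrt (a^-1 ^+ 3)).
Proof.
move=> a0 ab; have b0 : 0 < b by exact: lt_trans ab.
apply: L2_itv.
- by apply: measurable_funX; exact: measurable_inv.
- by rewrite exprn_ge0// invr_ge0 ltW.
have dG x : a <= x <= b -> is_derive x (1 : R) (fun x : R => - 3^-1 * x^-1 ^+ 3) ((x^-1 ^+ 2) ^+ 2).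
  move=> /andP[ax _]; have xn : x != 0 by rewrite gt_eqF// (lt_le_trans a0).
  have dV : is_derive x (1 : R) (fun y : R => y^-1) (- x ^- 2).
    by have := is_deriveV xn (is_derive_id x (1 : R)); rewrite /GRing.scale/= mulr1.
  by apply: is_derive_eq; rewrite /GRing.scale/=; field.
have cg : {within `[a, b], continuous (fun x : R => (x^-1 ^+ 2) ^+ 2)}.
  apply: continuous_in_subspaceT => x; rewrite inE/= in_itv/= => /andP[ax _].
  have xn : x != 0 by rewrite gt_eqF// (lt_le_trans a0).
  by apply: cvgM; apply: cvgM; apply: cvgV.
rewrite (FTC_is_derive ab dG cg) lee_fin.
have h1 : 0 <= b^-1 ^+ 3 by rewrite exprn_ge0// invr_ge0 ltW.
have h2 : 0 <= a^-1 ^+ 3 by rewrite exprn_ge0// invr_ge0 ltW.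
lra.
Qed.

Lemma powR_pred x (s : R) : 0 < x -> x `^ (s - 1) = x `^ s / x.
Proof.
move=> x0; rewrite powRD ?(gt_eqF x0) ?implybT//.
by rewrite powR_inv1// ltW.
Qed.

(** The weight x^(alpha/2 - 1) is, up to s alpha / 2, the Jacobian of u = s x^(alpha/2), and a
    Lorentzian in c u has mass at most pi / c. With s = t^(1/2) this is the dispersive rate, uniform
    in the centre [d]. *)
Lemma L1_resonance (alpha s c d a b : R) : 0 < alpha -> 0 < s -> 0 < c -> 0 < a -> a < b ->
  L1_le (fun x => x `^ (alpha / 2 - 1) * (1 + (c * (s * x `^ (alpha / 2) - d)) ^+ 2)^-1
           * \1_(`[a, b]) x) (2 * pi / (alpha * c * s)).
Proof.
move=> al0 s0 c0 a0 ab.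
have K0 : 0 < alpha * c * s by rewrite !mulr_gt0.
have den0 x : 0 < 1 + (c * (s * x `^ (alpha / 2) - d)) ^+ 2 by rewrite ltr_pwDl// sqr_ge0.
have mE : measurable_fun setT (fun x : R => (1 + (c * (s * x `^ (alpha / 2) - d)) ^+ 2)^-1).
  apply: measurableT_comp; first exact: measurable_inv.
  apply: measurable_funD => //; apply: measurable_funX; apply: measurable_funM => //.
  apply: measurable_funB => //; apply: measurable_funM => //; exact: measurable_powR.
have mW : measurable_fun setT (fun x : R => x `^ (alpha / 2 - 1)) by exact: measurable_powR.
apply: L1_itv; [|exact: measurable_funM|].
  by move=> x _; rewrite mulr_ge0 ?powR_ge0// invr_ge0 ltW.
pose g x := c * (s * x `^ (alpha / 2) - d).
pose g' x := c * (s * (alpha / 2 * x `^ (alpha / 2 - 1))).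
have dg x : a <= x <= b -> is_derive x (1 : R) g (g' x).
  move=> /andP[ax _]; have x0 : 0 < x by exact: lt_le_trans ax.
  have dp := @is_derive1_powR R (alpha / 2) x x0.
  by apply: is_derive_eq; rewrite /GRing.scale/= /g'; ring.
have cg' : {within `[a, b], continuous g'}.
  apply: derivable_within_continuous => x; rewrite in_itv/= => /andP[ax _].
  have x0 : 0 < x by exact: lt_le_trans ax.
  have dp := @is_derive1_powR R (alpha / 2 - 1) x x0.
  have [//] : is_derive x (1 : R) g' (c * (s * (alpha / 2 * ((alpha / 2 - 1) * x `^ (alpha / 2 - 1 - 1))))).
  by apply: is_derive_eq; rewrite /GRing.scale/=; ring.
have := integral_atan_le ab dg cg' => H.
rewrite (_ : 2 * pi / (alpha * c * s) = 2 / (alpha * c * s) * pi); last by field; lra.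
have k0 : (0 <= (2 / (alpha * c * s))%:E)%E by rewrite lee_fin divr_ge0// ltW.
rewrite EFinM; apply: le_trans (lee_wpmul2l k0 H).
rewrite -ge0_integralZl//.
- rewrite le_eqVlt; apply/orP; left; apply/eqP; apply: eq_integral => x _.
  by rewrite -EFinM /g' /g; congr EFin; field; rewrite !gt_eqF//.
- apply/measurable_EFinP; apply: measurable_funTS; apply: measurable_funM => //.
  by do 3 apply: measurable_funM => //.
- move=> x _; rewrite lee_fin divr_ge0 ?(ltW (den0 _))// /g'.
  by rewrite mulr_ge0 ?(ltW c0)// mulr_ge0 ?(ltW s0)// mulr_ge0 ?powR_ge0// divr_ge0// ltW.
Qed.

End PowerIntegrals.

(** * Construction of the oscillating test function *)

Section KeyEstimate.
Context {R : realType}.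
Implicit Types (x y : R).
Local Notation mu := (@lebesgue_measure R).

Lemma is_derive_oscillating (phi P N chi : R -> R) (dphi dP dN dchi x : R) : N x != 0 ->
  is_derive x (1 : R) phi dphi -> is_derive x (1 : R) P dP ->
  is_derive x (1 : R) N dN -> is_derive x (1 : R) chi dchi ->
  is_derive x (1 : R) (fun x => sin (phi x) * (P x / N x * chi x))
    (cos (phi x) * dphi * (P x / N x * chi x) +
     sin (phi x) * ((dP / N x - P x * dN / N x ^+ 2) * chi x + P x / N x * dchi)).
Proof.
move=> Nx hphi hP hN hchi.
have dV : is_derive x (1 : R) (fun x => (N x)^-1) (- (N x) ^- 2 * dN).
  by have := is_deriveV Nx hN.
have ds : is_derive x (1 : R) (fun x => sin (phi x)) (cos (phi x) * dphi).
  exact: (@is_derive1_comp _ sin phi).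
by apply: is_derive_eq; rewrite /GRing.scale/=; field.
Qed.

Lemma for_continuousM (f g : R -> R) x : {for x, continuous f} -> {for x, continuous g} ->
  {for x, continuous (fun z => f z * g z)}.
Proof. exact: cvgM. Qed.

Lemma for_continuousD (f g : R -> R) x : {for x, continuous f} -> {for x, continuous g} ->
  {for x, continuous (fun z => f z + g z)}.
Proof. exact: cvgD. Qed.

Lemma for_continuousB (f g : R -> R) x : {for x, continuous f} -> {for x, continuous g} ->
  {for x, continuous (fun z => f z - g z)}.
Proof. exact: cvgB. Qed.

Lemma for_continuousV (f : R -> R) x : f x != 0 -> {for x, continuous f} ->
  {for x, continuous (fun z => (f z)^-1)}.
Proof. exact: cvgV. Qed.

Variables (alpha p0 t : R).
Hypothesis alpha3 : 3^-1 < alpha.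
Hypothesis alpha1 : alpha < 1.
Hypothesis p01 : p0 <= 8^-1.
Hypothesis inv_alpha : 1 + 2 * p0 <= alpha^-1.
Hypothesis t2 : 2 <= t.

Let a0 : 0 < alpha. Proof. by apply: lt_trans alpha3; rewrite invr_gt0. Qed.
Let t0 : 0 < t. Proof. by apply: lt_le_trans t2. Qed.
Let t1 : 1 <= t. Proof. by apply: le_trans t2; rewrite ler1n. Qed.
(** [eps] solves t x^alpha = 1, the threshold of oscillation. [b] has to be large enough for the
    tail b^(-3/2) in [sqrt_invb_le] and small enough for [power_gain]; t^(1/2) meets both. *)
Let eps := t `^ (- alpha^-1).
Let b := Num.sqrt t.
Let delta := t `^ (- (2^-1 + p0)).
Let c := alpha * (1 - alpha) / 2.

Let eps0 : 0 < eps. Proof. exact: powR_gt0. Qed.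
Let b0 : 0 < b. Proof. by rewrite sqrtr_gt0. Qed.
Let c0 : 0 < c. Proof. by rewrite /c divr_gt0// mulr_gt0// subr_gt0. Qed.
Let c1 : c <= 1. Proof. by rewrite /c; nra. Qed.
Let b2 : b ^+ 2 = t. Proof. by rewrite sqr_sqrtr// ltW. Qed.
Let bE : b = t `^ 2^-1. Proof. by rewrite powR12_sqrt// ltW. Qed.

Let epsb : eps < b.
Proof.
apply: (@le_lt_trans _ _ 1).
  by rewrite -(powRr0 t) ler_powR// oppr_le0 invr_ge0 ltW.
have t12 : 1 < t by apply: lt_le_trans t2; rewrite ltr1n.
by rewrite /b -[ltLHS]sqrtr1 ltr_sqrt.
Qed.

Let epsU : t * eps `^ alpha = 1.
Proof.
by rewrite /eps -powRrM mulNr mulVf ?gt_eqF// powR_inv1 ?ltW// divff// gt_eqF.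
Qed.

Let U x := t * x `^ alpha.

Let U_ge1 x : eps <= x -> 1 <= U x.
Proof.
by move=> ex; rewrite -epsU /U (ler_wpM2l (ltW t0))// powR_mono ?(ltW eps0) ?(ltW a0).
Qed.

Let u x := Num.sqrt t * x `^ (alpha / 2).

Let u2 x : 0 < x -> u x ^+ 2 = U x.
Proof.
move=> x0; rewrite /u /U exprMn sqr_sqrtr ?ltW//; congr (_ * _).
rewrite -powR_mulrn ?powR_ge0// -powRrM; congr (_ `^ _).
by rewrite mulrVK// unitfE.
Qed.

(** In exponents this reads 1 / (2 alpha) >= 1/2 + p0, exactly the condition linking [alpha] and
    [p0]. *)
Lemma sqrt_eps_le : Num.sqrt eps <= delta.
Proof.
rewrite -powR12_sqrt ?(ltW eps0)// /eps -powRrM /delta; apply: ler_powR => //.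
by have := inv_alpha; lra.
Qed.

Lemma sqrt_invb_le : Num.sqrt (b^-1 ^+ 3) <= delta.
Proof.
rewrite bE -powRN -powR_mulrn ?powR_ge0// -powR12_sqrt ?powR_ge0// -!powRrM /delta.
by apply: ler_powR => //; move: p01; lra.
Qed.

(** Equivalent to x^(1 - 3 alpha / 2) <= t^(1/2 - 2 p0), and a monomial is largest at an endpoint.
    At the right end this asks for 2 p0 <= 3 alpha / 4, which follows from alpha > 1/3 and p0 <=
    1/8; at the left end it is 1 / alpha >= 1 + 2 p0 again. *)
Lemma power_gain x : eps <= x -> x <= b ->
  (U x)^-1 <= t `^ (- (2^-1 + 2 * p0)) * x `^ (alpha / 2 - 1).
Proof.
move=> ex xb; have x0 : 0 < x by exact: lt_le_trans ex.
have ia := inv_alpha.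
have tg : x `^ (1 - 3 / 2 * alpha) <= t `^ (2^-1 - 2 * p0).
  have [h|h] := leP 0 (1 - 3 / 2 * alpha).
    apply: (@le_trans _ _ (b `^ (1 - 3 / 2 * alpha))).
      by rewrite powR_mono// ltW.
    by rewrite bE -powRrM; apply: ler_powR => //; move: p01 alpha3; lra.
  apply: (@le_trans _ _ (eps `^ (1 - 3 / 2 * alpha))).
    rewrite -[X in x `^ X]opprK -[X in eps `^ X]opprK powRN [leRHS]powRN.
    by rewrite lef_pV2 ?posrE ?powR_gt0// powR_mono ?(ltW eps0)// oppr_ge0 ltW.
  rewrite /eps -powRrM; apply: ler_powR => //.
  have -> : - alpha^-1 * (1 - 3 / 2 * alpha) = 3 / 2 - alpha^-1 by field; rewrite gt_eqF.
  lra.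
rewrite /U invfM.
have -> : (x `^ alpha)^-1 = x `^ (1 - 3 / 2 * alpha) * x `^ (alpha / 2 - 1).
  rewrite -powRN -powRD ?(gt_eqF x0) ?implybT//; congr (_ `^ _); lra.
have -> : t `^ (- (2^-1 + 2 * p0)) = t^-1 * t `^ (2^-1 - 2 * p0).
  rewrite -(powR_inv1 (ltW t0)) -powRD ?(gt_eqF t0) ?implybT//; congr (_ `^ _); lra.
by rewrite mulrA ler_wpM2r ?powR_ge0// ler_wpM2l// invr_ge0 ltW.
Qed.

Section Oscillation.
Variables (y th : R).

Let P x := alpha * U x - y * x.
Let N x := P x ^+ 2 + 1 + U x.
Let v x := P x / N x.
(** Power-type factors, so that both 1 - chi and x chi' are controlled by eps / x and (x / b)^2.
    Cauchy-Schwarz pairs the first with [F] and the second with x^2 F. *)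
Let chi x := (1 - eps * x^-1) * (1 - (b^-1 * x) ^+ 2).
Let phi x := U x - y * x + th.
(** The prefix [D] denotes the Euler operator x (d/dx), which acts on powers by scalars; [xpsi]
    below is likewise x psi'. *)
Let DP x := P x - alpha * (1 - alpha) * U x.
Let Dv x := DP x / N x - P x * (2 * P x * DP x + alpha * U x) / N x ^+ 2.
Let Dchi x := eps * x^-1 * (1 - (b^-1 * x) ^+ 2) - (1 - eps * x^-1) * (2 * (b^-1 * x) ^+ 2).
Let psi x := sin (phi x) * (v x * chi x).
Let xpsi x := cos (phi x) * (P x * (v x * chi x)) + sin (phi x) * (Dv x * chi x + v x * Dchi x).

Let Ngt0 x : 0 < x -> 0 < N x.
Proof.
move=> x0; have : 0 <= U x by rewrite mulr_ge0 ?powR_ge0// ltW.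
by rewrite /N; have := sqr_ge0 (P x); lra.
Qed.

Let dU x : 0 < x -> is_derive x (1 : R) U (alpha * U x / x).
Proof.
move=> x0; have dp := @is_derive1_powR R alpha x x0.
by apply: is_derive_eq; rewrite /GRing.scale/= powR_pred// /U; ring.
Qed.

Let dpsi x : 0 < x -> is_derive x (1 : R) psi (xpsi x / x).
Proof.
move=> x0; have xn : x != 0 by rewrite gt_eqF.
have Nn : N x != 0 by rewrite gt_eqF// Ngt0.
have hU := dU x0.
have hphi : is_derive x (1 : R) phi (P x / x).
  by apply: is_derive_eq; rewrite /GRing.scale/= /P; field.
have hP : is_derive x (1 : R) P (DP x / x).
  by apply: is_derive_eq; rewrite /GRing.scale/= /DP /P; field.
have hN : is_derive x (1 : R) N ((2 * P x * DP x + alpha * U x) / x).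
  by apply: is_derive_eq; rewrite /GRing.scale/=; field.
have dV : is_derive x (1 : R) (fun y : R => y^-1) (- x ^- 2).
  by have := is_deriveV xn (is_derive_id x (1 : R)); rewrite /GRing.scale/= mulr1.
have hchi : is_derive x (1 : R) chi (Dchi x / x).
  by apply: is_derive_eq; rewrite /GRing.scale/= /Dchi; field; rewrite xn gt_eqF.
have := is_derive_oscillating Nn hphi hP hN hchi.
suff -> : xpsi x / x = cos (phi x) * (P x / x) * (P x / N x * chi x) +
     sin (phi x) * ((DP x / x / N x - P x * ((2 * P x * DP x + alpha * U x) / x) / N x ^+ 2) * chi x +
     P x / N x * (Dchi x / x)) by [].
rewrite /xpsi /v /Dv.
move: (P x) (N x) (DP x) (U x) (chi x) (Dchi x) (cos _) (sin _) Nn => p n dp uu ch dch cs sn Nn.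
by field; rewrite xn Nn.
Qed.

Let cpsi' : {within `[eps, b], continuous (fun x => xpsi x / x)}.
Proof.
apply: continuous_in_subspaceT => x; rewrite inE/= in_itv/= => /andP[ex xb].
have x0 : 0 < x by exact: lt_le_trans ex.
have xn : x != 0 by rewrite gt_eqF.
have Nn : N x != 0 by rewrite gt_eqF// Ngt0.
have cU : {for x, continuous U}.
  by apply/differentiable_continuous/derivable1_diffP; case: (dU x0).
have cid : {for x, continuous (fun x : R => x)} by exact: cvg_id.
have ccst (k : R) : {for x, continuous (fun _ : R => k)} by exact: cvg_cst.
have cX (f : R -> R) : {for x, continuous f} -> {for x, continuous (fun z => f z ^+ 2)}.
  by move=> cf; exact: for_continuousM.
have cP : {for x, continuous P} by apply: for_continuousB; apply: for_continuousM.
have cN : {for x, continuous N}.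
  by apply: for_continuousD => //; apply: for_continuousD => //; exact: cX.
have cNV : {for x, continuous (fun x => (N x)^-1)} by exact: for_continuousV.
have cV : {for x, continuous (fun x : R => x^-1)} by exact: (for_continuousV xn cid).
have cDP : {for x, continuous DP} by apply: for_continuousB => //; apply: for_continuousM.
have cv : {for x, continuous v} by exact: for_continuousM.
have cz : {for x, continuous (fun x : R => (b^-1 * x) ^+ 2)}.
  by apply: cX; exact: for_continuousM.
have ca : {for x, continuous (fun x : R => eps * x^-1)} by exact: for_continuousM.
have cchi : {for x, continuous chi}.
  by apply: for_continuousM; exact: for_continuousB.
have cDchi : {for x, continuous Dchi}.
  apply: for_continuousB; first by apply: for_continuousM => //; exact: for_continuousB.
  by apply: for_continuousM; [exact: for_continuousB|exact: for_continuousM].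
have cphi : {for x, continuous phi}.
  by apply: for_continuousD => //; apply: for_continuousB => //; exact: for_continuousM.
have ccos : {for x, continuous (fun x => cos (phi x))}.
  by apply: (@continuous_comp _ _ _ phi cos) => //; exact: continuous_cos.
have csin : {for x, continuous (fun x => sin (phi x))}.
  by apply: (@continuous_comp _ _ _ phi sin) => //; exact: continuous_sin.
have cDv : {for x, continuous Dv}.
  apply: for_continuousB; first exact: for_continuousM.
  apply: for_continuousM.
    apply: for_continuousM => //; apply: for_continuousD; last exact: for_continuousM.
    by apply: for_continuousM => //; exact: for_continuousM.
  by apply: for_continuousV; [rewrite expf_neq0|exact: cX].
apply: for_continuousM => //; apply: for_continuousD; apply: for_continuousM => //.
  by apply: for_continuousM => //; exact: for_continuousM.
by apply: for_continuousD; exact: for_continuousM.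
Qed.

Let psi_eps : psi eps = 0.
Proof. by rewrite /psi /chi divff ?gt_eqF// subrr mul0r !mulr0. Qed.

Let psi_b : psi b = 0.
Proof. by rewrite /psi /chi mulVf ?gt_eqF// expr1n subrr !mulr0. Qed.

Let az x : eps <= x -> x <= b ->
  [/\ 0 <= eps * x^-1, eps * x^-1 <= 1, 0 <= (b^-1 * x) ^+ 2 & (b^-1 * x) ^+ 2 <= 1].
Proof.
move=> ex xb; have x0 : 0 < x by exact: lt_le_trans ex.
split; first by rewrite mulr_ge0 ?invr_ge0 ?(ltW eps0) ?(ltW x0).
- by rewrite ler_pdivrMr// mul1r.
- exact: sqr_ge0.
- rewrite expr_le1//; first by rewrite mulrC ler_pdivrMr// mul1r.
  by rewrite mulr_ge0 ?invr_ge0 ?(ltW b0) ?(ltW x0).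
Qed.

(** The coefficient 16 is 7 times the 2 of [resonance_bound] plus the 2 / (1 + U) of [cutoff_error].
    For the square, psi^2 <= 1 / N, which is (1 + U) / N divided by 1 + U: the first factor is the
    resonance, the second is traded for the weight by [power_gain]. Centre 0 is written [u x - 0] to
    match [L1_resonance]. *)
Lemma psi_error : exists u0 : R, forall x, eps <= x -> x <= b ->
  `|cos (phi x) - xpsi x| <=
    16 * ((1 + (c * (u x - 0)) ^+ 2)^-1 + (1 + (c * (u x - u0)) ^+ 2)^-1) +
    2 * (eps * x^-1) + 3 * (b^-1 * x) ^+ 2 /\
  psi x ^+ 2 <= 2 * t `^ (- (2^-1 + 2 * p0)) * (x `^ (alpha / 2 - 1) *
    ((1 + (c * (u x - 0)) ^+ 2)^-1 + (1 + (c * (u x - u0)) ^+ 2)^-1)).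
Proof.
have a01 : 0 < alpha < 1 by rewrite a0.
have [u0 hu0] := phase_derivative_lower y a01 t0.
exists u0 => x ex xb; have x0 : 0 < x by exact: lt_le_trans ex.
have [z0 z1 w0 w1] := az ex xb.
have U1 := U_ge1 ex.
have up : 0 < u x by rewrite mulr_gt0 ?powR_gt0// sqrtr_gt0.
have h1 : 1 <= u x ^+ 2 by rewrite u2.
have := resonance_bound c0 up h1 (hu0 x x0); rewrite -/(U x) -/(P x) u2// -/(N x) subr0.
set E1 := (1 + (c * u x) ^+ 2)^-1; set E2 := (1 + (c * (u x - u0)) ^+ 2)^-1 => hE.
have Np := Ngt0 x0.
have E20 : 0 <= E2 by rewrite invr_ge0; have := sqr_ge0 (c * (u x - u0)); lra.
have UE1 : (1 + U x)^-1 <= E1.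
  have c2 : (c * u x) ^+ 2 <= U x.
    rewrite exprMn u2// ler_piMl//; first by lra.
    by rewrite expr_le1// ltW.
  by rewrite lef_pV2 ?posrE//; have := sqr_ge0 (c * u x); lra.
split.
- have chi01 : 0 <= chi x <= 1 by rewrite /chi; apply/andP; split; nra.
  have := @cutoff_error R (P x) (U x) (DP x) alpha (cos (phi x)) (sin (phi x))
    (chi x) (Dchi x) (N x) (v x) (Dv x) a01 (le_trans ler01 U1)
    (cos_norm_le1 _) (sin_max _) chi01 erefl erefl erefl erefl.
  rewrite -/(xpsi x) => H; apply: le_trans H _.
  have k1 : 1 - chi x <= eps * x^-1 + (b^-1 * x) ^+ 2 by rewrite /chi; nra.
  have k2 : `|Dchi x| <= eps * x^-1 + 2 * (b^-1 * x) ^+ 2.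
    rewrite /Dchi ler_norml; apply/andP; split; nra.
  lra.
- have s1 : sin (phi x) ^+ 2 <= 1 by rewrite sin2cos2; have := sqr_ge0 (cos (phi x)); lra.
  have chi2 : chi x ^+ 2 <= 1.
    rewrite /chi expr_le1//; nra.
  have v2 : v x ^+ 2 <= (N x)^-1.
    rewrite /v exprMn exprVn ler_pdivrMr ?exprn_gt0//.
    have -> : (N x)^-1 * N x ^+ 2 = N x by field; rewrite gt_eqF.
    by rewrite /N; lra.
  have N1 : (N x)^-1 <= 2 * (E1 + E2) * (U x)^-1.
    have Up : 0 < U x by lra.
    apply: (@le_trans _ _ ((1 + U x) / N x * (U x)^-1)); last first.
      by rewrite ler_wpM2r// invr_ge0 ltW.
    rewrite mulrAC -[leLHS]mul1r ler_wpM2r ?invr_ge0 ?(ltW Np)//.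
    by rewrite ler_pdivlMr// mul1r; lra.
  have NV : 0 <= (N x)^-1 by rewrite invr_ge0 ltW.
  apply: (@le_trans _ _ (N x)^-1).
    apply: le_trans v2.
    have -> : psi x ^+ 2 = sin (phi x) ^+ 2 * chi x ^+ 2 * v x ^+ 2 by rewrite /psi; ring.
    by rewrite ler_piMl ?sqr_ge0// mulr_ile1 ?sqr_ge0.
  apply: le_trans N1 _.
  have -> : 2 * t `^ (- (2^-1 + 2 * p0)) * (x `^ (alpha / 2 - 1) * (E1 + E2)) =
    2 * (E1 + E2) * (t `^ (- (2^-1 + 2 * p0)) * x `^ (alpha / 2 - 1)) by ring.
  rewrite ler_wpM2l ?power_gain//.
  have : 0 <= (1 + U x)^-1 by rewrite invr_ge0; lra.
  lra.
Qed.

(* [psi = sin(Phi) P / (P^2 + 1 + t x^alpha) * chi] where [Phi] is the phase, [P = x Phi']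
   and [chi = (1 - eps / x) (1 - x^2 / t)], [eps = t^(-1/alpha)], vanishes at both ends. *)
Lemma oscillating_test_function : exists (psi psi' : R -> R) (u0 : R),
  [/\ forall x, t `^ (- alpha^-1) <= x <= Num.sqrt t -> is_derive x (1 : R) psi (psi' x),
      {within `[t `^ (- alpha^-1), Num.sqrt t], continuous psi'},
      psi (t `^ (- alpha^-1)) = 0, psi (Num.sqrt t) = 0 &
      forall x, t `^ (- alpha^-1) <= x -> x <= Num.sqrt t ->
        let E d := (1 + (alpha * (1 - alpha) / 2 * (Num.sqrt t * x `^ (alpha / 2) - d)) ^+ 2)^-1 in
        `|cos (t * x `^ alpha - y * x + th) - x * psi' x| <=
          16 * (E 0 + E u0) + 2 * (t `^ (- alpha^-1) * x^-1) + 3 * ((Num.sqrt t)^-1 * x) ^+ 2 /\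
        psi x ^+ 2 <= 2 * t `^ (- (2^-1 + 2 * p0)) * (x `^ (alpha / 2 - 1) * (E 0 + E u0))].
Proof.
have [u0 hu0] := psi_error.
exists psi, (fun x => xpsi x / x), u0; split => //.
- by move=> x /andP[ex _]; apply: dpsi; exact: lt_le_trans ex.
- move=> x ex xb E; have [h1 h2] := hu0 x ex xb; split=> //.
  have x0 : 0 < x by exact: lt_le_trans ex.
  have -> : x * (xpsi x / x) = xpsi x by rewrite mulrCA divff ?gt_eqF// mulr1.
  exact: h1.
Qed.

End Oscillation.

Lemma lower_cutoff_lt : t `^ (- alpha^-1) < Num.sqrt t.
Proof. exact: epsb. Qed.

End KeyEstimate.

(** * The integral over a half-line *)

Section DispersiveIntegral.
Context {R : realType}.
Implicit Types (x y : R) (F : R -> R).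
Local Notation mu := (@lebesgue_measure R).

(* What is used of [fourier f] on a half-line; the last field is the dual form of the
   bound of the L^2 norm of the derivative of [x * F x], that is, of [x * f' x]. *)
Record profile (alpha A B : R) F := Profile {
  profile_weight : {ae mu, forall x, 0 < x -> `|F x| <= A * x `^ (alpha / 2 - 1)};
  profile_L2 : L2_le F B;
  profile_L2_sqr : L2_le (fun x => x ^+ 2 * F x) B;
  profile_dilation : forall (psi psi' : R -> R) (p q c : R), p < q ->
    (forall x, p <= x <= q -> is_derive x (1 : R) psi (psi' x)) ->
    {within `[p, q], continuous psi'} -> psi p = 0 -> psi q = 0 -> 0 <= c ->
    L2_le (fun x => psi x * \1_(`[p, q]) x) c ->
    `|\int[mu]_x (F x * (x * psi' x * \1_(`[p, q]) x))| <= B * c }.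

Lemma L2_abs F b : L2_le F b -> L2_le (fun x => `|F x|) b.
Proof.
move=> Fb; apply: (L2_dom Fb); last by move=> x; rewrite normr_id.
by apply: measurableT_comp => //; case: Fb.
Qed.

Lemma measurable_phase (alpha t y th : R) :
  measurable_fun setT (fun x : R => cos (t * x `^ alpha - y * x + th)).
Proof.
apply: measurableT_comp; first by apply: continuous_measurable_fun; exact: continuous_cos.
by apply: measurable_funD => //; apply: measurable_funB; apply: measurable_funM.
Qed.

Lemma L2_phase_itv (alpha t y th n : R) : 0 <= n ->
  L2_le (fun x => cos (t * x `^ alpha - y * x + th) * \1_(`[0, n]) x) (Num.sqrt n).
Proof.
move=> n0; have := L2_cst_itv n0; rewrite subr0 => h; apply: (L2_dom h).
  by apply: measurable_funM; [exact: measurable_phase|exact: measurable_indic].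
by move=> x; rewrite normrM ler_piMl// cos_norm_le1.
Qed.

Section Estimate.
Variables (alpha p0 A B t y th n : R) (F : R -> R).
Hypothesis alpha3 : 3^-1 < alpha.
Hypothesis alpha1 : alpha < 1.
Hypothesis p01 : p0 <= 8^-1.
Hypothesis inv_alpha : 1 + 2 * p0 <= alpha^-1.
Hypothesis A0 : 0 <= A.
Hypothesis B0 : 0 <= B.
Hypothesis FP : profile alpha A B F.

Let mF : measurable_fun setT F. Proof. by case: (profile_L2 FP). Qed.

(** Oscillation is irrelevant for bounded times: the integral of |F| is at most B on [0, 1] by the
    L^2 bound of [F], and at most B beyond 1 by that of x^2 F. *)
Lemma dispersive_integral_small : 1 < n ->
  `|\int[mu]_x (F x * (cos (t * x `^ alpha - y * x + th) * \1_(`[0, n]) x))| <= 2 * B.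
Proof.
move=> n1.
have h1 : L1_le (fun x => `|F x| * \1_(`[0, 1]) x) (B * Num.sqrt (1 - 0)).
  by apply: L1_CS (sqrtr_ge0 _) _ (L2_cst_itv ler01) => //; apply: L2_abs; exact: profile_L2 FP.
have h2 : L1_le (fun x => `|x ^+ 2 * F x| * (x^-1 ^+ 2 * \1_(`[1, n]) x)) (B * Num.sqrt (1^-1 ^+ 3)).
  apply: L1_CS (sqrtr_ge0 _) _ (L2_invsqr ltr01 n1) => //; apply: L2_abs; exact: profile_L2_sqr FP.
rewrite (_ : 2 * B = B * Num.sqrt (1 - 0) + B * Num.sqrt (1^-1 ^+ 3)); last first.
  by rewrite subr0 invr1 expr1n sqrtr1; ring.
apply: L1_Rintegral; apply: L1_dom (L1_D h1 h2) _ _.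
  apply: measurable_funM => //; apply: measurable_funM; last exact: measurable_indic.
  exact: measurable_phase.
move=> x.
have i1 : 0 <= `|F x| * \1_(`[0, 1]) x by rewrite mulr_ge0.
have i2 : 0 <= `|x ^+ 2 * F x| * (x^-1 ^+ 2 * \1_(`[1, n]) x).
  by rewrite mulr_ge0// mulr_ge0// sqr_ge0.
rewrite [leRHS]ger0_norm ?addr_ge0// normrM (normrM (cos _)).
have [x0|x0] := boolP (x \in `[0, n]%classic); last first.
  by rewrite [\1_(`[0, n]) x]indicE (negbTE x0) normr0 !mulr0 addr_ge0.
rewrite [\1_(`[0, n]) x]indicE x0 normr1 mulr1.
have Fc : `|F x| * `|cos (t * x `^ alpha - y * x + th)| <= `|F x|.
  by rewrite ler_piMr// cos_norm_le1.
apply: le_trans Fc _; move: x0; rewrite inE/= in_itv/= => /andP[x0 xn].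
have [x1|x1] := leP x 1.
  rewrite (_ : \1_(`[0, 1]) x = 1 :> R) ?mulr1; first by rewrite lerDl.
  by rewrite indicE mem_set//= in_itv/= x0.
have x00 : 0 < x by exact: lt_trans x1.
rewrite (_ : \1_(`[1, n]) x = 1 :> R); last by rewrite indicE mem_set//= in_itv/= (ltW x1).
rewrite normrM (ger0_norm (_ : 0 <= x ^+ 2)) ?sqr_ge0// mulr1.
rewrite (_ : x ^+ 2 * `|F x| * x^-1 ^+ 2 = `|F x|); last by field; rewrite gt_eqF.
by rewrite lerDr mulr_ge0.
Qed.

Hypothesis t2 : 2 <= t.
Hypothesis tn : Num.sqrt t < n.

Let a0 : 0 < alpha. Proof. by apply: lt_trans alpha3; rewrite invr_gt0. Qed.
Let t0 : 0 < t. Proof. by apply: lt_le_trans t2. Qed.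
Let eps := t `^ (- alpha^-1).
Let b := Num.sqrt t.
Let delta := t `^ (- (2^-1 + p0)).
Let c := alpha * (1 - alpha) / 2.
Let eps0 : 0 < eps. Proof. exact: powR_gt0. Qed.
Let b0 : 0 < b. Proof. by rewrite sqrtr_gt0. Qed.
Let c0 : 0 < c. Proof. by rewrite /c divr_gt0// mulr_gt0// subr_gt0. Qed.
Let epsb : eps < b. Proof. exact: (lower_cutoff_lt alpha3 t2). Qed.

(** Origin of the constants: 64 is 16 times the masses 2 + 2 of two Lorentzians; the square root is
    the norm of [psi]; 7 adds the two outer regions, 1 + 1, to the cutoff errors, 2 + 3. *)
Lemma dispersive_integral_large :
  `|\int[mu]_x (F x * (cos (t * x `^ alpha - y * x + th) * \1_(`[0, n]) x))| <=
  64 * pi / (alpha * c) * A / b + (Num.sqrt (8 * pi / (alpha * c)) + 7) * B * delta.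
Proof.
have [psi [psi' [u0 [dpsi cpsi' psip psiq Hpsi]]]] :=
  oscillating_test_function alpha3 alpha1 p01 inv_alpha t2 y th.
have hs1 := sqrt_eps_le inv_alpha t2.
have hs2 := sqrt_invb_le p01 t2.
rewrite -/eps -/delta -/b in dpsi cpsi' psip psiq Hpsi hs1 hs2.
pose I (x : R) : R := \1_(`[eps, b]) x.
pose W (x : R) := x `^ (alpha / 2 - 1).
pose E d x := (1 + (c * (b * x `^ (alpha / 2) - d)) ^+ 2)^-1.
pose cs (x : R) := cos (t * x `^ alpha - y * x + th).
have E0 d x : 0 <= E d x by rewrite invr_ge0; have := sqr_ge0 (c * (b * x `^ (alpha / 2) - d)); lra.
have W0 x : 0 <= W x by exact: powR_ge0.
have K0 : 0 < alpha * c by rewrite mulr_gt0.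
have hW d : L1_le (fun x => W x * E d x * I x) (2 * pi / (alpha * c * b)).
  exact: L1_resonance.
have delta0 : 0 <= delta by exact: powR_ge0.
(* The bound of psi^2 carries t^(-(1/2 + 2 p0)), and integrating the resonance adds t^(-1/2):
   together [delta ^+ 2]. *)
have hpsi : L2_le (fun x => psi x * I x) (Num.sqrt (8 * pi / (alpha * c)) * delta).
  have mpsi : measurable_fun setT (fun x => psi x * I x).
    have [M bp] := bcs_psi epsb dpsi.
    by case: bp.
  split => //.
  have k0 : 0 <= 8 * pi / (alpha * c) by rewrite divr_ge0 ?(ltW K0)// mulr_ge0 ?pi_ge0.
  rewrite exprMn sqr_sqrtr//.
  have := L1_Z (2 * t `^ (- (2^-1 + 2 * p0))) (L1_D (hW 0) (hW u0)).
  rewrite ger0_norm ?mulr_ge0 ?powR_ge0// => H.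
  have H2 : L1_le (fun x => (psi x * I x) ^+ 2)
     (2 * t `^ (- (2^-1 + 2 * p0)) * (2 * pi / (alpha * c * b) + 2 * pi / (alpha * c * b))).
    apply: L1_dom H _ _; first exact: measurable_funX.
    move=> x; rewrite ger0_norm ?sqr_ge0// ger0_norm; last first.
      by rewrite mulr_ge0// ?addr_ge0// ?mulr_ge0// ?powR_ge0.
    rewrite exprMn /I indicE; have [xi|xi] := boolP (x \in _); last first.
      by rewrite expr0n/= !mulr0 addr0 mulr0.
    move: xi; rewrite inE/= in_itv/= => /andP[ex xb].
    have [_] := Hpsi x ex xb; rewrite expr1n !mulr1 mulrDr; exact.
  under eq_integral do rewrite -[_ ^+ 2]ger0_norm ?sqr_ge0//.
  apply: le_trans H2.2 _; rewrite lee_fin le_eqVlt; apply/orP; left; apply/eqP.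
  have -> : delta ^+ 2 = t `^ (- (2^-1 + 2 * p0)) / b.
    rewrite /b -powR12_sqrt ?(ltW t0)// -powRN -powRD ?(gt_eqF t0) ?implybT//.
    rewrite -powR_mulrn// -powRrM; congr (_ `^ _); lra.
  by field; rewrite gt_eqF//= gt_eqF//= gt_eqF.
have hD := profile_dilation FP epsb dpsi cpsi' psip psiq
  (mulr_ge0 (sqrtr_ge0 _) delta0) hpsi.
rewrite -/I in hD.
(* Outside [eps, b] the subtracted term is 0, so [r] there is the bare cosine and is left to [h1]
   and [h2]; inside, the three terms of the test function's error meet [h5], [h3] and [h4]. *)
pose r x := cs x * \1_(`[0, n]) x - x * psi' x * I x.
have FL2 := L2_abs (profile_L2 FP); have FL2' := L2_abs (profile_L2_sqr FP).
have eps00 : 0 <= eps by exact: ltW.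
have bn : b < n by exact: tn.
have h1 : L1_le (fun x => `|F x| * \1_(`[0, eps]) x) (B * Num.sqrt (eps - 0)).
  exact: L1_CS (sqrtr_ge0 _) FL2 (L2_cst_itv eps00).
have h2 : L1_le (fun x => `|x ^+ 2 * F x| * (x^-1 ^+ 2 * \1_(`[b, n]) x)) (B * Num.sqrt (b^-1 ^+ 3)).
  exact: L1_CS (sqrtr_ge0 _) FL2' (L2_invsqr b0 bn).
have h3 : L1_le (fun x => `|F x| * (x^-1 * I x)) (B * Num.sqrt eps^-1).
  exact: L1_CS (sqrtr_ge0 _) FL2 (L2_inv eps0 epsb).
have h4 : L1_le (fun x => `|x ^+ 2 * F x| * \1_(`[0, b]) x) (B * Num.sqrt (b - 0)).
  exact: L1_CS (sqrtr_ge0 _) FL2' (L2_cst_itv (ltW b0)).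
have h5 := L1_D (hW 0) (hW u0).
have H := L1_D (L1_Z (16 * A) h5) (L1_D (L1_D h1 h2) (L1_D (L1_Z (2 * eps) h3) (L1_Z (3 * b^-1 ^+ 2) h4))).
have mr : measurable_fun setT (fun x => F x * r x).
  have [M bp] := bcs_xpsi' epsb cpsi'.
  apply: measurable_funM => //; apply: measurable_funB; last by case: bp.
  by apply: measurable_funM; [exact: measurable_phase|exact: measurable_indic].
have Hr := L1_dom_ae H mr.
have Fr : L1_le (fun x => F x * r x) (`|16 * A| * (2 * pi / (alpha * c * b) + 2 * pi / (alpha * c * b)) +
   (B * Num.sqrt (eps - 0) + B * Num.sqrt (b^-1 ^+ 3) +
     (`|2 * eps| * (B * Num.sqrt eps^-1) + `|3 * b^-1 ^+ 2| * (B * Num.sqrt (b - 0))))).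
  apply: Hr; have [Z [mZ Z0 HZ]] := profile_weight FP.
  exists Z; split => // x /= nx; apply: HZ => /= wx; apply: nx.
  set G := (X in _ <= `|X|).
  suff : `|F x * r x| <= G by move/le_trans; apply; exact: ler_norm.
  rewrite /G {G}.
  have j1 : 0 <= 16 * A * (W x * E 0 x * I x + W x * E u0 x * I x).
    by rewrite mulr_ge0 ?mulr_ge0// addr_ge0// !mulr_ge0.
  have j2 : 0 <= `|F x| * \1_(`[0, eps]) x by rewrite mulr_ge0.
  have j3 : 0 <= `|x ^+ 2 * F x| * (x^-1 ^+ 2 * \1_(`[b, n]) x) by rewrite mulr_ge0// mulr_ge0// sqr_ge0.
  have j5 : 0 <= 3 * b^-1 ^+ 2 * (`|x ^+ 2 * F x| * \1_(`[0, b]) x).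
    by apply: mulr_ge0; apply: mulr_ge0 => //; exact: sqr_ge0.
  have [ex|ex] := boolP (x \in `[eps, b]%classic).
    move: ex; rewrite inE/= in_itv/= => /andP[ex xb].
    have x0 : 0 < x by exact: lt_le_trans ex.
    have I1 : I x = 1 by rewrite /I indicE mem_set//= in_itv/= ex.
    have n1 : \1_(`[0, n]) x = 1 :> R.
      by rewrite indicE mem_set//= in_itv/= (ltW x0) (le_trans xb)// ltW.
    have b1 : \1_(`[0, b]) x = 1 :> R by rewrite indicE mem_set//= in_itv/= (ltW x0) xb.
    have [+ _] := Hpsi x ex xb; rewrite -/c -/(cs x) -/(E 0 x) -/(E u0 x) => hr.
    rewrite normrM /r n1 I1 !mulr1.
    have hFx := wx x0; rewrite -/(W x) in hFx.
    have e2 : `|x ^+ 2 * F x| = x ^+ 2 * `|F x| by rewrite normrM ger0_norm ?sqr_ge0.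
    have Fx0 := normr_ge0 (F x).
    apply: (@le_trans _ _ (`|F x| * (16 * (E 0 x + E u0 x) + 2 * (eps * x^-1) + 3 * (b^-1 * x) ^+ 2))).
      by rewrite ler_wpM2l.
    have hE : `|F x| * (16 * (E 0 x + E u0 x)) <= 16 * A * (W x * E 0 x + W x * E u0 x).
      have -> : 16 * A * (W x * E 0 x + W x * E u0 x) = A * W x * (16 * (E 0 x + E u0 x)) by ring.
      by rewrite ler_wpM2r// mulr_ge0// addr_ge0.
    have -> : `|F x| * (16 * (E 0 x + E u0 x) + 2 * (eps * x^-1) + 3 * (b^-1 * x) ^+ 2) =
      `|F x| * (16 * (E 0 x + E u0 x)) + 2 * eps * (`|F x| * x^-1) + 3 * b^-1 ^+ 2 * (x ^+ 2 * `|F x|).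
      by ring.
    move: j2 j3; rewrite e2 b1 mulr1 => j2 j3.
    lra.
  have I0 : I x = 0 by rewrite /I indicE (negbTE ex).
  rewrite /r I0 !mulr0 !addr0 subr0 mulr0 add0r.
  have [x0|x0] := boolP (x \in `[0, n]%classic); last first.
    by rewrite [\1_(`[0, n]) x]indicE (negbTE x0) !mulr0 normr0; lra.
  rewrite [\1_(`[0, n]) x]indicE x0 mulr1 normrM.
  have Fc : `|F x| * `|cs x| <= `|F x| by rewrite ler_piMr// cos_norm_le1.
  apply: le_trans Fc _; move: x0; rewrite inE/= in_itv/= => /andP[x0 xn].
  have [x1|x1] := leP x eps.
    have -> : \1_(`[0, eps]) x = 1 :> R by rewrite indicE mem_set//= in_itv/= x0.
    by rewrite mulr1; lra.
  have bx : b < x.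
    by rewrite ltNge; apply: contra ex => xb; rewrite inE/= in_itv/= (ltW x1).
  have x00 : 0 < x by exact: lt_trans bx.
  move: j3; rewrite (_ : \1_(`[b, n]) x = 1 :> R); last first.
    by rewrite indicE mem_set//= in_itv/= (ltW bx).
  rewrite mulr1 normrM (ger0_norm (_ : 0 <= x ^+ 2)) ?sqr_ge0//.
  rewrite (_ : x ^+ 2 * `|F x| * x^-1 ^+ 2 = `|F x|); last by field; rewrite gt_eqF.
  by rewrite normrM ger0_norm ?sqr_ge0 // in j5 *; lra.
have n0 : 0 <= n by rewrite (le_trans _ (ltW bn))// ltW.
have i1 := L1_integrable (L1_CS B0 (sqrtr_ge0 _) (profile_L2 FP) (L2_phase_itv alpha t y th n0)).
have i2 := L1_integrable Fr.
have e1 : \int[mu]_x (F x * (cs x * \1_(`[0, n]) x)) =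
    \int[mu]_x (F x * (x * psi' x * I x)) + \int[mu]_x (F x * r x).
  rewrite -RintegralD//.
    by apply: eq_Rintegral => x _; rewrite /r; ring.
  have := L1_integrable (L1_D (integrable_L1 i1) (L1_Z (-1) Fr)).
  by apply: eq_integrable => // x _ /=; congr EFin; rewrite /r /cs; ring.
rewrite e1; apply: le_trans (ler_normD _ _) _.
have FR := L1_Rintegral Fr.
(* With [se] below: each cutoff error costs, up to its coefficient, the same as the outer region
   next to it. *)
have sb : b^-1 ^+ 2 * Num.sqrt b = Num.sqrt (b^-1 ^+ 3).
  have -> : b^-1 ^+ 2 = Num.sqrt (b^-1 ^+ 4).
    by rewrite (_ : b^-1 ^+ 4 = (b^-1 ^+ 2) ^+ 2) ?sqrtr_sqr ?ger0_norm ?sqr_ge0//; ring.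
  rewrite -sqrtrM; last by rewrite exprn_ge0// invr_ge0 ltW.
  by congr Num.sqrt; field; rewrite gt_eqF.
have se : eps * Num.sqrt eps^-1 = Num.sqrt eps.
  have -> : eps * Num.sqrt eps^-1 = Num.sqrt (eps ^+ 2) * Num.sqrt eps^-1.
    by rewrite sqrtr_sqr ger0_norm.
  rewrite -sqrtrM ?sqr_ge0//; by congr Num.sqrt; field; rewrite gt_eqF.
rewrite !subr0 in FR.
have g1 : 0 <= 16 * A by rewrite mulr_ge0.
have g2 : 0 <= 2 * eps by rewrite mulr_ge0.
have g3 : 0 <= 3 * b^-1 ^+ 2 by apply: mulr_ge0 => //; exact: sqr_ge0.
rewrite (ger0_norm g1) (ger0_norm g2) (ger0_norm g3) in FR.
have q1 : 2 * eps * (B * Num.sqrt eps^-1) = 2 * B * Num.sqrt eps by rewrite -se; ring.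
have q2 : 3 * b^-1 ^+ 2 * (B * Num.sqrt b) = 3 * B * Num.sqrt (b^-1 ^+ 3) by rewrite -sb; ring.
rewrite q1 q2 in FR.
have q3 : 16 * A * (2 * pi / (alpha * c * b) + 2 * pi / (alpha * c * b)) = 64 * pi / (alpha * c) * A / b.
  by field; rewrite gt_eqF//= gt_eqF//= gt_eqF.
rewrite q3 in FR.
have q4 := ler_wpM2l B0 hs1; have q5 := ler_wpM2l B0 hs2.
lra.
Qed.

End Estimate.
End DispersiveIntegral.

(** * Fourier transform of the propagated function *)

Section Reflection.
Context {R : realType}.
Implicit Types (f g F : R -> R).
Local Notation mu := (@lebesgue_measure R).

Let measurable_opp : measurable_fun setT (-%R : R -> R).
Proof. exact: oppr_measurable. Qed.

Lemma ge0_integralN (f : R -> \bar R) : measurable_fun setT f ->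
  (forall x, 0 <= f x)%E -> (\int[mu]_x f (- x)%R = \int[mu]_x f x)%E.
Proof.
move=> mf f0.
transitivity (\int[pushforward mu (-%R : _ -> measurableTypeR R)]_x f x)%E.
  by rewrite ge0_integral_pushforward.
by apply: eq_measure_integral => //= A mA _; exact: lebesgue_measureN.
Qed.

Lemma RintegralN f : measurable_fun setT f ->
  \int[mu]_x f (- x) = \int[mu]_x f x.
Proof.
move=> mf; rewrite /Rintegral; congr fine; rewrite integralE [RHS]integralE; congr (_ - _)%E.
- rewrite -(ge0_integralN (f := (EFin \o f)^\+)%E)//; first by apply: eq_integral => x _; rewrite ?funeposE ?funenegE.
  by apply: measurable_funepos; exact/measurable_EFinP.
- rewrite -(ge0_integralN (f := (EFin \o f)^\-)%E)//; first by apply: eq_integral => x _; rewrite ?funeposE ?funenegE.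
  by apply: measurable_funeneg; exact/measurable_EFinP.
Qed.

Lemma aeN (P : R -> Prop) : {ae mu, forall x, P x} -> {ae mu, forall x, P (- x)}.
Proof.
move=> [N [mN N0 PN]]; exists (-%R @^-1` N); split.
- by rewrite -[X in measurable X]setTI; exact: measurable_opp.
- by have := lebesgue_measureN mN; rewrite /pushforward N0.
- by move=> x /= Px; apply: PN.
Qed.

Lemma measurable_reflect f : measurable_fun setT f -> measurable_fun setT (fun x : R => f (- x)).
Proof. by move=> mf; exact: measurableT_comp. Qed.

Lemma bcsN k (M m : R) : bcs k M m -> bcs (fun x => k (- x)) M m.
Proof.
move=> [mk kM k0]; split=> //; first exact: measurable_reflect.
by move=> x mx; apply: k0; rewrite normrN.
Qed.

Lemma cosTN th k (x : R) : measurable_fun setT k ->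
  cosT th (fun y => k (- y)) x = cosT (- th) k x.
Proof.
move=> mk; rewrite /cosT.
rewrite -[LHS]RintegralN; last first.
  by apply: measurable_funM; [exact: measurable_coslin|exact: measurable_reflect].
by apply: eq_Rintegral => y _; rewrite opprK -cosN; congr (cos _ * _); ring.
Qed.

(** Reflecting the frequency only changes the sign of the phases; [f] and [g] stay, so negative
    frequencies inherit the same bounds. *)
Lemma transform_pairN th1 th2 f g F : measurable_fun setT F ->
  transform_pair th1 th2 f g F ->
  transform_pair (- th1) (- th2) f g (fun x => F (- x)).
Proof.
move=> mF FP k M m bk; have mk : measurable_fun setT k by case: bk.
rewrite -RintegralN; last first.
  by apply: measurable_funM => //; exact: measurable_reflect.
under eq_Rintegral do rewrite opprK.
rewrite (FP _ _ _ (bcsN bk)); congr (_ + _).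
- by apply: eq_Rintegral => x _; rewrite cosTN.
- by apply: eq_Rintegral => x _; rewrite cosTN.
Qed.

End Reflection.

Section UniformEstimate.
Context {R : realType}.
Local Notation mu := (@lebesgue_measure R).

Lemma dispersive_integral (alpha p0 : R) : 3^-1 < alpha -> alpha < 1 ->
  0 < p0 -> p0 <= 8^-1 -> 1 + 2 * p0 <= alpha^-1 ->
  exists2 C : R, 0 < C & forall (A B t y th n : R) (F : R -> R), 0 <= A -> 0 <= B ->
    profile alpha A B F -> 0 < t -> 1 + t < n ->
    `|\int[mu]_x (F x * (cos (t * x `^ alpha - y * x + th) * \1_(`[0, n]) x))| <=
    C * ((1 + t) `^ (- 2^-1) * A + (1 + t) `^ (- (2^-1 + p0)) * B).
Proof.
move=> alpha3 alpha1 p00 p08 inva.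
have a0 : 0 < alpha by apply: lt_trans alpha3; rewrite invr_gt0.
pose c := alpha * (1 - alpha) / 2.
have c0 : 0 < c by rewrite /c divr_gt0// mulr_gt0// subr_gt0.
pose K1 := 64 * pi / (alpha * c); pose K2 := Num.sqrt (8 * pi / (alpha * c)) + 7.
have K10 : 0 <= K1 by rewrite /K1 divr_ge0 ?(ltW (mulr_gt0 a0 c0))// mulr_ge0 ?pi_ge0.
have K20 : 0 <= K2 by rewrite /K2 addr_ge0// sqrtr_ge0.
(* The 6 is for t <= 2, where the bound 2 B meets (1 + t)^s <= 3; the factors 2 convert powers of t
   into powers of 1 + t for t > 2. *)
exists (2 * K1 + 2 * K2 + 6); first by lra.
move=> A B t y th n F A0 B0 FP t0 tn.
have p07 : p0 <= 2^-1 by apply: le_trans p08 _; rewrite lef_pV2 ?posrE// ler_nat.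
pose s := 2^-1 + p0; have s0 : 0 < s by rewrite /s addr_gt0// invr_gt0.
have s1 : s <= 1 by rewrite /s; lra.
have u1 : 0 <= (1 + t) `^ (- 2^-1) by exact: powR_ge0.
have u2 : 0 <= (1 + t) `^ (- s) by exact: powR_ge0.
have aux : 0 <= (2 * K1 + 2 * K2 + 6) * ((1 + t) `^ (- 2^-1) * A).
  by rewrite mulr_ge0// ?mulr_ge0//; lra.
have aux2 : 0 <= (1 + t) `^ (- s) * B by rewrite mulr_ge0.
have [t2|t2] := leP t 2.
  apply: le_trans (dispersive_integral_small t y th B0 FP _) _; first by lra.
  have h3 : (1 + t) `^ s <= 3.
    have h : 3 `^ s <= 3 `^ 1 :> R by rewrite ler_powR//; lra.
    rewrite powRr1// in h; apply: le_trans h; apply: ge0_ler_powR; rewrite ?nnegrE ?(ltW s0)//; lra.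
  have h4 : 1 <= 3 * (1 + t) `^ (- s).
    by rewrite powRN -ler_pdivrMr ?invr_gt0 ?powR_gt0 ?invrK ?mul1r//; lra.
  have h5 : B <= 3 * ((1 + t) `^ (- s) * B) by rewrite mulrA ler_peMl.
  have h6 : 0 <= (2 * K1 + 2 * K2) * ((1 + t) `^ (- s) * B) by rewrite mulr_ge0//; lra.
  rewrite -/s; lra.
have tle r : 0 <= r -> r <= 1 -> t `^ (- r) <= 2 * (1 + t) `^ (- r).
  move=> r0 r1; rewrite !powRN -ler_pdivrMl// -invfM lef_pV2 ?posrE ?mulr_gt0 ?powR_gt0//; last by lra.
  apply: (@le_trans _ _ ((2 * t) `^ r)).
    by apply: ge0_ler_powR; rewrite ?nnegrE//; lra.
  rewrite powRM ?(ltW t0)// ler_wpM2r ?powR_ge0//.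
  have h : 2 `^ r <= 2 `^ 1 :> R by rewrite ler_powR//; lra.
  by rewrite powRr1// in h.
have st : Num.sqrt t < n.
  apply: le_lt_trans tn; rewrite -(ger0_norm (_ : 0 <= 1 + t)); last by lra.
  by rewrite -sqrtr_sqr ler_sqrt ?sqr_ge0//; nra.
apply: le_trans (dispersive_integral_large y th alpha3 alpha1 p08 inva A0 B0 FP (ltW t2) st) _.
rewrite -/c -/K1 -/K2 -/s -powR12_sqrt ?(ltW t0)// -powRN.
have h1 : t `^ (- 2^-1) <= 2 * (1 + t) `^ (- 2^-1) by apply: tle; lra.
have h2 : t `^ (- s) <= 2 * (1 + t) `^ (- s) by apply: tle => //; lra.
have h3 : K1 * A * t `^ (- 2^-1) <= K1 * A * (2 * (1 + t) `^ (- 2^-1)).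
  by apply: ler_wpM2l => //; exact: mulr_ge0.
have h4 : K2 * B * t `^ (- s) <= K2 * B * (2 * (1 + t) `^ (- s)).
  by apply: ler_wpM2l => //; exact: mulr_ge0.
have h5 : 0 <= (2 * K2 + 6) * ((1 + t) `^ (- 2^-1) * A).
  by rewrite mulr_ge0// ?mulr_ge0//; lra.
have h6 : 0 <= (2 * K1 + 6) * ((1 + t) `^ (- s) * B).
  by rewrite mulr_ge0//; lra.
apply: le_trans (lerD h3 h4) _.
rewrite -subr_ge0; apply: le_trans (addr_ge0 h5 h6) _.
by rewrite le_eqVlt; apply/orP; left; apply/eqP; ring.
Qed.

End UniformEstimate.

(** * From complex-valued functions to pairs of real ones *)

Section ComplexBridge.
Context {R : realType}.
Implicit Types (f g F G h : R -> R[i]) (c e : R).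
Local Notation mu := (@lebesgue_measure R).

Lemma sqr_normcE (z : R[i]) :
  Normc.normc z ^+ 2 = complex.Re z ^+ 2 + complex.Im z ^+ 2.
Proof. by case: z => a b /=; rewrite sqr_sqrtr// addr_ge0// sqr_ge0. Qed.

Lemma normc_ge0 (z : R[i]) : 0 <= Normc.normc z.
Proof. by case: z => a b /=; rewrite sqrtr_ge0. Qed.

Lemma CLnorm2_sqr h : (CLnorm 2%:E h `^ 2 =
  \int[mu]_x (complex.Re (h x) ^+ 2 + complex.Im (h x) ^+ 2)%:E)%E.
Proof.
rewrite /CLnorm poweR_Lnorm//; apply: eq_integral => x _.
by rewrite gee0_abs ?lee_fin ?normc_ge0// poweR_EFin powR_mulrn ?normc_ge0// sqr_normcE.
Qed.

Lemma CLnorm_L2 h c : 0 <= c -> Cmeasurable h -> (CLnorm 2%:E h <= c%:E)%E ->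
  L2_le (fun x => complex.Re (h x)) c /\ L2_le (fun x => complex.Im (h x)) c.
Proof.
move=> c0 [mr mi] hc.
have mX (k : R -> R) : measurable_fun setT k ->
    measurable_fun setT (fun x : R => (k x ^+ 2)%:E).
  by move=> mk; apply/measurable_EFinP; exact: measurable_funX.
have : (\int[mu]_x (complex.Re (h x) ^+ 2 + complex.Im (h x) ^+ 2)%:E <= (c ^+ 2)%:E)%E.
  rewrite -CLnorm2_sqr -powR_mulrn// -poweR_EFin gt0_ler_poweR//.
  - by rewrite in_itv/= Lnorm_ge0 leey.
  - by rewrite in_itv/= lee_fin c0 leey.
under eq_integral do rewrite EFinD.
rewrite ge0_integralD//; last first.
- exact: (mX _ mi).
- by move=> x _; rewrite lee_fin sqr_ge0.
- exact: (mX _ mr).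
- by move=> x _; rewrite lee_fin sqr_ge0.
move=> H; split; split => //; apply: le_trans H.
- by rewrite leeDl// integral_ge0// => x _; rewrite lee_fin sqr_ge0.
- by rewrite leeDr// integral_ge0// => x _; rewrite lee_fin sqr_ge0.
Qed.

Lemma in_L2_le h : in_L2 h -> forall c, (CLnorm 2%:E h <= c%:E)%E ->
  L2_le (fun x => complex.Re (h x)) c /\ L2_le (fun x => complex.Im (h x)) c.
Proof.
move=> [mh _] c hc; apply: CLnorm_L2 => //.
by rewrite -lee_fin (le_trans _ hc)// Lnorm_ge0.
Qed.

Lemma sin_cos_pihalf (x : R) : sin x = cos (x - pi / 2).
Proof. by rewrite cosB cos_pihalf sin_pihalf mulr0 mulr1 add0r. Qed.

Lemma Nsin_cos_pihalf (x : R) : - sin x = cos (x + pi / 2).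
Proof. by rewrite cosD cos_pihalf sin_pihalf mulr0 mulr1 add0r. Qed.

(** The real part of e^(-i x xi) f is cos Re f + sin Im f and the imaginary part cos Im f - sin Re
    f; writing the sines as shifted cosines fixes the phase pairs (0, -pi/2) and (0, pi/2). *)
Lemma fourier_truncE f n xi c : 0 <= c ->
  L2_le (fun x => complex.Re (f x)) c -> L2_le (fun x => complex.Im (f x)) c ->
  let f1 := cut n (fun x => complex.Re (f x)) in
  let f2 := cut n (fun x => complex.Im (f x)) in
  complex.Re (fourier_trunc f n xi) = cosT 0 f1 xi + cosT (- (pi / 2)) f2 xi /\
  complex.Im (fourier_trunc f n xi) = cosT 0 f2 xi + cosT (pi / 2) f1 xi.
Proof.
move=> c0 rc ic f1 f2.
have i1 := cut_integrable n c0 rc; have i2 := cut_integrable n c0 ic.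
split.
- rewrite /= -RintegralD//; [|exact: cosT_integrand|exact: cosT_integrand].
  rewrite [LHS]Rintegral_mkcond; apply: eq_Rintegral => x _; rewrite patchE.
  rewrite /f1 /f2 /cut indicE addr0 -sin_cos_pihalf.
  case: (f x) => a b; case: (x \in _); rewrite /= ?mulr1 ?mulr0 ?addr0//.
  by rewrite cosN sinN (mulrC xi); ring.
- rewrite /= -RintegralD//; [|exact: cosT_integrand|exact: cosT_integrand].
  rewrite [LHS]Rintegral_mkcond; apply: eq_Rintegral => x _; rewrite patchE.
  rewrite /f1 /f2 /cut indicE addr0 -Nsin_cos_pihalf.
  case: (f x) => a b; case: (x \in _); rewrite /= ?mulr1 ?mulr0 ?addr0//.
  by rewrite cosN sinN (mulrC xi); ring.
Qed.

Lemma measurable_cosT_cut th n (g : R -> R) c : 0 <= c -> L2_le g c ->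
  measurable_fun setT (cosT th (cut n g)).
Proof.
move=> c0 gc; apply: continuous_measurable_fun.
by apply: continuous_cosT_integrable; exact: cut_integrable c0 gc.
Qed.

Lemma Cmeasurable_fourier_trunc f n c : 0 <= c ->
  L2_le (fun x => complex.Re (f x)) c -> L2_le (fun x => complex.Im (f x)) c ->
  Cmeasurable (fourier_trunc f n).
Proof.
move=> c0 rc ic; split.
- rewrite (_ : _ \o _ = fun xi => cosT 0 (cut n (fun x => complex.Re (f x))) xi
      + cosT (- (pi / 2)) (cut n (fun x => complex.Im (f x))) xi).
    by apply: measurable_funD; exact: measurable_cosT_cut c0 _.
  by apply/funext => xi; exact: (fourier_truncE n xi c0 rc ic).1.
- rewrite (_ : _ \o _ = fun xi => cosT 0 (cut n (fun x => complex.Im (f x))) xi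
      + cosT (pi / 2) (cut n (fun x => complex.Re (f x))) xi).
    by apply: measurable_funD; exact: measurable_cosT_cut c0 _.
  by apply/funext => xi; exact: (fourier_truncE n xi c0 rc ic).2.
Qed.

Lemma ReB (z w : R[i]) : complex.Re (z - w) = complex.Re z - complex.Re w.
Proof. by case: z w => a b [c d]. Qed.

Lemma ImB (z w : R[i]) : complex.Im (z - w) = complex.Im z - complex.Im w.
Proof. by case: z w => a b [c d]. Qed.

Lemma CmeasurableB f g : Cmeasurable f -> Cmeasurable g ->
  Cmeasurable (fun x => f x - g x).
Proof.
move=> [rf jf] [rg jg]; split.
- rewrite (_ : _ \o _ = fun x => complex.Re (f x) - complex.Re (g x)).
    exact: measurable_funB.
  by apply/funext => x; exact: ReB.
- rewrite (_ : _ \o _ = fun x => complex.Im (f x) - complex.Im (g x)).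
    exact: measurable_funB.
  by apply/funext => x; exact: ImB.
Qed.

Lemma is_fourier_near f F e : is_fourier f F -> 0 < e -> \forall n \near \oo,
  Cmeasurable (fun xi => F xi - fourier_trunc f n xi) /\
  (CLnorm 2%:E (fun xi => F xi - fourier_trunc f n xi)%R <= e%:E)%E.
Proof.
move=> [Lf [mF _] FL] e0.
have [c c0 fc] : exists2 c, 0 <= c & (CLnorm 2%:E f <= c%:E)%E.
  have f0 : (0 <= CLnorm 2%:E f)%E by exact: Lnorm_ge0.
  exists (fine (CLnorm 2%:E f)); first exact: fine_ge0.
  by rewrite fineK// ge0_fin_numE//; case: Lf.
have [rc ic] := in_L2_le Lf fc.
have e1 : (0 < e%:E)%E by rewrite lte_fin.
have H := FL _ (open_ereal_lt' e1).
near=> n; split.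
  by apply: CmeasurableB => //; exact: Cmeasurable_fourier_trunc rc ic.
by apply: ltW; near: n; exact: H.
Unshelve. all: by end_near. Qed.

Lemma is_fourier_transform_pair f F b : is_fourier f F ->
  (CLnorm 2%:E f <= b%:E)%E ->
  transform_pair 0 (- (pi / 2)) (fun x => complex.Re (f x)) (fun x => complex.Im (f x))
    (fun x => complex.Re (F x)) /\
  transform_pair 0 (pi / 2) (fun x => complex.Im (f x)) (fun x => complex.Re (f x))
    (fun x => complex.Im (F x)).
Proof.
move=> FF fb; have [Lf LF FL] := FF.
have b0 : 0 <= b by rewrite -lee_fin (le_trans _ fb)// Lnorm_ge0.
have [rb ib] := in_L2_le Lf fb.
have F0 : (0 <= CLnorm 2%:E F)%E by exact: Lnorm_ge0.
pose B := fine (CLnorm 2%:E F).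
have FB : (CLnorm 2%:E F <= B%:E)%E by rewrite fineK// ge0_fin_numE//; case: LF.
have B0 : 0 <= B by exact: fine_ge0.
have [rB iB] := in_L2_le LF FB.
split.
- apply: (transform_pair_lim b0 B0 rb ib rB) => e e0.
  near=> n.
  have [mFn Fn] : Cmeasurable (fun xi => F xi - fourier_trunc f n xi) /\
    (CLnorm 2%:E (fun xi => F xi - fourier_trunc f n xi)%R <= e%:E)%E.
    by near: n; exact: is_fourier_near.
  have [h _] := CLnorm_L2 (ltW e0) mFn Fn.
  rewrite (_ : (fun x => _) = (fun x => complex.Re (F x - fourier_trunc f n x)))//.
  by apply/funext => x; rewrite ReB (fourier_truncE n x b0 rb ib).1.
- apply: (transform_pair_lim b0 B0 ib rb iB) => e e0.
  near=> n.
  have [mFn Fn] : Cmeasurable (fun xi => F xi - fourier_trunc f n xi) /\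
    (CLnorm 2%:E (fun xi => F xi - fourier_trunc f n xi)%R <= e%:E)%E.
    by near: n; exact: is_fourier_near.
  have [_ h] := CLnorm_L2 (ltW e0) mFn Fn.
  rewrite (_ : (fun x => _) = (fun x => complex.Im (F x - fourier_trunc f n x)))//.
  by apply/funext => x; rewrite ImB (fourier_truncE n x b0 rb ib).2.
Unshelve. all: by end_near. Qed.

Lemma ReZ (r : R) (z : R[i]) : complex.Re (r%:C%C * z) = r * complex.Re z.
Proof. by case: z => a b /=; rewrite mul0r subr0. Qed.

Lemma ImZ (r : R) (z : R[i]) : complex.Im (r%:C%C * z) = r * complex.Im z.
Proof. by case: z => a b /=; rewrite mul0r addr0. Qed.

Lemma is_weak_derivative_weak_deriv f g : is_weak_derivative f g ->
  weak_deriv (fun x => complex.Re (f x)) (fun x => complex.Re (g x)) /\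
  weak_deriv (fun x => complex.Im (f x)) (fun x => complex.Im (g x)).
Proof.
move=> [_ _ fg]; split=> phi tphi; have := fg phi tphi.
- move=> /(congr1 (@complex.Re R)) /= H.
  transitivity (\int[mu]_x complex.Re ((derive1 phi x)%:C%C * f x)).
    by apply: eq_Rintegral => x _; rewrite ReZ.
  by rewrite H; congr (- _); apply: eq_Rintegral => x _; rewrite ReZ.
- move=> /(congr1 (@complex.Im R)) /= H.
  transitivity (\int[mu]_x complex.Im ((derive1 phi x)%:C%C * f x)).
    by apply: eq_Rintegral => x _; rewrite ImZ.
  by rewrite H; congr (- _); apply: eq_Rintegral => x _; rewrite ImZ.
Qed.

End ComplexBridge.

Section Profiles.
Context {R : realType}.
Implicit Types (f F : R -> R[i]) (alpha A B b : R).
Local Notation mu := (@lebesgue_measure R).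

Lemma ae_imply (P Q : R -> Prop) : (forall x, P x -> Q x) ->
  {ae mu, forall x, P x} -> {ae mu, forall x, Q x}.
Proof. by move=> PQ; apply: negligibleS => x /= nQ /PQ. Qed.

(** Serves the default value: when no function qualifies as the transform of f, [fourier f] is
    identically 0. *)
Lemma profile0 alpha A B : 0 <= A -> 0 <= B -> profile alpha A B (fun=> 0).
Proof.
move=> A0 B0.
have h0 (g : R -> R) : (forall x, g x = 0) -> L2_le g B.
  move=> g0; split.
    by rewrite (_ : g = cst 0)//; apply/funext.
  by under eq_integral do rewrite g0 expr0n; rewrite integral0 lee_fin sqr_ge0.
split.
- by apply/aeW => x x0; rewrite normr0 mulr_ge0// powR_ge0.
- exact: h0.
- by apply: h0 => x; rewrite mulr0.
- move=> psi psi' p q c _ _ _ _ _ c0 _.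
  by under eq_Rintegral do rewrite mul0r; rewrite Rintegral_cst// mul0r normr0 mulr_ge0.
Qed.

Section RealProfile.
Variables (alpha A b th1 th2 : R) (f f1 f2 g g1 g2 F : R -> R).
Hypothesis b0 : 0 <= b.
Hypotheses (fb : L2_le f b) (f1b : L2_le f1 b) (f2b : L2_le f2 b).
Hypotheses (gb : L2_le g b) (g1b : L2_le g1 b) (g2b : L2_le g2 b).
Hypotheses (ff1 : weak_deriv f f1) (f12 : weak_deriv f1 f2).
Hypotheses (gg1 : weak_deriv g g1) (g12 : weak_deriv g1 g2).
Hypothesis xf1 : L2_le (fun x => x * f1 x) b.
Hypothesis xg1 : L2_le (fun x => x * g1 x) b.

Lemma transform_pair_profile : measurable_fun setT F ->
  {ae mu, forall x, 0 < x -> `|F x| <= A * x `^ (alpha / 2 - 1)} ->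
  transform_pair th1 th2 f g F -> profile alpha A (28 * pi * b) F.
Proof.
move=> mF FA FP; split=> //.
- exact: transform_pair_L2 FP.
- exact: (transform_pair_L2_sqr b0 fb f1b f2b ff1 f12 gb g1b g2b gg1 g12 mF FP).
- move=> psi psi' p q c pq dpsi cpsi' psip psiq c0 psic.
  have mf1 : measurable_fun setT f1 by case: f1b.
  have mg1 : measurable_fun setT g1 by case: g1b.
  exact: (transform_pair_dilation pq dpsi cpsi' psip psiq b0 c0 fb mf1 xf1 ff1 gb mg1 xg1 gg1 FP psic).
Qed.

End RealProfile.

Lemma in_L2_fine f : in_L2 f -> CLnorm 2%:E f = (fine (CLnorm 2%:E f))%:E.
Proof. by move=> [_ h]; rewrite fineK// ge0_fin_numE// Lnorm_ge0. Qed.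

Lemma sobolev_norm_fin f : in_sobolev 2 f -> sobolev_norm 2 f \is a fin_num.
Proof.
move=> [Lf _]; rewrite /sobolev_norm.
rewrite (eq_bigr (fun k : 'I_3 =>
    (fine (CLnorm 2%:E (iter k (@weak_derivative R) f)) ^+ 2)%:E)); last first.
  by move=> [k k3] _; rewrite {1}(in_L2_fine (Lf k k3)) EFin_expe.
by rewrite sumEFin poweR_EFin.
Qed.

Lemma sobolev_norm_ge f k : in_sobolev 2 f -> (k <= 2)%N ->
  (CLnorm 2%:E (iter k (@weak_derivative R) f) <= sobolev_norm 2 f)%E.
Proof.
move=> [Lf _] k2; have Lk := Lf k k2.
have c0 : 0 <= fine (CLnorm 2%:E (iter k (@weak_derivative R) f)) by rewrite fine_ge0// Lnorm_ge0.
rewrite /sobolev_norm (in_L2_fine Lk).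
rewrite -[leLHS](_ : (((fine (CLnorm 2%:E (iter k (@weak_derivative R) f)) ^+ 2)%:E `^ 2^-1) = _)%E); last first.
  by rewrite poweR_EFin powR12_sqrt ?sqr_ge0// sqrtr_sqr ger0_norm.
have sq0 (i : 'I_3) : (0 <= CLnorm 2%:E (iter i (@weak_derivative R) f) ^+ 2)%E.
  by rewrite expe_ge0// Lnorm_ge0.
apply: gt0_ler_poweR.
- by rewrite invr_ge0.
- by rewrite in_itv/= lee_fin sqr_ge0 leey.
- by rewrite in_itv/= leey andbT; apply: sume_ge0 => i _; exact: sq0.
- rewrite (bigD1 (Ordinal (k2 : (k < 3)%N)))//= (in_L2_fine Lk) EFin_expe leeDl//.
  by apply: sume_ge0 => i _; exact: sq0.
Qed.

Lemma CLnorm_infty_le f (A : R) : (CLnorm +oo f <= A%:E)%E <->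
  {ae mu, forall x, Normc.normc (f x) <= A}.
Proof.
(* The norm with exponent infinity is an essential supremum only on a space of positive measure. *)
have mu0 : (0 < mu setT)%E.
  apply: (@lt_le_trans _ _ (mu `[0%R, 1%R])); first by rewrite lebesgue_measure_itv/= lte01 oppr0 adde0 lte01.
  by apply: le_measure => //; rewrite inE.
rewrite /CLnorm unlock /Lnorm mu0; split.
- move=> /ess_supP; apply: ae_imply => x.
  by rewrite /= lee_fin ger0_norm ?normc_ge0.
- move=> h; apply/ess_supP; apply: ae_imply h => x.
  by rewrite /= lee_fin ger0_norm ?normc_ge0.
Qed.

Lemma normcZ (r : R) (z : R[i]) : 0 <= r -> Normc.normc (r%:C%C * z) = r * Normc.normc z.
Proof.
by move=> r0; rewrite Normc.normcM /= expr0n/= addr0 sqrtr_sqr ger0_norm.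
Qed.

(** Dividing by the weight, which vanishes at the origin, turns its exponent into alpha / 2 - 1. *)
Lemma weighted_fourier_ae alpha f A : (CLnorm +oo (weighted_fourier alpha f) <= A%:E)%E ->
  {ae mu, forall x, x != 0 -> Normc.normc (fourier f x) <= A * `|x| `^ (alpha / 2 - 1)}.
Proof.
move=> /CLnorm_infty_le; apply: ae_imply => x.
rewrite /weighted_fourier normcZ ?powR_ge0// => h x0.
have x1 : 0 < `|x| by rewrite normr_gt0.
have e1 : `|x| `^ ((2 - alpha) / 2) * `|x| `^ (alpha / 2 - 1) = 1.
  rewrite -powRD; last by rewrite (gt_eqF x1) implybT.
  have -> : (2 - alpha) / 2 + (alpha / 2 - 1) = 0 by field.
  by rewrite powRr0.
rewrite -[leLHS]mulr1 -[X in _ * X <= _]e1 mulrA; apply: ler_wpM2r; first exact: powR_ge0.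
by rewrite mulrC.
Qed.

Lemma normc_Re_le (z : R[i]) : `|complex.Re z| <= Normc.normc z.
Proof.
case: z => a b /=; rewrite -sqrtr_sqr ler_sqrt ?addr_ge0 ?sqr_ge0//.
by rewrite lerDl sqr_ge0.
Qed.

Lemma normc_Im_le (z : R[i]) : `|complex.Im z| <= Normc.normc z.
Proof.
case: z => a b /=; rewrite -sqrtr_sqr ler_sqrt ?addr_ge0 ?sqr_ge0//.
by rewrite lerDr sqr_ge0.
Qed.

Lemma fourier_profile alpha A b f : 0 <= A -> in_sobolev 2 f ->
  (sobolev_norm 2 f <= b%:E)%E -> (CLnorm 2%:E (x_partial f) <= b%:E)%E ->
  (CLnorm +oo (weighted_fourier alpha f) <= A%:E)%E ->
  let F1 x := complex.Re (fourier f x) in let F2 x := complex.Im (fourier f x) in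
  let B := 28 * pi * b in
  [/\ profile alpha A B F1, profile alpha A B F2,
      profile alpha A B (fun x => F1 (- x)) & profile alpha A B (fun x => F2 (- x))].
Proof.
move=> A0 sf fb xb /weighted_fourier_ae FA F1 F2 B.
have b0 : 0 <= b by rewrite -lee_fin (le_trans _ xb)// Lnorm_ge0.
have B0 : 0 <= B by rewrite !mulr_ge0 ?pi_ge0.
have [FE|nF] := pselect (exists F, is_fourier f F); last first.
  have h0 : fourier f = fun=> 0 by apply: xgetPN => G fG; apply: nF; exists G.
  by rewrite /F1 /F2 h0; split; exact: profile0.
have {FE} FF : is_fourier f (fourier f) by exact: (xgetPex (fun=> 0) FE).
have [Lf Wf] := sf.
have Nf k : (k <= 2)%N -> (CLnorm 2%:E (iter k (@weak_derivative R) f) <= b%:E)%E.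
  by move=> k2; apply: le_trans (sobolev_norm_ge sf k2) fb.
have [r0 i0] := in_L2_le (Lf 0 isT) (Nf 0 isT).
have [r1 i1] := in_L2_le (Lf 1 isT) (Nf 1 isT).
have [r2 i2] := in_L2_le (Lf 2 isT) (Nf 2 isT).
have [wr1 wi1] := is_weak_derivative_weak_deriv (Wf 0 isT).
have [wr2 wi2] := is_weak_derivative_weak_deriv (Wf 1 isT).
have [xr xi] : L2_le (fun x => x * complex.Re (weak_derivative f x)) b /\
    L2_le (fun x => x * complex.Im (weak_derivative f x)) b.
  have [mr mi] : Cmeasurable (x_partial f).
    have [[m1 m2] _] := Lf 1 isT; split.
    - rewrite (_ : _ \o _ = fun x => x * complex.Re (weak_derivative f x)).
        by apply: measurable_funM.
      by apply/funext => x; rewrite /= ReZ.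
    - rewrite (_ : _ \o _ = fun x => x * complex.Im (weak_derivative f x)).
        by apply: measurable_funM.
      by apply/funext => x; rewrite /= ImZ.
  have [hr hi] := CLnorm_L2 b0 (conj mr mi) xb.
  split.
  - by move: hr; under eq_fun do rewrite ReZ.
  - by move: hi; under eq_fun do rewrite ImZ.
have [P1 P2] := is_fourier_transform_pair FF (Nf 0 isT).
have [mF1 mF2] : measurable_fun setT F1 /\ measurable_fun setT F2.
  by have [_ [[? ?] _] _] := FF.
have P1N := transform_pairN mF1 P1; have P2N := transform_pairN mF2 P2.
have mF1N := measurable_reflect mF1; have mF2N := measurable_reflect mF2.
have w (G : R -> R) : (forall x, `|G x| <= Normc.normc (fourier f x)) ->
    {ae mu, forall x, 0 < x -> `|G x| <= A * x `^ (alpha / 2 - 1)} /\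
    {ae mu, forall x, 0 < x -> `|G (- x)| <= A * x `^ (alpha / 2 - 1)}.
  move=> GF; split.
  - apply: ae_imply FA => x h x0; apply: le_trans (GF x) _.
    by have := h (lt0r_neq0 x0); rewrite gtr0_norm.
  - apply: ae_imply (aeN FA) => x h x0; apply: le_trans (GF (- x)) _.
    by have := h; rewrite oppr_eq0 normrN gtr0_norm// => ->//; exact: lt0r_neq0.
have [w1 w1'] := w F1 (fun x => normc_Re_le _).
have [w2 w2'] := w F2 (fun x => normc_Im_le _).
split.
- exact: (transform_pair_profile b0 r0 r1 r2 i0 i1 i2 wr1 wr2 wi1 wi2 xr xi mF1 w1 P1).
- exact: (transform_pair_profile b0 i0 i1 i2 r0 r1 r2 wi1 wi2 wr1 wr2 xi xr mF2 w2 P2).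
- exact: (transform_pair_profile b0 r0 r1 r2 i0 i1 i2 wr1 wr2 wi1 wi2 xr xi mF1N w1' P1N).
- exact: (transform_pair_profile b0 i0 i1 i2 r0 r1 r2 wi1 wi2 wr1 wr2 xi xr mF2N w2' P2N).
Qed.

End Profiles.

(** * Truncated inverse transforms and their limit *)

Section TruncatedPropagator.
Context {R : realType}.
Implicit Types (G : R -> R) (F H : R -> R[i]) (alpha A B M t y th : R) (n : nat).
Local Notation mu := (@lebesgue_measure R).
Local Notation integr f := (mu.-integrable setT (EFin \o f)).

Definition phase alpha t xi th (x : R) : R := cos (t * `|x| `^ alpha - x * xi + th).

Let measurable_abs_phase alpha t xi th : measurable_fun setT (phase alpha t xi th).
Proof.
apply: measurableT_comp; first by apply: continuous_measurable_fun; exact: continuous_cos.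
apply: measurable_funD => //; apply: measurable_funB; last exact: measurable_funM.
apply: measurable_funM => //.
rewrite (_ : (fun x => _) = (@powR R ^~ alpha) \o (fun x : R => `|x|))//.
by apply: measurableT_comp => //; exact: measurableT_comp.
Qed.

Lemma integrable_abs_phase alpha t xi th n G B : 0 <= B -> L2_le G B ->
  integr (fun x => G x * (phase alpha t xi th x * \1_(`[- n%:R, n%:R]) x)).
Proof.
move=> B0 GB; have h := L2_indic_itv (ler0n R n).
have p : L2_le (fun x => phase alpha t xi th x * \1_(`[- n%:R, n%:R]) x) (Num.sqrt (2 * n%:R)).
  apply: (L2_dom h).
    by apply: measurable_funM; [exact: measurable_abs_phase|exact: measurable_indic].
  by move=> x; rewrite normrM ler_piMl// cos_norm_le1.
exact: L1_integrable (L1_CS B0 (sqrtr_ge0 _) GB p).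
Qed.

(** The two half-lines are treated separately, whence the factor 2. Reflection replaces [xi] by its
    opposite, so the half-line bounds are required for every [y]. *)
Lemma symmetric_dispersive_integral alpha t xi th n G B M : 0 <= B -> L2_le G B ->
  (forall y, `|\int[mu]_x (G x *
     (cos (t * x `^ alpha - y * x + th) * \1_(`[0, n%:R]) x))| <= M) ->
  (forall y, `|\int[mu]_x (G (- x) *
     (cos (t * x `^ alpha - y * x + th) * \1_(`[0, n%:R]) x))| <= M) ->
  `|\int[mu]_x (G x * (phase alpha t xi th x * \1_(`[- n%:R, n%:R]) x))| <= 2 * M.
Proof.
move=> B0 GB M1 M2.
pose I (x : R) : R := \1_(`[0, n%:R]) x.
have mI : measurable_fun setT I by exact: measurable_indic.
have mNI : measurable_fun setT (fun x : R => I (- x)) by exact: measurable_reflect.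
have mG : measurable_fun setT G by case: GB.
have mp := measurable_abs_phase alpha t xi th.
pose u (x : R) : R := G x * (phase alpha t xi th x * I x).
pose v (x : R) : R := G x * (phase alpha t xi th x * I (- x)).
have mu_ : measurable_fun setT u by do 2 apply: measurable_funM => //.
have mv : measurable_fun setT v by do 2 apply: measurable_funM => //.
have ip := integrable_abs_phase alpha t xi th n B0 GB.
have dom (J : R -> R) : (forall x, `|J x| <= `|\1_(`[- n%:R, n%:R]) x : R|) ->
    measurable_fun setT (fun x => G x * (phase alpha t xi th x * J x)) ->
    integr (fun x => G x * (phase alpha t xi th x * J x)).
  move=> JI mJ; apply: L1_integrable (L1_dom (integrable_L1 ip) mJ _) => x.
  by rewrite !normrM !ler_wpM2l.
have iu : integr u.
  apply: dom => // x; rewrite /I !indicE.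
  have [|_] := boolP (x \in `[0, n%:R]%classic); last by rewrite normr0.
  rewrite inE/= in_itv/= => /andP[x0 xn]; rewrite mem_set//= in_itv/= xn andbT.
  by apply: le_trans x0; rewrite oppr_le0.
have iv : integr v.
  apply: dom => // x; rewrite /I !indicE.
  have [|_] := boolP (- x \in `[0, n%:R]%classic); last by rewrite normr0.
  rewrite inE/= in_itv/= => /andP[x0 xn]; rewrite mem_set//= in_itv/=.
  by rewrite lerNl xn/=; apply: (@le_trans _ _ 0); rewrite // -oppr_ge0.
have -> : \int[mu]_x (G x * (phase alpha t xi th x * \1_(`[- n%:R, n%:R]) x)) =
    \int[mu]_x (u x + v x).
  rewrite /Rintegral; congr fine; apply: ae_eq_integral => //.
  - exact: measurable_int ip.
  - by apply/measurable_EFinP; exact: measurable_funD.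
  (* Both closed halves contain the origin, so the integrands agree only off this null set. *)
  - exists [set 0]; split => //; first exact: lebesgue_measure_set1.
    move=> x /= h; apply: contrapT => x0; apply: h => _; congr EFin.
    rewrite /u /v -mulrDr -mulrDr; congr (_ * (_ * _)).
    rewrite /I !indicE.
    have [xn|xn] := boolP (x \in `[- n%:R, n%:R]%classic).
      move: xn; rewrite inE/= in_itv/= => /andP[nx xn].
      have [x1|x1|x1] := ltgtP x 0; last by case: x0.
      + rewrite memNset/=; last by rewrite in_itv/= => /andP[]; rewrite leNgt x1.
        by rewrite mem_set ?add0r//= in_itv/= lerNl nx oppr_ge0 ltW.
      + rewrite mem_set/=; last by rewrite in_itv/= xn ltW.
        by rewrite memNset ?addr0//= in_itv/= oppr_ge0 leNgt x1.
    rewrite memNset; last first.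
      move=> /=; rewrite in_itv/= => /andP[x1 x2]; move/negP: xn; apply.
      by rewrite inE/= in_itv/= x2 andbT (le_trans _ x1)// oppr_le0.
    rewrite memNset ?addr0//= in_itv/= oppr_ge0 => /andP[x1 x2].
    move/negP: xn; apply; rewrite inE/= in_itv/= lerNl x2/=.
    exact: (le_trans x1).
rewrite RintegralD// mulr2n mulrDl mul1r; apply: le_trans (ler_normD _ _) _; apply: lerD.
- apply: le_trans (M1 xi); rewrite le_eqVlt; apply/orP; left; apply/eqP; congr `|_|.
  apply: eq_Rintegral => x _; rewrite /u /phase /I indicE.
  have [|_] := boolP (x \in `[0, n%:R]%classic); last by rewrite !mulr0.
  by rewrite inE/= in_itv/= => /andP[x0 _]; rewrite ger0_norm// (mulrC x).
- rewrite -RintegralN//.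
  apply: le_trans (M2 (- xi)); rewrite le_eqVlt; apply/orP; left; apply/eqP; congr `|_|.
  apply: eq_Rintegral => x _; rewrite /v /phase /I opprK !indicE.
  have [|_] := boolP (x \in `[0, n%:R]%classic); last by rewrite !mulr0.
  by rewrite inE/= in_itv/= => /andP[x0 _]; rewrite normrN ger0_norm// !mulNr (mulrC x).
Qed.

(** The factor 4 counts the real and imaginary parts of the result, each made of one integral
    against Re F and one against Im F. *)
Lemma fourier_trunc_phase_le alpha t xi n F B M : 0 <= B ->
  L2_le (fun x => complex.Re (F x)) B -> L2_le (fun x => complex.Im (F x)) B ->
  (forall th, `|\int[mu]_x (complex.Re (F x) *
     (phase alpha t xi th x * \1_(`[- n%:R, n%:R]) x))| <= M) ->
  (forall th, `|\int[mu]_x (complex.Im (F x) *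
     (phase alpha t xi th x * \1_(`[- n%:R, n%:R]) x))| <= M) ->
  Normc.normc (fourier_trunc (fun x => cexpi (t * `|x| `^ alpha) * F x) n xi) <= 4 * M.
Proof.
move=> B0 rB iB rM iM.
have ir th := integrable_abs_phase alpha t xi th n B0 rB.
have ii th := integrable_abs_phase alpha t xi th n B0 iB.
have triv (z : R[i]) : Normc.normc z <= `|complex.Re z| + `|complex.Im z|.
  case: z => a b /=; rewrite -[leRHS]ger0_norm ?addr_ge0// -sqrtr_sqr ler_sqrt ?sqr_ge0//.
  rewrite -(real_normK (num_real a)) -(real_normK (num_real b)) sqrrD.
  by rewrite lerD2r lerDl mulrn_wge0// mulr_ge0.
apply: le_trans (triv _) _.
rewrite (_ : 4 * M = (M + M) + (M + M)); last by ring.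
apply: lerD.
- rewrite (_ : complex.Re _ = \int[mu]_x (complex.Re (F x) *
      (phase alpha t xi 0 x * \1_(`[- n%:R, n%:R]) x)) + \int[mu]_x (complex.Im (F x) *
      (phase alpha t xi (pi / 2) x * \1_(`[- n%:R, n%:R]) x))).
    by apply: le_trans (ler_normD _ _) _; exact: lerD.
  rewrite -RintegralD// /= [LHS]Rintegral_mkcond; apply: eq_Rintegral => x _.
  rewrite patchE indicE /phase -Nsin_cos_pihalf addr0.
  case: (F x) => a b; case: (x \in _); rewrite /= ?mulr1 ?mulr0 ?addr0//.
  by rewrite cosN sinN cosB sinB; ring.
- rewrite (_ : complex.Im _ = \int[mu]_x (complex.Im (F x) *
      (phase alpha t xi 0 x * \1_(`[- n%:R, n%:R]) x)) + \int[mu]_x (complex.Re (F x) *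
      (phase alpha t xi (- (pi / 2)) x * \1_(`[- n%:R, n%:R]) x))).
    by apply: le_trans (ler_normD _ _) _; exact: lerD.
  rewrite -RintegralD// /= [LHS]Rintegral_mkcond; apply: eq_Rintegral => x _.
  rewrite patchE indicE /phase -sin_cos_pihalf addr0.
  case: (F x) => a b; case: (x \in _); rewrite /= ?mulr1 ?mulr0 ?addr0//.
  by rewrite cosN sinN cosB sinB; ring.
Qed.

End TruncatedPropagator.

Section FourierBound.
Context {R : realType}.
Local Notation mu := (@lebesgue_measure R).

(** The excess [k] of |G| over M is at most the distance from G to any truncated transform bounded
    by M. These distances tend to 0 in L^2, so [k] vanishes almost everywhere. *)
Lemma fourier_le_ae (H G : R -> R[i]) (M : R) : is_fourier H G ->
  (\forall n \near \oo, forall xi, Normc.normc (fourier_trunc H n xi) <= M) ->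
  {ae mu, forall xi, Normc.normc (G xi) <= M}.
Proof.
move=> HG HM; have [_ [[mr mi] _] _] := HG.
pose k x := Num.max 0 (Normc.normc (G x) - M).
have mN : measurable_fun setT (fun x => Normc.normc (G x)).
  rewrite (_ : (fun x => _) = (fun x : R => Num.sqrt (complex.Re (G x) ^+ 2 + complex.Im (G x) ^+ 2))).
    apply: measurableT_comp; first by apply: continuous_measurable_fun; exact: sqrt_continuous.
    by apply: measurable_funD; apply: measurable_funX.
  by apply/funext => x; rewrite -sqr_normcE sqrtr_sqr ger0_norm ?normc_ge0.
have mk : measurable_fun setT k by apply: measurable_maxr => //; exact: measurable_funB.
have k0 x : 0 <= k x by rewrite le_max lexx.
have mk2 : measurable_fun setT (fun x => (k x ^+ 2)%:E).
  by apply/measurable_EFinP; exact: measurable_funX.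
have ke e : 0 < e -> (\int[mu]_x (k x ^+ 2)%:E <= (e ^+ 2)%:E)%E.
  move=> e0; near \oo => n.
  have [[mrn min_] Hn] : Cmeasurable (fun xi => G xi - fourier_trunc H n xi) /\
    (CLnorm 2%:E (fun xi => G xi - fourier_trunc H n xi)%R <= e%:E)%E.
    by near: n; exact: is_fourier_near.
  have Mn xi : Normc.normc (fourier_trunc H n xi) <= M by move: xi; near: n.
  apply: (@le_trans _ _ (CLnorm 2%:E (fun xi => G xi - fourier_trunc H n xi)%R `^ 2)%E).
    rewrite CLnorm2_sqr; apply: ge0_le_integral => //.
    - by move=> x _; rewrite lee_fin sqr_ge0.
    - by apply/measurable_EFinP; apply: measurable_funD; exact: measurable_funX.
    - move=> x _; rewrite lee_fin -sqr_normcE lerXn2r ?nnegrE ?normc_ge0//.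
      rewrite ge_max normc_ge0/= lerBlDr.
      rewrite -{1}(subrK (fourier_trunc H n x) (G x)).
      by apply: le_trans (le_normcD _ _) _; rewrite lerD2l.
  rewrite -(powR_mulrn _ (ltW e0)) -poweR_EFin gt0_ler_poweR//.
  - by rewrite in_itv/= Lnorm_ge0 leey.
  - by rewrite in_itv/= lee_fin (ltW e0) leey.
have I0 : (\int[mu]_x (k x ^+ 2)%:E = 0)%E.
  apply/eqP; rewrite eq_le integral_ge0 ?andbT; last by move=> x _; rewrite lee_fin sqr_ge0.
  apply/lee_addgt0Pr => e e0; rewrite add0e.
  have s0 : 0 < Num.sqrt e by rewrite sqrtr_gt0.
  by have := ke _ s0; rewrite sqr_sqrtr// ltW.
have : ae_eq mu setT (fun x => (k x ^+ 2)%:E) (cst 0%E).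
  apply/(ae_eq_integral_abs mu measurableT) => //.
  under eq_integral do rewrite gee0_abs ?lee_fin ?sqr_ge0//.
  by rewrite I0.
apply: ae_imply => x /(_ I) [] /eqP; rewrite sqrf_eq0 => /eqP kx.
by rewrite -subr_le0 -kx le_max lexx orbT.
Unshelve. all: by end_near. Qed.

End FourierBound.

Local Open Scope complex_scope.

Section DispersiveEstimate.
Context {R : realType}.

Lemma frac_propagator_le (alpha t M : R) (f : R -> R[i]) : 0 <= M ->
  (forall G, is_fourier (fun xi => cexpi (t * `|xi| `^ alpha) * fourier f xi) G ->
   \forall n \near \oo, forall x, Normc.normc
     (fourier_trunc (fun xi => cexpi (t * `|xi| `^ alpha) * fourier f xi) n x) <= M) ->
  (CLnorm +oo (frac_propagator alpha t f) <= M%:E)%E.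
Proof.
move=> M0 HM; apply/CLnorm_infty_le.
rewrite /frac_propagator /fourier_multiplier /inv_fourier.
set H := fun xi : R => _ in HM *.
have HMae : {ae (@lebesgue_measure R), forall x, Normc.normc (fourier H x) <= M}.
  have [GE|nG] := pselect (exists G, is_fourier H G).
    have FH : is_fourier H (fourier H) by exact: (xgetPex (fun=> 0) GE).
    exact: (fourier_le_ae FH (HM _ FH)).
  (* Without a transform, the default value 0 satisfies any nonnegative bound. *)
  have -> : fourier H = fun=> 0 by apply: xgetPN => G HG; apply: nG; exists G.
  by apply/aeW => x; rewrite Normc.normc0.
have p0 : 0 <= (2 * pi : R)^-1 by rewrite invr_ge0 mulr_ge0// pi_ge0.
apply: ae_imply (aeN HMae) => x h.
rewrite normcZ//; apply: le_trans h; rewrite ler_piMl ?normc_ge0//.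
(* The normalising factor 1 / (2 pi) is at most 1 and is discarded. *)
by rewrite invf_le1 ?mulr_gt0 ?pi_gt0//; have := pi_ge2 R; lra.
Qed.

End DispersiveEstimate.

Theorem lemma3p1 (R : realType) (alpha p0 : R)
    (halpha : 3^-1 < alpha /\ alpha < 1)
    (hp0 : 0 < p0 /\ p0 <= 1000^-1)
    (halphap0 : alpha <= (1 + 2 * p0)^-1) :
  exists C : R, 0 < C /\
    forall (t : R) (f : R -> R[i]),
      0 < t ->
      in_sobolev 2 f ->
      (CLnorm 2%:E (x_partial f) < +oo)%E ->
      (CLnorm +oo (weighted_fourier alpha f) < +oo)%E ->
      (CLnorm +oo (frac_propagator alpha t f) <=
       C%:E *
       (((1 + t) `^ (- 2^-1))%:E * CLnorm +oo (weighted_fourier alpha f) +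
        ((1 + t) `^ (- (2^-1 + p0)))%:E *
          (sobolev_norm 2 f + CLnorm 2%:E (x_partial f))))%E.
Proof.
have [alpha3 alpha1] := halpha; have [p00 p01] := hp0.
have a0 : 0 < alpha by apply: lt_trans alpha3; rewrite invr_gt0.
have p08 : p0 <= 8^-1 by apply: le_trans p01 _; rewrite lef_pV2 ?posrE ?ltr0n ?ler_nat.
clear hp0 p01.
have inva : 1 + 2 * p0 <= alpha^-1.
  by rewrite -[leLHS]invrK lef_pV2 ?posrE ?invr_gt0//; apply: ltr_wpDr; rewrite ?mulr_ge0// ltW.
have [C1 C10 HC] := dispersive_integral alpha3 alpha1 p00 p08 inva.
have pi2 : 2 <= pi :> R by exact: pi_ge2.
(* 8 = 4 * 2 counts the four real integrals and the two half-lines; 28 pi is the profile constant,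
   and being at least 1 it may also multiply the weighted term. *)
exists (8 * C1 * (28 * pi)); split; first by rewrite !mulr_gt0 ?pi_gt0.
move=> t f t0 sf xf wf.
have fin (p : \bar R) (h : R -> R[i]) : (CLnorm p h < +oo)%E ->
    CLnorm p h = (fine (CLnorm p h))%:E.
  by move=> hp; rewrite fineK// ge0_fin_numE// Lnorm_ge0.
have nn (p : \bar R) (h : R -> R[i]) : 0 <= fine (CLnorm p h).
  by rewrite fine_ge0// Lnorm_ge0.
pose A := fine (CLnorm +oo (weighted_fourier alpha f)).
pose X := fine (CLnorm 2%:E (x_partial f)).
pose S := fine (sobolev_norm 2 f).
have wE : CLnorm +oo (weighted_fourier alpha f) = A%:E by exact: fin.
have xE : CLnorm 2%:E (x_partial f) = X%:E by exact: fin.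
have sE : sobolev_norm 2 f = S%:E by rewrite fineK// sobolev_norm_fin.
have A0 : 0 <= A by exact: nn.
have X0 : 0 <= X by exact: nn.
have S0 : 0 <= S by rewrite fine_ge0// poweR_ge0.
(* A profile carries a single L^2 constant, so both norms are bounded by their sum. *)
have sb : (sobolev_norm 2 f <= (S + X)%:E)%E by rewrite sE lee_fin lerDl.
have xb : (CLnorm 2%:E (x_partial f) <= (S + X)%:E)%E by rewrite xE lee_fin lerDr.
have wA : (CLnorm +oo (weighted_fourier alpha f) <= A%:E)%E by rewrite wE.
have [P1 P2 P3 P4] := fourier_profile A0 sf sb xb wA.
pose B := 28 * pi * (S + X).
have B0 : 0 <= B by rewrite mulr_ge0 ?addr_ge0// mulr_ge0// pi_ge0.
pose u1 := (1 + t) `^ (- 2^-1); pose u2 := (1 + t) `^ (- (2^-1 + p0)).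
have u10 : 0 <= u1 by exact: powR_ge0.
have u20 : 0 <= u2 by exact: powR_ge0.
pose M := C1 * (u1 * A + u2 * B).
have M0 : 0 <= M by rewrite mulr_ge0 ?(ltW C10)// addr_ge0// mulr_ge0.
apply: (@le_trans _ _ (8 * M)%:E); last first.
  rewrite wE xE sE.
  rewrite -[leRHS]/((8 * C1 * (28 * pi) * (u1 * A + u2 * (S + X)))%:E) lee_fin /M.
  rewrite (_ : 8 * C1 * (28 * pi) * (u1 * A + u2 * (S + X)) =
    8 * (C1 * (28 * pi * (u1 * A) + u2 * B))); last by rewrite /B; ring.
  rewrite ler_wpM2l// ler_wpM2l ?(ltW C10)// lerD2r ler_peMl ?mulr_ge0//; lra.
apply: frac_propagator_le => [|G HG]; first by rewrite mulr_ge0.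
near=> n => xi.
(* The truncation must eventually pass the frequency t^(1/2) and 1; how late may depend on t, since
   the bound itself does not depend on n. *)
have tn : 1 + t < n%:R.
  near: n; exists (Num.truncn (1 + t)).+1 => // n /= tn.
  by apply: lt_le_trans (truncnS_gt _) _; rewrite ler_nat.
have rB := profile_L2 P1; have iB := profile_L2 P2.
rewrite (_ : 8 * M = 4 * (2 * M)); last by ring.
apply: (fourier_trunc_phase_le B0 rB iB) => th.
- exact: (symmetric_dispersive_integral xi B0 rB
    (fun y => HC A B t y th n%:R _ A0 B0 P1 t0 tn) (fun y => HC A B t y th n%:R _ A0 B0 P3 t0 tn)).
- exact: (symmetric_dispersive_integral xi B0 iB
    (fun y => HC A B t y th n%:R _ A0 B0 P2 t0 tn) (fun y => HC A B t y th n%:R _ A0 B0 P4 t0 tn)).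
Unshelve. all: by end_near. Qed.
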